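(* Let $n\ge 1$ and $k\ge 0$. The coefficient of $x^k$ in the toric $g$-polynomial of the $n$-dimensional cyclohedron is the number of $123$-avoiding functions $f:[n]\to[n]$ having exactly $k$ ascents.
   Context: $[n]=\{1,\ldots,n\}$. The $n$-dimensional cyclohedron (type $B$ associahedron) is the simple polytope whose nonempty faces correspond to the centrally symmetric sets of pairwise noncrossing diagonals of a centrally symmetric convex $(2n+2)$-gon, ordered by reverse inclusion. Toric $g$-polynomial: for an Eulerian poset $P$ with rank function $\rho$, minimum $\hat 0$ and maximum $\hat 1$, the polynomials $f(P,x)$ and $g(P,x)$ are defined recursively. For the one-element poset, $f=g=1$. If $\operatorname{rank} P=n+1>0$, then $f(P,x)=\sum_{y\in P\setminus\{\hat 1\}} g([\hat 0,y],x)(x-1)^{n-\rho(y)}$; writing $f(P,x)=h_0+h_1x+\cdots+h_nx^n$, one sets $g(P,x)=h_0+(h_1-h_0)x+\cdots+(h_m-h_{m-1})x^m$ with $m=\lfloor n/2\rfloor$. The toric $g$-polynomial of an $n$-dimensional polytope is that of its face lattice (all faces including the empty face and the polytope itself, ordered by inclusion, of rank $n+1$). For a function $f:[n]\to[n]$: $f$ is $123$-avoiding if there is no triple $1\le i_1<i_2<i_3\le n$ with $f(i_1)\le f(i_2)\le f(i_3)$; $f$ has an ascent at position $i$ if $1\le i\le n-1$ and $f(i)\le f(i+1)$ (weak inequality). *)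

(* Defs.v *)
From HB Require Import structures.
From mathcomp Require Import all_boot all_order all_algebra.

Set Implicit Arguments.
Unset Strict Implicit.
Unset Printing Implicit Defensive.

Import Order.TTheory GRing.Theory Num.Theory.

Local Open Scope ring_scope.

(** * Toric polynomials of a finite bounded poset *)

(* The rank of [y] is the length of a longest chain from [\bot] to [y], i.e.
   the largest size of a chain of elements strictly below [y]. *)
Definition rank (d : Order.disp_t) (T : finTBPOrderType d) (y : T) : nat :=
  (\max_(C : {set T} | [forall x in C, (x < y)%O] &&
                       [forall x in C, forall z in C, (x >=< z)%O]) #|C|)%N.

(* h_0 + (h_1 - h_0) x + ... + (h_m - h_{m-1}) x^m with m = floor(n/2), where
   the h_i are the coefficients of [f]. *)
Definition g_of_f (n : nat) (f : {poly int}) : {poly int} :=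
  \poly_(i < n./2.+1) (if i is j.+1 then f`_j.+1 - f`_j else f`_0).

(* The polynomials of the lower interval [\bot, y]: [lower_f g y] is its
   f-polynomial, given the g-polynomials [g z] of the intervals [\bot, z]
   with z < y, and [lower_g_of] recovers its g-polynomial. *)
Definition lower_f (d : Order.disp_t) (T : finTBPOrderType d)
    (g : T -> {poly int}) (y : T) : {poly int} :=
  if rank y is n.+1
  then \sum_(z : T | (z < y)%O) g z * ('X - 1) ^+ (n - rank z)
  else 1.

Definition lower_g_of (d : Order.disp_t) (T : finTBPOrderType d)
    (f : {poly int}) (y : T) : {poly int} :=
  if rank y is n.+1 then g_of_f n f else 1.

(* [m] bounds the recursion depth; by [lower_gE] below, [m = rank y] is
   sufficient for the polynomial of the interval [\bot, y]. *)
Fixpoint lower_g_rec (d : Order.disp_t) (T : finTBPOrderType d)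
    (m : nat) (y : T) : {poly int} :=
  if m is m'.+1 then lower_g_of (lower_f (lower_g_rec m') y) y else 1.

Definition lower_g (d : Order.disp_t) (T : finTBPOrderType d) (y : T) :
  {poly int} := lower_g_rec (rank y) y.

Definition toric_f (d : Order.disp_t) (T : finTBPOrderType d) : {poly int} :=
  lower_f (@lower_g d T) \top%O.

Definition toric_g (d : Order.disp_t) (T : finTBPOrderType d) : {poly int} :=
  lower_g (\top%O : T).

Lemma rank_lt (d : Order.disp_t) (T : finTBPOrderType d) (z y : T) :
  (z < y)%O -> (rank z < rank y)%N.
Proof.
move=> zy; rewrite [rank z]/rank.
case: (@eq_bigmax_cond _ [pred C : {set T} | [forall x in C, (x < z)%O] &&
    [forall x in C, forall w in C, (x >=< w)%O]] (fun C => #|C|)).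
  apply/card_gt0P; exists set0; rewrite !inE.
  by apply/andP; split; apply/forall_inP => x; rewrite inE.
move=> C /andP[/forall_inP Cz /forall_inP Cc] ->.
have zC : z \notin C by apply/negP => /Cz; rewrite ltxx.
have <- : #|z |: C| = #|C|.+1 by rewrite cardsU1 zC.
rewrite /rank; apply: (bigop.bigmax_sup (z |: C)) => //; apply/andP; split.
  by apply/forall_inP => x /setU1P[-> // | /Cz xz]; apply: lt_trans zy.
apply/forall_inP => x /setU1P[-> | xC]; apply/forall_inP => w /setU1P[-> | wC].
- exact: comparablexx.
- by rewrite comparable_sym /Order.comparable (ltW (Cz _ wC)).
- by rewrite /Order.comparable (ltW (Cz _ xC)).
- exact: (forall_inP (Cc x xC)).
Qed.

Lemma lower_gE (d : Order.disp_t) (T : finTBPOrderType d) (y : T) :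
  lower_g y = lower_g_of (lower_f (@lower_g d T) y) y.
Proof.
suff rec m (z : T) : (rank z <= m)%N ->
    lower_g_rec m z = lower_g_of (lower_f (@lower_g d T) z) z by exact: rec.
elim/ltn_ind: m z => -[|m] IH z zm.
  by rewrite /= /lower_g_of; move: zm; case: (rank z).
rewrite /= /lower_g_of /lower_f; case Ez: (rank z) => [//|k].
congr (g_of_f _ _); apply: eq_bigr => w wz; congr (_ * _).
have wm : (rank w <= m)%N by rewrite -ltnS (leq_trans (rank_lt wz)).
by rewrite IH // /lower_g [RHS]IH // ltnS.
Qed.

(** * The cyclohedron *)

(* The vertices of the (2n+2)-gon are the elements of ['I_(n.*2.+2)] in cyclic
   order. *)
Definition antipode (n : nat) (v : 'I_(n.*2.+2)) : 'I_(n.*2.+2) :=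
  inZp (v + n.+1)%N.

Definition is_diagonal (n : nat) (D : {set 'I_(n.*2.+2)}) : bool :=
  (#|D| == 2) && [forall v : 'I_(n.*2.+2), D != [set v; ordS v]].

(* Some endpoint [v] of [E] lies strictly between the endpoints of [D] and
   some endpoint [w] of [E] lies strictly outside; in particular [D] and [E]
   do not cross when they share an endpoint. *)
Definition crossing (n : nat) (D E : {set 'I_(n.*2.+2)}) : bool :=
  [exists a in D, exists b in D, exists v in E, exists w in E,
     [&& (a < v)%N, (v < b)%N & (w < a)%N || (b < w)%N]].

Definition cyclo_dissection (n : nat) (A : {set {set 'I_(n.*2.+2)}}) : bool :=
  [&& [forall D in A, is_diagonal D],
      [forall D in A, forall E in A, ~~ crossing D E]
    & [set [set antipode v | v in D] | D : {set 'I_(n.*2.+2)} in A] == A].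

(* The faces of the [n]-dimensional cyclohedron: [None] is the empty face, and
   [Some A] is the nonempty face given by the dissection [A]. *)
Definition cyclohedron (n : nat) : Type :=
  option {A : {set {set 'I_(n.*2.+2)}} | cyclo_dissection A}.

HB.instance Definition _ (n : nat) := Finite.on (cyclohedron n).

Definition cyclo_le (n : nat) (F G : cyclohedron n) : bool :=
  match F, G with
  | None, _ => true
  | Some _, None => false
  | Some A, Some B => val B \subset val A
  end.

Lemma cyclo_le_refl (n : nat) : reflexive (@cyclo_le n).
Proof. by case=> [A|] /=. Qed.

Lemma cyclo_le_anti (n : nat) : antisymmetric (@cyclo_le n).
Proof.
case=> [A|] [B|] //= /andP[AB BA]; congr Some; apply: val_inj.
by apply/eqP; rewrite eqEsubset BA.
Qed.

Lemma cyclo_le_trans (n : nat) : transitive (@cyclo_le n).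
Proof.
by case=> [A|] [B|] [C|] //= AB CA; apply: subset_trans CA AB.
Qed.

Fact cyclo_display : Order.disp_t. Proof. exact: (Order.Disp tt tt). Qed.

HB.instance Definition _ (n : nat) :=
  Order.Le_isPOrder.Build cyclo_display (cyclohedron n)
    (@cyclo_le_refl n) (@cyclo_le_anti n) (@cyclo_le_trans n).

Lemma cyclo_dissection0 (n : nat) : @cyclo_dissection n set0.
Proof.
apply/and3P; split; try by apply/forall_inP => D; rewrite inE.
by rewrite imset0.
Qed.

Lemma cyclo_bot_le (n : nat) (F : cyclohedron n) :
  (None <= F :> cyclohedron n)%O.
Proof. by []. Qed.

Lemma cyclo_le_top (n : nat) (F : cyclohedron n) :
  (F <= Some (exist _ set0 (cyclo_dissection0 n)) :> cyclohedron n)%O.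
Proof. by case: F => [A|] //; apply: sub0set. Qed.

HB.instance Definition _ (n : nat) :=
  Order.hasBottom.Build cyclo_display (cyclohedron n) (@cyclo_bot_le n).
HB.instance Definition _ (n : nat) :=
  Order.hasTop.Build cyclo_display (cyclohedron n) (@cyclo_le_top n).

(** * Functions from [n] to [n] *)

(* [n] is encoded as ['I_n], i.e. shifted down to {0, ..., n-1} in both the
   domain and the codomain. *)
Definition avoids123 (n : nat) (f : {ffun 'I_n -> 'I_n}) : bool :=
  ~~ [exists i1 : 'I_n, exists i2 : 'I_n, exists i3 : 'I_n,
        [&& (i1 < i2)%N, (i2 < i3)%N, (f i1 <= f i2)%N & (f i2 <= f i3)%N]].

Definition ascents (n : nat) (f : {ffun 'I_n -> 'I_n}) : {set 'I_n} :=
  [set i : 'I_n | [exists j : 'I_n,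
     (nat_of_ord j == i.+1) && (f i <= f j)%N]].

(* Main.v *)
(* For a poset with Boolean upper intervals (the face lattice of a simple
   polytope), the recursion for g can be solved in terms of the h-vector
   sum_F (t - 1)^(dim F) = sum_i h_i t^i, where F runs over the nonempty faces:
   the coefficient of x^k in g is
     sum_i h_i (C(i,k) C(d-i,k) - C(i-1,k) C(d-i+1,k)).
   With this choice of the summand the Euler relation is not needed; all that
   enters is that the differences in parentheses, as a linear functional on the
   polynomials in t, behave well under the substitution t -> t + x - 1.

   For the cyclohedron h_i = C(n,i)^2, because it has C(n,k) C(n+k,k) faces of
   codimension k.  A centrally symmetric dissection of the (2n+2)-gon is a
   noncrossing family of intervals of the integers that is periodic with period
   N = n + 1.  Contracting an edge of the polygon together with the opposite edge
   sends the dissections for n + 1 to those for n; the preimages of a dissection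
   correspond to a choice among the arcs at the vertex onto which the edge is
   contracted.  Since the degrees of the vertices add up to twice the number of
   arcs, averaging over rotations gives a recursion for the number of dissections.

   On the other side, removing the largest letter of a word that avoids 123
   leads to a recursion for the number of words with a given number of ascents
   and given length of the initial decreasing run.  It is solved by sums of
   products of C(m,a) C(m,b) - C(m,a+1) C(m,b-1) (the number of semistandard
   tableaux with two columns) and two binomial coefficients, by means of the
   branching rule for these tableaux. *)

Require Import Defs.
From mathcomp Require Import all_boot all_order all_algebra.
From mathcomp Require Import zify ring.

Set Implicit Arguments.
Unset Strict Implicit.
Unset Printing Implicit Defensive.

Import Order.TTheory GRing.Theory Num.Theory.

(** * The toric g-polynomial of a poset with Boolean upper intervals *)

Local Open Scope ring_scope.

(** For a face y of dimension d, g is characterized by two conditions: its degree is at most d/2,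
    and in degrees up to d/2 the sum of g(z) (x - 1)^(dim y - dim z) over all faces z of y, the
    empty one and y included, vanishes. So a closed formula can be verified instead of derived.
    Boolean intervals turn the sum over the nonempty faces into the homogenized h-polynomial with
    (t, q) replaced by (t + x - 1, q + x - 1); the variable q is there because the formula depends
    on both i and d - i.

    Since [rank] is defined by longest chains, the rank of a face is known only once every
    dissection that is not of maximal size is seen to extend by exactly one arc. The bound on the
    size is itself read off from the enumeration.

    Of the two intervals under a chord of the 2N-gon, the one of length at most N is kept. A
    diameter has length N, so both its ends lie at the same vertex modulo N and count separately in
    the degree.

    Both sides meet in [minrun_sum]: the symmetry of C(n,i)^2 under i -> n - i rewrites the
    coefficient of g through the differences C(n,i)^2 - C(n,i+1)^2, which are values of [schur2]. *)

(* 'C(a - 1, k), with the value 0 for a = 0 even when k = 0 *)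
Definition binpred (a k : nat) : nat := if a is a'.+1 then 'C(a', k) else 0.

Lemma coef_XaddCn (R : comNzRingType) (c : R) (n k : nat) :
  (('X + c%:P) ^+ n)`_k = 'C(n, k)%:R * c ^+ (n - k).
Proof.
rewrite addrC exprDn coef_sum.
have [kn|nk] := ltnP k n.+1; last first.
  rewrite bin_small // mul0r big1 // => i _.
  rewrite coefMn -polyC_exp coefCM coefXn.
  by case: eqP => [e|]; rewrite ?mulr0 ?mul0rn //; move: (ltn_ord i); rewrite -e ltnNge nk.
rewrite (bigD1 (Ordinal kn)) //= big1 ?addr0.
  by rewrite coefMn -polyC_exp coefCM coefXn eqxx mulr1 mulr_natl.
move=> i ik; rewrite coefMn -polyC_exp coefCM coefXn.
case: eqP => [e|]; rewrite ?mulr0 ?mul0rn //.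
by case/eqP: ik; apply: val_inj.
Qed.

(** Both sides are the coefficient of ['X^k] in [('X + x%:P) ^+ i], expanded directly and as a power
    of [(x - 1) + ('X + 1)]. *)
Lemma sum_bin_shift (R : comNzRingType) (x : R) (i k : nat) :
  \sum_(a < i.+1) ('C(i, a)%:R * (x - 1) ^+ (i - a)) * 'C(a, k)%:R
  = 'C(i, k)%:R * x ^+ (i - k).
Proof.
rewrite -coef_XaddCn.
have -> : 'X + x%:P = (x - 1)%:P + ('X + 1%:P).
  by rewrite polyCB; ring.
rewrite exprDn coef_sum; apply: eq_bigr => a _.
rewrite coefMn -polyC_exp coefCM coef_XaddCn expr1n mulr1 -mulr_natl.
ring.
Qed.

Lemma sum_binpred_rec (R : comNzRingType) (x : R) (i k : nat) :
  \sum_(a < i.+1) ('C(i, a)%:R * (x - 1) ^+ (i - a)) * (binpred a k.+1)%:R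
  + \sum_(a < i.+1) ('C(i, a)%:R * (x - 1) ^+ (i - a)) * (binpred a k)%:R
  = 'C(i, k.+1)%:R * x ^+ (i - k.+1).
Proof.
rewrite -sum_bin_shift -big_split /=; apply: eq_bigr => -[[|a] ai] _ /=.
  by rewrite !mulr0 addr0.
by rewrite -mulrDr -natrD.
Qed.

Definition tor_coef (a b k : nat) : int :=
  ('C(a, k) * 'C(b, k))%N%:Z - (binpred a k * 'C(b.+1, k))%N%:Z.

Definition tor_poly (m a b : nat) : {poly int} :=
  \sum_(k < m.+1) 'X^k * (tor_coef a b k)%:~R.

Definition bin_weight (i a : nat) : {poly int} := 'C(i, a)%:R * ('X - 1) ^+ (i - a).

(** The image of [(t + x - 1)^i (q + x - 1)^j] under the functional [tor_fun] introduced below; see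
    [tor_fun_shift]. *)
Definition tor_shift (m i j : nat) : {poly int} :=
  \sum_(a < i.+1) \sum_(b < j.+1) bin_weight i a * bin_weight j b * tor_poly m a b.

(** Unlike the shift of ['C(a, k)], this is not a multiple of a power of ['X]; only the sum of the
    values at [k] and [k.+1] is. *)
Definition predbin_shift (i k : nat) : {poly int} :=
  \sum_(a < i.+1) bin_weight i a * (binpred a k)%:R.

Lemma predbin_shift_rec (i k : nat) :
  predbin_shift i k.+1 = 'C(i, k.+1)%:R * 'X ^+ (i - k.+1) - predbin_shift i k.
Proof. by rewrite -sum_binpred_rec addrK. Qed.

Lemma predbin_shift0 (i : nat) : predbin_shift i 0 = 'X ^+ i - ('X - 1) ^+ i.
Proof.
have := sum_bin_shift ('X : {poly int}) i 0.
rewrite /predbin_shift bin0 subn0 mul1r => <-.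
rewrite [in RHS]big_ord_recl [in LHS]big_ord_recl /= /bin_weight !bin0 subn0.
rewrite !mul1r mulr0 mulr1 addrAC subrr !add0r.
by apply: eq_bigr => a _; rewrite bin0.
Qed.

Lemma tor_shift_prod (m i j : nat) :
  tor_shift m i j = \sum_(k < m.+1) 'X^k *
    ('C(i, k)%:R * 'X ^+ (i - k) * ('C(j, k)%:R * 'X ^+ (j - k))
     - predbin_shift i k * \sum_(b < j.+1) bin_weight j b * 'C(b.+1, k)%:R).
Proof.
rewrite /tor_shift.
under eq_bigr => a _ do under eq_bigr => b _ do rewrite /tor_poly mulr_sumr.
under eq_bigr => a _ do rewrite exchange_big /=.
rewrite exchange_big /=; apply: eq_bigr => k _.
rewrite -(sum_bin_shift 'X i) -(sum_bin_shift 'X j) /predbin_shift.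
rewrite !mulr_suml -sumrB mulr_sumr; apply: eq_bigr => a _.
rewrite !mulr_sumr -sumrB mulr_sumr; apply: eq_bigr => b _.
rewrite /tor_coef intrB -!pmulrn !natrM /bin_weight; ring.
Qed.

Lemma sum_binS_shift (j k : nat) :
  \sum_(b < j.+1) bin_weight j b * 'C(b.+1, k.+1)%:R
  = 'C(j, k.+1)%:R * 'X ^+ (j - k.+1) + 'C(j, k)%:R * 'X ^+ (j - k).
Proof.
rewrite -!sum_bin_shift -big_split /=; apply: eq_bigr => b _.
by rewrite binS natrD mulrDr.
Qed.

Lemma binX (R : nzRingType) (n k p : nat) : (n <= p)%N ->
  'C(n, k)%:R * 'X ^+ (p - k) * 'X ^+ k = 'C(n, k)%:R * 'X ^+ p :> {poly R}.
Proof.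
move=> np; have [kn|nk] := leqP k n; last by rewrite bin_small // !mul0r.
by rewrite -mulrA -exprD subnK // (leq_trans kn).
Qed.

(** By Pascal's rule the inner sum is a combination of two powers of ['X]. Eliminating
    [predbin_shift i k.+1] from one of the two parts collects everything that is not a monomial in
    the single sum of ['C(j, k)%:R * predbin_shift i k]. *)
Lemma tor_shift_expand (m i j : nat) : (j < m)%N ->
  \sum_(k < m.+1) 'X^k * (predbin_shift i k *
       \sum_(b < j.+1) bin_weight j b * 'C(b.+1, k)%:R)
  = 'X ^+ j * (1 - 'X) * (\sum_(k < m) 'C(j, k)%:R * predbin_shift i k)
    + 'X^(j.+1) * \sum_(k < m) 'C(j, k)%:R * ('C(i, k.+1)%:R * 'X ^+ (i - k.+1)).
Proof.
move=> jm; rewrite big_ord_recl /= expr0 mul1r.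
have -> : \sum_(b < j.+1) bin_weight j b * 'C(b.+1, 0)%:R = 'X^j.
  have := sum_bin_shift ('X : {poly int}) j 0; rewrite bin0 subn0 mul1r => <-.
  by apply: eq_bigr => b _; rewrite !bin0.
transitivity ('X^j * (predbin_shift i 0 + \sum_(k < m) 'C(j, k.+1)%:R * predbin_shift i k.+1)
  + 'X^(j.+1) * \sum_(k < m) 'C(j, k)%:R * predbin_shift i k.+1).
  rewrite mulrDr -addrA (mulrC 'X^j); congr (_ + _).
  rewrite !mulr_sumr -big_split /=; apply: eq_bigr => k _.
  rewrite /bump /= add1n sum_binS_shift.
  have e1 := @binX int j k.+1 j (leqnn j); have e2 := @binX int j k j (leqnn j).
  transitivity (predbin_shift i k.+1 * ('C(j, k.+1)%:R * 'X ^+ (j - k.+1) * 'X ^+ k.+1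
     + 'X * ('C(j, k)%:R * 'X ^+ (j - k) * 'X ^+ k))); first by rewrite [in LHS]exprS [in RHS]exprS; ring.
  by rewrite e1 e2 [in RHS]exprS; ring.
have -> : predbin_shift i 0 + \sum_(k < m) 'C(j, k.+1)%:R * predbin_shift i k.+1
  = \sum_(k < m) 'C(j, k)%:R * predbin_shift i k.
  transitivity (\sum_(k < m.+1) 'C(j, k)%:R * predbin_shift i k).
    by rewrite big_ord_recl bin0 mul1r.
  by rewrite big_ord_recr /= (bin_small jm) // mul0r addr0.
under [X in _ + _ * X = _]eq_bigr => k _ do rewrite predbin_shift_rec mulrBr.
rewrite sumrB exprS; ring.
Qed.

(** Pascal's rule for ['C(j.+1, k)] pairs neighbouring values of [predbin_shift], whose sums are
    monomials. This requires a positive upper index, which makes the exponent 0 of [q] exceptional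
    below. *)
Lemma sum_bin_predbin_shift (m i j : nat) : (j.+1 < m)%N ->
  \sum_(k < m) 'C(j.+1, k)%:R * predbin_shift i k
  = \sum_(k < m) 'C(j, k)%:R * ('C(i, k.+1)%:R * 'X ^+ (i - k.+1)).
Proof.
case: m => // m jm.
under [RHS]eq_bigr => k _ do
  rewrite -[X in _ * X](subrK (predbin_shift i k)) -predbin_shift_rec mulrDr.
rewrite big_split /= [X in _ = _ + X]big_ord_recl /= bin0 mul1r.
rewrite [X in _ = X + _]big_ord_recr /= (@bin_small j m jm) mul0r addr0.
rewrite big_ord_recl bin0 mul1r addrCA -big_split /=; congr (_ + _).
by apply: eq_bigr => k _; rewrite /bump /= add1n binS natrD mulrDl addrC.
Qed.

Lemma low_coef_sum (I : finType) (n e : I -> nat) (c : nat) :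
  (forall k, n k != 0 -> c < e k)%N ->
  (\sum_k (n k)%:R * 'X^(e k) : {poly int})`_c = 0.
Proof.
move=> H; rewrite coef_sum big1 // => k _.
rewrite mulr_natl coefMn coefXn; case: eqP => [ec|]; last by rewrite mul0rn.
by case: (eqVneq (n k) 0%N) => [->//|/H]; rewrite ec ltnn.
Qed.

(** Once only monomials are left, nonvanishing of the binomials bounds [k] so strongly that every
    exponent exceeds [(i + j.+1) / 2]. *)
Lemma tor_shift_low (m i j c : nat) : (j.+1 < m)%N -> (c.*2 <= i + j.+1)%N ->
  (tor_shift m i j.+1)`_c = 0.
Proof.
move=> jm cij; rewrite tor_shift_prod.
under eq_bigr => k _ do rewrite mulrBr.
rewrite sumrB tor_shift_expand // sum_bin_predbin_shift //.
set d := (i + j)%N.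
have -> : \sum_(k < m.+1) 'X^k * ('C(i, k)%:R * 'X^(i - k) * ('C(j.+1, k)%:R * 'X^(j.+1 - k)))
  = 'X^(d.+1) + \sum_(k < m) ('C(i, k.+1) * 'C(j, k.+1))%:R * 'X^(d - k)
    + \sum_(k < m) ('C(j, k) * 'C(i, k.+1))%:R * 'X^(d - k) :> {poly int}.
  rewrite big_ord_recl !bin0 !subn0 !mul1r -exprD addnS -addrA; congr (_ + _).
  rewrite -big_split /=; apply: eq_bigr => k _; rewrite /bump /= add1n.
  have [ki|ik] := ltnP k i; last by rewrite (@bin_small i k.+1) // !(mul0r,mulr0,muln0,mul0n) addr0.
  rewrite binS natrD !natrM.
  have [kj|jk] := leqP k j; last by rewrite (@bin_small j k.+1 (ltnW jk)) (@bin_small j k jk) !(addr0,mul0r,mulr0).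
  have -> : 'X^(d - k) = 'X^(k.+1) * 'X^(i - k.+1) * 'X^(j - k) :> {poly int}.
    by rewrite -!exprD; congr ('X^_); rewrite /d; lia.
  rewrite subSS; ring.
have -> : 'X^(j.+1) * (1 - 'X) * (\sum_(k < m) 'C(j, k)%:R * ('C(i, k.+1)%:R * 'X^(i - k.+1)))
  = (\sum_(k < m) ('C(j, k) * 'C(i, k.+1))%:R * 'X^(d - k))
  - \sum_(k < m) ('C(j, k) * 'C(i, k.+1))%:R * 'X^((d - k).+1) :> {poly int}.
  rewrite mulr_sumr -sumrB; apply: eq_bigr => k _.
  have [ki|ik] := ltnP k i; last by rewrite (@bin_small i k.+1) // !(mul0r,mulr0,muln0,mul0n) subr0.
  have -> : (d - k = j.+1 + (i - k.+1))%N by rewrite /d; lia.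
  rewrite [in RHS]exprS exprD natrM; ring.
have -> : 'X^(j.+2) * \sum_(k < m) 'C(j.+1, k)%:R * ('C(i, k.+1)%:R * 'X^(i - k.+1))
  = \sum_(k < m) ('C(j.+1, k) * 'C(i, k.+1))%:R * 'X^((d - k).+1) :> {poly int}.
  rewrite mulr_sumr; apply: eq_bigr => k _.
  have [ki|ik] := ltnP k i; last by rewrite (@bin_small i k.+1) // !(mul0r,mulr0,muln0,mul0n).
  have -> : ((d - k).+1 = j.+2 + (i - k.+1))%N by rewrite /d; lia.
  rewrite exprD natrM; ring.
set S2 := (\sum_(k < m) ('C(j, k) * 'C(i, k.+1))%:R * 'X^(d - k)).
(* The two copies of [S2], the only sum with too small exponents, cancel. *)
rewrite [X in (polyseq X)`_c](_ : _ = 'X^(d.+1)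
   + \sum_(k < m) ('C(i, k.+1) * 'C(j, k.+1))%:R * 'X^(d - k)
   + \sum_(k < m) ('C(j, k) * 'C(i, k.+1))%:R * 'X^((d - k).+1)
   - \sum_(k < m) ('C(j.+1, k) * 'C(i, k.+1))%:R * 'X^((d - k).+1)); last by ring.
have nz a b k l : (('C(a, k) * 'C(b, l))%N != 0 -> (k <= a) && (l <= b))%N.
  by rewrite -lt0n muln_gt0 !bin_gt0.
rewrite coefB !coefD !low_coef_sum ?coefXn ?subr0 ?addr0 => [|k /nz|k /nz|k /nz]; rewrite /d; try lia.
Qed.

(** The exceptional case: the low coefficients do not vanish, but they are the negatives of those
    that the empty face contributes in [sum_G_low]. *)
Lemma tor_shift_low0 (m i c : nat) : (0 < m)%N -> (c.*2 <= i)%N ->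
  (tor_shift m i 0)`_c = - (('X - 1) ^+ i.+1)`_c.
Proof.
move=> m0 ci; rewrite tor_shift_prod.
under eq_bigr => k _ do rewrite mulrBr.
rewrite sumrB tor_shift_expand //.
case: m m0 => // m _.
rewrite big_ord_recl /= big1 ?addr0 => [|k _]; last by rewrite (@bin_small 0) // !mul0r !mulr0.
rewrite big_ord_recl /= big1 ?addr0 => [|k _]; last by rewrite (@bin_small 0) // !mul0r.
rewrite big_ord_recl /= big1 ?addr0 => [|k _]; last by rewrite (@bin_small 0) // !mul0r.
rewrite predbin_shift0 !bin0 !subn0 expr0 expr1 bin1.
apply/eqP; rewrite -addr_eq0 -coefD exprS.
case: i ci => [|i] ci.
  rewrite !expr0 (_ : _ + _ = 'X); last by ring.
  by rewrite coefX; move: ci; case: c.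
rewrite [X in (polyseq X)`_c](_ : _ = 'X^(i.+2) - ('X^(i.+1)) *+ i.+1).
  have [c1 c2] : c != i.+2 /\ c != i.+1 by split; lia.
  by rewrite coefB coefMn !coefXn (negPf c1) (negPf c2) mul0rn subr0.
rewrite subn1 /= -mulr_natr !exprS; ring.
Qed.

(** This is the bound d/2 on the degree of g, with [a + b] in the role of d. *)
Lemma tor_coef_high (a b c : nat) : (a + b < c.*2)%N -> tor_coef a b c = 0.
Proof.
move=> abc; rewrite /tor_coef; case: a abc => [|a] abc /=.
  by rewrite mul0n subr0 (@bin_small 0) ?mul0n //; lia.
have -> : ('C(a.+1, c) * 'C(b, c) = 0)%N.
  by apply/eqP; rewrite -leqn0 leqNgt muln_gt0 !bin_gt0; lia.
suff -> : ('C(a, c) * 'C(b.+1, c) = 0)%N by [].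
by apply/eqP; rewrite -leqn0 leqNgt muln_gt0 !bin_gt0; lia.
Qed.

Lemma coef_tor_poly (m a b c : nat) : (a + b <= m)%N ->
  (tor_poly m a b)`_c = tor_coef a b c.
Proof.
move=> abm; have -> : tor_poly m a b = \poly_(k < m.+1) tor_coef a b k.
  rewrite poly_def; apply: eq_bigr => k _.
  by rewrite -mul_polyC mulrC -[in RHS](intz (tor_coef a b k)) (rmorph_int polyC).
by rewrite coef_poly; case: ltnP => // mc; rewrite tor_coef_high //; lia.
Qed.

Notation bipoly := {poly {poly {poly int}}}.

(** The outer variable is t, the middle one q, and the innermost is the variable x of the toric
    polynomials; [svar] is the constant x - 1. *)
Definition tvar : bipoly := 'X.
Definition qvar : bipoly := 'X%:P.
Definition svar : bipoly := ('X - 1)%:P%:P.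

(* The linear functional that maps t^a q^b to [tor_poly m a b]. *)
Definition tor_fun (m : nat) (P : bipoly) : {poly int} :=
  \sum_(a < m) \sum_(b < m) P`_a`_b * tor_poly m a b.

Lemma tor_funD (m : nat) (P Q : bipoly) : tor_fun m (P + Q) = tor_fun m P + tor_fun m Q.
Proof.
rewrite /tor_fun -big_split /=; apply: eq_bigr => a _.
by rewrite -big_split /=; apply: eq_bigr => b _; rewrite !coefD mulrDl.
Qed.

Lemma tor_funM (m : nat) (c : {poly int}) (P : bipoly) :
  tor_fun m (c%:P%:P * P) = c * tor_fun m P.
Proof.
rewrite /tor_fun mulr_sumr; apply: eq_bigr => a _.
by rewrite mulr_sumr; apply: eq_bigr => b _; rewrite !coefCM mulrA.
Qed.

Lemma tor_fun_sum (I : Type) (r : seq I) (p : pred I) (m : nat) (F : I -> bipoly) :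
  tor_fun m (\sum_(i <- r | p i) F i) = \sum_(i <- r | p i) tor_fun m (F i).
Proof.
apply: (big_morph _ (tor_funD m)).
have := tor_funM m 0 0; by rewrite mulr0 mul0r.
Qed.

Lemma tor_fun_int (m : nat) (c : int) (P : bipoly) :
  tor_fun m (c%:~R * P) = c%:~R * tor_fun m P.
Proof. by rewrite -tor_funM !rmorph_int. Qed.

Lemma tor_fun_monom (m a b : nat) : (a < m)%N -> (b < m)%N ->
  tor_fun m (tvar ^+ a * qvar ^+ b) = tor_poly m a b.
Proof.
move=> am bm; rewrite /tor_fun /tvar /qvar -polyC_exp.
rewrite (bigD1 (Ordinal am)) //= [X in _ + X]big1 ?addr0 => [|a' ne].
  rewrite (bigD1 (Ordinal bm)) //= big1 ?addr0 => [|b' ne].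
    by rewrite coefMC !coefXn !eqxx mul1r coefXn eqxx mul1r.
  rewrite coefMC !coefXn !eqxx mul1r coefXn.
  by rewrite (_ : (_ == _) = false) ?mul0r //; apply/negbTE; apply: contra ne => /eqP e; apply/eqP/val_inj.
apply: big1 => b' _; rewrite coefMC coefXn.
rewrite (_ : (_ == _) = false) ?mul0r ?coef0 ?mul0r //.
by apply/negbTE; apply: contra ne => /eqP e; apply/eqP/val_inj.
Qed.

Lemma tor_fun_shift (m i j : nat) : (i < m)%N -> (j < m)%N ->
  tor_fun m ((tvar + svar) ^+ i * (qvar + svar) ^+ j) = tor_shift m i j.
Proof.
move=> im jm; rewrite /tor_fun /tor_shift.
have -> : (qvar + svar) ^+ j = (('X + ('X - 1)%:P) ^+ j)%:P.
  by rewrite polyC_exp polyCD.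
have E (a b : nat) : ((tvar + svar) ^+ i * (('X + ('X - 1)%:P) ^+ j)%:P)`_a`_b
    = bin_weight i a * bin_weight j b.
  rewrite coefMC coef_XaddCn /bin_weight -polyC_exp -(polyC_natr {poly int}) -polyCM.
  by rewrite coefCM coef_XaddCn.
rewrite (big_ord_widen m (fun a => \sum_(b < j.+1) bin_weight i a * bin_weight j b * tor_poly m a b)) //.
rewrite [in RHS]big_mkcond /=; apply: eq_bigr => a _.
rewrite (big_ord_widen m (fun b => bin_weight i a * bin_weight j b * tor_poly m a b)) //.
have w0 i' (a' : nat) : (i' < a')%N -> bin_weight i' a' = 0.
  by move=> ia; rewrite /bin_weight bin_small // mul0r.
case: ltnP => ia; last first.
  by apply: big1 => b _; rewrite E w0 // !mul0r.
rewrite [in RHS]big_mkcond /=; apply: eq_bigr => b _; rewrite E.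
by case: ltnP => // jb; rewrite [bin_weight j b]w0 // mulr0 mul0r.
Qed.


Lemma exprBn_int (R : comNzRingType) (x y : R) (m : nat) :
  (x - y) ^+ m =
  \sum_(i < m.+1) ((-1) ^+ i * 'C(m, i)%:R : int)%:~R * (x ^+ (m - i) * y ^+ i).
Proof.
rewrite exprBn; apply: eq_bigr => i _.
rewrite intrM rmorphXn rmorphN1 natz -pmulrn -[LHS]mulr_natr; ring.
Qed.

Local Open Scope ring_scope.

(** * Solution of the recursion for g when upper intervals are Boolean *)

Section SimplePoset.

Variables (disp : Order.disp_t) (T : finTBPOrderType disp).
Implicit Types w y z : T.

Lemma rank_bot : rank (\bot%O : T) = 0%N.
Proof.
apply/eqP; rewrite -leqn0; apply/bigmax_leqP => C /andP[/forall_inP Cb _].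
by rewrite leqn0 cards_eq0 -subset0; apply/subsetP => x /Cb; rewrite ltx0.
Qed.

Lemma rank_gt0 y : y != \bot%O -> (0 < rank y)%N.
Proof. by move=> y0; rewrite -rank_bot rank_lt // lt0x. Qed.

Lemma rank_le z y : (z <= y)%O -> (rank z <= rank y)%N.
Proof. by rewrite le_eqVlt => /predU1P[-> // | /rank_lt /ltnW]. Qed.

(* [top_rank] bounds the exponents that occur, so that [tor_fun top_rank] is
   linear and correct on all the polynomials below. *)
Let top_rank := rank (\top%O : T).

(** The binomial theorem for the rank generating function of a Boolean interval; it is applied in
    the ring [bipoly]. *)
Hypothesis boolean_upper : forall (R : comNzRingType) (s q : R) w y,
  w != \bot%O -> (w <= y)%O ->
  \sum_(z | (w <= z <= y)%O) s ^+ (rank y - rank z) * q ^+ (rank z - rank w)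
  = (s + q) ^+ (rank y - rank w).

(* The homogenized h-polynomial sum_i h_i t^i q^(d-i) of the face y of dimension d. *)
Definition hom_h_poly y : bipoly :=
  \sum_(w | (w != \bot%O) && (w <= y)%O)
     (tvar - qvar) ^+ (rank w).-1 * qvar ^+ (rank y - rank w).

Let G y := tor_fun top_rank (hom_h_poly y).

Let G_high y c : y != \bot%O -> ((rank y).-1 < c.*2)%N -> (G y)`_c = 0.
Proof.
move=> y0 yc; rewrite /G tor_fun_sum coef_sum big1 // => w /andP[w0 wy].
rewrite exprBn_int mulr_suml tor_fun_sum coef_sum big1 // => i _.
have rw := rank_gt0 w0; have rwy := rank_le wy; have ry := rank_le (lex1 y).
rewrite -!mulrA -exprD.
rewrite tor_fun_int tor_fun_monom /top_rank; try by case: i => i /=; lia.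
rewrite -(rmorph_int polyC) coefCM coef_tor_poly ?tor_coef_high ?mulr0 //;
  by rewrite ?/top_rank; case: i => i /=; lia.
Qed.

(** After exchanging the sums over [z] and [w], the interval from [w] to [y] contributes a power of
    [svar + qvar]. Since t - q = (t + s) - (q + s), everything is a polynomial in the shifted
    variables, on which the functional is [tor_shift]. *)
Let sum_G y : y != \bot%O ->
  \sum_(z | (z != \bot%O) && (z <= y)%O) G z * ('X - 1) ^+ (rank y - rank z)
  = \sum_(w | (w != \bot%O) && (w <= y)%O) \sum_(i < (rank w).-1.+1)
      ((-1) ^+ i * 'C((rank w).-1, i)%:R)%:~R
      * tor_shift top_rank ((rank w).-1 - i) (i + (rank y - rank w)).
Proof.
move=> y0.
transitivity (tor_fun top_rank (\sum_(w | (w != \bot%O) && (w <= y)%O)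
   (tvar - qvar) ^+ (rank w).-1 * (svar + qvar) ^+ (rank y - rank w))).
  under eq_bigr => z _ do rewrite mulrC /G -tor_funM /hom_h_poly mulr_sumr.
  rewrite -tor_fun_sum; congr tor_fun.
  rewrite (exchange_big_dep (fun w => (w != \bot%O) && (w <= y)%O)) /=.
    apply: eq_bigr => w /andP[w0 wy]; rewrite -(boolean_upper _ _ w0 wy) mulr_sumr.
    apply: eq_big => [z | z _].
      by rewrite w0 /= andbC andbA; case: (boolP (w <= z)%O); rewrite //= => wz;
         case: (eqVneq z \bot%O) wz => [-> | //]; rewrite lex0 (negPf w0).
    by rewrite /svar !polyC_exp mulrCA.
  move=> z w /andP[_ zy] /andP[w0 wz]; rewrite w0; exact: le_trans zy.
rewrite tor_fun_sum; apply: eq_bigr => w /andP[w0 wy].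
have rw := rank_gt0 w0; have rwy := rank_le wy; have ry := rank_le (lex1 y).
have -> : tvar - qvar = (tvar + svar) - (qvar + svar) by rewrite opprD addrACA subrr addr0.
rewrite exprBn_int mulr_suml tor_fun_sum; apply: eq_bigr => i _.
rewrite -tor_fun_shift /top_rank; try by case: i => i /=; lia.
by rewrite -tor_fun_int [svar + _]addrC exprD !mulrA.
Qed.

(** Every term contains a positive power of q + s and vanishes in low degrees by [tor_shift_low],
    except the one with [w = y] and [i = 0], which cancels [('X - 1) ^+ rank y] by
    [tor_shift_low0]. *)
Let sum_G_low y c : y != \bot%O -> (c.*2 <= (rank y).-1)%N ->
  (\sum_(z | (z != \bot%O) && (z <= y)%O) G z * ('X - 1) ^+ (rank y - rank z)
   + ('X - 1) ^+ rank y)`_c = 0.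
Proof.
move=> y0 cy; rewrite sum_G // coefD.
have ry0 := rank_gt0 y0; have ry := rank_le (lex1 y).
rewrite coef_sum (bigD1 y) /=; last by rewrite y0 lexx.
rewrite [X in _ + X + _]big1 ?addr0 => [|w /andP[/andP[w0 wy] wney]]; last first.
  have rw := rank_gt0 w0; have rwy : (rank w < rank y)%N by rewrite rank_lt // lt_neqAle wney.
  rewrite coef_sum big1 // => -[i im] _ /=.
  rewrite -(rmorph_int polyC) coefCM.
  have -> : (i + (rank y - rank w) = (i + (rank y - rank w)).-1.+1)%N by lia.
  by rewrite tor_shift_low ?mulr0 // /top_rank; lia.
rewrite coef_sum subnn big_ord_recl /= [X in _ + X + _]big1 ?addr0 => [|[i im] _].
  rewrite expr0 bin0 mulr1 mul1r subn0 tor_shift_low0 //; last by rewrite /top_rank; lia.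
  by rewrite prednK // addNr.
rewrite -(rmorph_int polyC) coefCM /bump /= add1n addn0.
by rewrite tor_shift_low ?mulr0 // /top_rank; lia.
Qed.

(** By induction [('X - 1) * f] is the full sum over the faces of [y] minus [G y]. As the full sum
    vanishes in low degrees, the successive differences of the coefficients of [f] are the
    coefficients of [G y]; above the middle [G_high] applies. *)
Let lower_gE y : y != \bot%O -> lower_g y = G y.
Proof.
have [r] := ubnP (rank y); elim: r y => // r IH y yr y0.
rewrite Defs.lower_gE /lower_g_of /lower_f.
have ry0 := rank_gt0 y0; case Ey: (rank y) => [|d]; first by rewrite Ey in ry0.
set f := \sum_(z | (z < y)%O) _.
have fE : ('X - 1) * f =
   (\sum_(z | (z != \bot%O) && (z <= y)%O) G z * ('X - 1) ^+ (rank y - rank z)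
   + ('X - 1) ^+ rank y) - G y.
  rewrite [in RHS](bigD1 y) /=; last by rewrite y0 lexx.
  rewrite subnn expr0 mulr1 -[G y + _ + _]addrA [G y + _]addrC addrK /f mulr_sumr [RHS]addrC.
  rewrite (bigD1 \bot%O) /=; last by rewrite lt0x.
  rewrite rank_bot subn0 Defs.lower_gE /lower_g_of rank_bot mul1r -exprS Ey.
  congr (_ + _); apply: eq_big => [z | z /andP[zy z0]].
    by rewrite lt_neqAle andbC andbAC -andbA.
  rewrite IH //; last by have := rank_lt zy; lia.
  rewrite mulrCA -exprS; congr (_ * _ ^+ _); have := rank_lt zy; lia.
apply/polyP => i; rewrite /g_of_f coef_poly.
have low c : (c < d./2.+1)%N -> (('X - 1) * f)`_c = - (G y)`_c.
  move=> cd; rewrite fE coefB sum_G_low ?sub0r //; rewrite Ey; lia.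
case: ltnP => id; last by rewrite G_high // Ey; lia.
have := low i id; rewrite mulrBl mul1r coefB coefXM => /eqP.
rewrite -eqr_oppLR opprB => /eqP <-.
by case: i id => [|i] _ //=; rewrite subr0.
Qed.

Lemma toric_g_simple : (0 < rank (\top%O : T))%N ->
  toric_g T = tor_fun (rank (\top%O : T)) (hom_h_poly \top%O).
Proof.
move=> r0; rewrite /toric_g lower_gE //; apply: contraTN r0 => /eqP ->.
by rewrite rank_bot.
Qed.

End SimplePoset.

(** * Words without weakly increasing subsequence of length three *)

Local Open Scope nat_scope.

(** The length of the initial strictly decreasing run. The default of [head] is [x] itself, so that
    a single letter has run 1. *)
Fixpoint run (w : seq nat) : nat :=
  if w is x :: w' then (if head x w' < x then run w' else 0).+1 else 0.

Fixpoint asc (w : seq nat) : nat :=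
  if w is x :: w' then (if w' is y :: _ then x <= y : nat else 0) + asc w' else 0.

(** A weakly increasing triple starting at [x] exists exactly when the later letters that are at
    least [x] fail to decrease strictly. *)
Fixpoint avoiding (w : seq nat) : bool :=
  if w is x :: w' then sorted gtn [seq y <- w' | x <= y] && avoiding w' else true.

Fixpoint insert (m j : nat) (w : seq nat) : seq nat :=
  if j is j'.+1 then if w is x :: w' then x :: insert m j' w' else [:: m] else m :: w.

Lemma insertE m j w : insert m j w = take j w ++ m :: drop j w.
Proof. by elim: w j => [|x w IH] [|j] //=; rewrite IH. Qed.

Lemma gtn_trans : transitive gtn.
Proof. by move=> x y z /= xy yz; apply: ltn_trans yz xy. Qed.

Lemma run_le_size w : run w <= size w.
Proof. by elim: w => //= x [|y w] IH //; case: ifP. Qed.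

Lemma asc_eq0 w : (asc w == 0) = (run w == size w).
Proof.
elim: w => //= x [|y w] IH; first by rewrite /= ltnn.
rewrite addn_eq0 IH [head _ _]/=; case: leqP => //= xy.
Qed.

Lemma run_gt0 w : (0 < run w) = (0 < size w).
Proof. by case: w. Qed.

Lemma all_lt_filter m w : all (ltn^~ m) w -> [seq y <- w | m <= y] = [::].
Proof.
move=> /allP H; apply/eqP; rewrite -[_ == _]negbK -has_filter -all_predC.
by apply/allP => x /H /=; rewrite ltnNge.
Qed.

Lemma take_run_path x w j : j <= run w -> head x w < x -> 
  all (ltn^~ x) (take j w).
Proof.
elim: w x j => [|y w IH] x [|j] //=.
rewrite ltnS => jr yx; rewrite yx /=; move: jr; case: ifP => hy jr; last first.
  by move: jr; rewrite leqn0 => /eqP ->; rewrite take0.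
apply: sub_all (IH y j jr hy) => z /= /ltn_trans; exact.
Qed.

Lemma sorted_insert m a b : all (ltn^~ m) a -> all (ltn^~ m) b ->
  sorted gtn (a ++ m :: b) = (a == [::]) && sorted gtn b.
Proof.
case: a => [|x a] /= Ha Hb.
  by rewrite path_min_sorted // (eq_all (a2 := ltn^~ m)).
case/andP: Ha => xm _; apply/negP => H.
have := order_path_min gtn_trans H; rewrite all_cat /= => /and3P[_].
by rewrite ltnNge ltnW.
Qed.

Lemma insert_cons m j x w : insert m j.+1 (x :: w) = x :: insert m j w.
Proof. by []. Qed.

Lemma insert0 m w : insert m 0 w = m :: w.
Proof. by case: w. Qed.

Lemma avoiding_cons_max m w : all (ltn^~ m) w -> avoiding (m :: w) = avoiding w.
Proof. by move=> H /=; rewrite all_lt_filter. Qed.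

(** A weakly increasing pair in front of [m] would form a triple with it, so the prefix has to lie
    in the initial run; [m] cannot be in a triple in any other way, because all other letters are
    smaller. *)
Lemma avoiding_insert m j w : all (ltn^~ m) w -> j <= size w ->
  avoiding (insert m j w) = avoiding w && (j <= run w).
Proof.
elim: w j => [|x w IH] [|j] //.
- by move=> H _; rewrite insert0 avoiding_cons_max ?andbT.
move=> /[dup] H /andP[xm wm] jw; rewrite insert_cons [LHS]/= IH //.
rewrite insertE filter_cat /= (ltnW xm) sorted_insert; last 2 first.
- by apply/allP => y; rewrite mem_filter => /andP[_ /mem_take /(allP wm)].
- by apply/allP => y; rewrite mem_filter => /andP[_ /mem_drop /(allP wm)].
rewrite ltnS -!andbA.
case: j jw => [|j] jw.
  by rewrite take0 drop0 /= !leq0n.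
case: w wm jw H {IH} => [|y w] // wm jw H.
rewrite [head _ _]/=; case: (ltnP y x) => yx; last first.
  by rewrite /= yx /= !andbF.
rewrite [LHS]andbA [RHS]andbA; case: (boolP (j.+1 <= run (y :: w))) => jr; rewrite ?andbF //.
rewrite !andbT; congr (_ && _).
have H0 : [seq z <- take j.+1 (y :: w) | x <= z] = [::].
  exact/all_lt_filter/take_run_path.
by rewrite -[in RHS](cat_take_drop j.+1 (y :: w)) filter_cat H0.
Qed.

Lemma run_insert m j w : all (ltn^~ m) w -> 0 < j <= run w -> run (insert m j w) = j.
Proof.
elim: w j => [|x w IH] [|j] //= /andP[xm wm]; rewrite ltnS => jr.
congr _.+1.
case: j jr => [|j] jr.
  by rewrite insert0 /= ltnNge ltnW.
move: jr; case: ifP => // hx jr.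
case: w wm IH hx jr => [|y w] // wm IH hx jr; rewrite IH //=.
by rewrite /= in hx; rewrite hx.
Qed.

Lemma asc_cons_max m w : all (ltn^~ m) w -> asc (m :: w) = asc w.
Proof. by case: w => //= x w /andP[xm _]; rewrite leqNgt xm. Qed.

Lemma run_cons_max m w : all (ltn^~ m) w -> run (m :: w) = (run w).+1.
Proof. by case: w => [|x w] /=; [rewrite ltnn | case/andP => -> ]. Qed.

(** Inside the run a descent is replaced by an ascent and a descent; at the end of the word an
    ascent is added. At the end of a shorter run the ascent already there is replaced by one ascent
    and one descent. *)
Lemma asc_insert m j w : all (ltn^~ m) w -> 0 < j <= run w ->
  asc (insert m j w) = asc w + ((j < run w) || (j == size w)).
Proof.
elim: w j => [|x w IH] [|j] // /[dup] H /andP[xm wm]; rewrite ltnS => jr.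
rewrite insert_cons.
case: j jr => [|j] jr.
  rewrite insert0 [LHS]/= (ltnW xm) -/(asc (m :: w)) asc_cons_max //.
  case: w wm {IH H jr} => [|y w] wm /=; first by rewrite orbT.
  by case: (leqP x y) => /= _; rewrite ?addn0 ?addn1.
move: jr => /=; case: ifP => // hx jr.
case: w wm IH hx jr {H} => [|y w] // wm IH hx jr.
transitivity ((x <= y) + asc (insert m j.+1 (y :: w))); first by [].
rewrite /= in hx; rewrite IH // addnA.
by rewrite !ltnS eqSS.
Qed.

Lemma run_insert2 m j w : all (ltn^~ m) w -> j <= run w -> run (m :: insert m j w) = j.+1.
Proof.
case: j => [|j] wm jr; first by rewrite insert0 /= ltnn.
transitivity (run (insert m j.+1 w)).+1; last by rewrite run_insert.
by case: w wm jr => [|x w] //= /andP[-> _].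
Qed.

Lemma asc_insert2 m j w : all (ltn^~ m) w -> j <= run w ->
  asc (m :: insert m j w) = asc w + ((j < run w) || (j == size w)).
Proof.
case: j => [|j] wm jr.
  rewrite insert0 [LHS]/= leqnn -/(asc (m :: w)) asc_cons_max // run_gt0 addnC.
  by case: w wm jr.
rewrite -(asc_insert wm) //.
by case: w wm jr => [|x w] //= /andP[xm _] _; rewrite leqNgt xm.
Qed.

(** The words are built from the rest left by deleting the largest letter [m']. The groups are: no
    copy, one copy in front, one copy at a later place of the initial run, two copies. Three copies
    would be a triple, and of two copies the first has to be the first letter. *)
Fixpoint words (m l : nat) : seq (seq nat) :=
  if m is m'.+1 then
    words m' l
    ++ (if l is l1.+1 then
          [seq m' :: w | w <- words m' l1]
          ++ flatten [seq [seq insert m' j w | j <- iota 1 (run w)] | w <- words m' l1]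
        else [::])
    ++ (if l is l2.+2 then
          flatten [seq [seq m' :: insert m' j w | j <- iota 0 (run w).+1] | w <- words m' l2]
        else [::])
  else if l is 0 then [:: [::]] else [::].

Lemma wordsS m l : words m.+1 l =
    words m l
    ++ (if l is l1.+1 then
          [seq m :: w | w <- words m l1]
          ++ flatten [seq [seq insert m j w | j <- iota 1 (run w)] | w <- words m l1]
        else [::])
    ++ (if l is l2.+2 then
          flatten [seq [seq m :: insert m j w | j <- iota 0 (run w).+1] | w <- words m l2]
        else [::]).
Proof. by []. Qed.

Lemma size_insert m j w : size (insert m j w) = (size w).+1.
Proof. by rewrite insertE size_cat /= addnS -size_cat cat_take_drop. Qed.

Lemma all_insert (p : pred nat) m j w : all p (insert m j w) = p m && all p w.
Proof. by rewrite insertE all_cat /= andbCA -all_cat cat_take_drop. Qed.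

Lemma mem_all_ltS m w : all (ltn^~ m.+1) w -> m \notin w -> all (ltn^~ m) w.
Proof.
move=> /allP H mw; apply/allP => x xw; have := H x xw; rewrite /= ltnS leq_eqVlt.
by case/orP => // /eqP e; rewrite -e xw in mw.
Qed.

Lemma insert_index m w : m \in w -> insert m (index m w) (rem m w) = w.
Proof.
elim: w => //= x w IH; rewrite inE eq_sym; case: eqP => [-> _|_ /= mw].
  by rewrite insert0.
by rewrite IH.
Qed.

Lemma all_lt_sub m n w : m <= n -> all (ltn^~ m) w -> all (ltn^~ n) w.
Proof. by move=> mn; apply: sub_all => x /= xm; apply: leq_trans mn. Qed.

Lemma notin_all_lt m w : all (ltn^~ m) w -> m \notin w.
Proof. by move=> /allP H; apply/negP => /H /=; rewrite ltnn. Qed.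

Lemma all_rem (p : pred nat) m w : all p w -> all p (rem m w).
Proof. by move=> /allP H; apply/allP => x /mem_rem /H. Qed.

(** A letter in front of two copies of the maximum would start a triple, and so would a first of
    three copies: in either case a strictly decreasing list would contain [m] twice. *)
Lemma avoiding_max m w : all (ltn^~ m.+1) w -> avoiding w -> m \in w ->
  (all (ltn^~ m) (rem m w)) \/
  (exists2 w', w = m :: w' & (m \in w') && all (ltn^~ m) (rem m w')).
Proof.
move=> wm aw mw; case: (boolP (m \in rem m w)) => mr; last first.
  by left; apply: mem_all_ltS => //; apply: all_rem.
right; case: w mw wm aw mr => // x w; rewrite inE /= eq_sym.
case: eqP => [-> _ /andP[_ wm]|/eqP xm /= mw /andP[xlt wm]] /andP[sw aw] mr.
  exists w; rewrite // mr; apply: mem_all_ltS; first exact: all_rem.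
  apply/negP => mrr; have := insert_index mr => we.
  have : sorted gtn [seq y <- insert m (index m w) (rem m w) | m <= y] by rewrite we.
  rewrite insertE filter_cat /= leqnn => srt.
  have : uniq [seq y <- w | m <= y] by apply: sorted_uniq sw; [exact: gtn_trans | move=> y /=; rewrite ltnn].
  have : 1 < count_mem m [seq y <- w | m <= y].
    rewrite -we insertE filter_cat /= leqnn count_cat /= eqxx addnS ltnS.
    rewrite -count_cat -filter_cat cat_take_drop -has_count has_pred1.
    by rewrite mem_filter leqnn.
  by move=> c1 /count_uniq_mem cu; rewrite cu in c1; move: c1; case: (_ \in _).
have {}mr : m \in rem m w by move: mr; rewrite inE eq_sym (negPf xm).
have := insert_index mw => we.
have : uniq [seq y <- w | x <= y] by apply: sorted_uniq sw; [exact: gtn_trans | move=> y /=; rewrite ltnn].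
have xm' : x <= m by rewrite -ltnS.
have : 1 < count_mem m [seq y <- w | x <= y].
  rewrite -we insertE filter_cat /= xm' count_cat /= eqxx addnS ltnS.
  rewrite -count_cat -filter_cat cat_take_drop -has_count has_pred1.
  by rewrite mem_filter xm'.
by move=> c1 /count_uniq_mem cu; rewrite cu in c1; move: c1; case: (_ \in _).
Qed.

Lemma mem_words m l w :
  (w \in words m l) = [&& size w == l, all (ltn^~ m) w & avoiding w].
Proof.
elim: m l w => [|m IH] l w.
  by case: l => [|l]; case: w => [|x w] //=; rewrite andbF.
rewrite wordsS !mem_cat IH.
apply/idP/idP.
  case/or3P.
  - by case/and3P => -> /(all_lt_sub (leqnSn m)) -> ->.
  - case: l => // l; rewrite mem_cat => /orP[/mapP[u] | /flatten_mapP[u]]; rewrite IH => /and3P[/eqP su um au].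
      by move=> ->; rewrite avoiding_cons_max //= su eqxx leqnn (all_lt_sub _ um).
    case/mapP => j; rewrite mem_iota add1n ltnS => /andP[j0 jr] ->.
    rewrite size_insert su eqxx all_insert /= leqnn (all_lt_sub _ um) //=.
    by rewrite avoiding_insert ?au ?jr // (leq_trans jr) // run_le_size.
  - case: l => [|[|l]] // /flatten_mapP[u]; rewrite IH => /and3P[/eqP su um au].
    case/mapP => j; rewrite mem_iota add0n ltnS => /andP[_ jr] ->.
    rewrite /= size_insert su eqxx all_insert /= leqnn (all_lt_sub _ um) //=.
    rewrite avoiding_insert ?au ?jr ?(leq_trans jr) ?run_le_size // andbT.
    rewrite insertE filter_cat /= leqnn.
    by rewrite !all_lt_filter //; apply/allP => x; [move/mem_drop/(allP um)|move/mem_take/(allP um)].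
case/and3P => /eqP sw wm aw.
case: (boolP (m \in w)) => mw; last first.
  by rewrite sw eqxx aw (mem_all_ltS wm mw).
apply/orP; right.
have sj : index m w <= size (rem m w) by rewrite size_rem //; have := mw; rewrite -index_mem; case: (size w).
case: (avoiding_max wm aw mw) => [um|[w' we /andP[mw' um]]].
  have we := insert_index mw.
  case: l sw => [|l] sw; first by move/eqP: sw mw; rewrite size_eq0 => /eqP ->.
  have ul : size (rem m w) = l by rewrite size_rem // sw.
  move: aw; rewrite -we avoiding_insert // => /andP[au jr].
  apply/orP; left; rewrite mem_cat.
  case: (posnP (index m w)) => j0.
    by apply/orP; left; rewrite j0 insert0 map_f // IH ul eqxx um.
  apply/orP; right; apply/flatten_mapP; exists (rem m w); first by rewrite IH ul eqxx um.
  apply/mapP; exists (index m w); first by rewrite mem_iota j0 add1n ltnS.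
  by [].
subst w; case: l sw => [|[|l]] // [sw]; first by move/eqP: sw mw'; rewrite size_eq0 => /eqP ->.
have we := insert_index mw'.
have ul : size (rem m w') = l by rewrite size_rem // sw.
have sj' : index m w' <= size (rem m w') by rewrite size_rem //; have := mw'; rewrite -index_mem; case: (size w').
case/andP: aw => _; rewrite -/(avoiding w') -{1}we avoiding_insert // => /andP[au jr].
apply/orP; right; apply/flatten_mapP; exists (rem m w'); first by rewrite IH ul eqxx um.
apply/mapP; exists (index m w'); first by rewrite mem_iota add0n ltnS.
by rewrite we.
Qed.


Lemma rem_insert m j w : m \notin w -> rem m (insert m j w) = w.
Proof.
elim: w j => [|x w IH] [|j]; rewrite ?insert0 /= ?eqxx //.
by rewrite inE eq_sym negb_or => /andP[/negPf -> mw]; rewrite IH.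
Qed.

Lemma index_insert m j w : m \notin w -> j <= size w -> index m (insert m j w) = j.
Proof.
elim: w j => [|x w IH] [|j]; rewrite ?insert0 /= ?eqxx //.
by rewrite inE eq_sym negb_or => /andP[/negPf -> mw] jw; rewrite IH.
Qed.

Lemma words_notin m l w : w \in words m l -> m \notin w.
Proof. by rewrite mem_words => /and3P[_ /notin_all_lt]. Qed.

(** From [insert m j w] the word is recovered by [rem m] and the position by [index m]. The map [g]
    first strips a further copy of [m] from the front, if there is one. *)
Lemma uniq_insertions (T : eqType) (f : nat -> seq nat -> T) (g : T -> seq nat) m l a b :
  (forall j w, g (f j w) = insert m j w) ->
  (forall w, w \in words m l -> a + b w <= (run w).+1) ->
  uniq (words m l) -> uniq (flatten [seq [seq f j w | j <- iota a (b w)] | w <- words m l]).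
Proof.
move=> gf ab uw; apply: allpairs_uniq_dep => //.
  by move=> w _; apply: iota_uniq.
have mt (t : {_ : seq nat & nat}) :
    t \in [seq existT (fun _ : seq nat => nat) w j | w <- words m l, j <- iota a (b w)] ->
    m \notin tag t /\ tagged t <= size (tag t).
  case/allpairsPdep => w [j [ww]]; rewrite mem_iota => /andP[_ jb] ->.
  split=> /=; first exact: words_notin ww.
  have := ab w ww; have := run_le_size w; lia.
move=> t t' /mt[n1 s1] /mt[n2 s2] /(congr1 g) /=; rewrite !gf => e.
have e1 : tag t = tag t' by rewrite -(rem_insert (tagged t) n1) e rem_insert.
have e2 : tagged t = tagged t' by rewrite -(index_insert n1 s1) e index_insert.
by case: t t' e1 e2 {n1 n2 s1 s2 e} => [w j] [w' j'] /= -> ->.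
Qed.

Lemma uniq_words m l : uniq (words m l).
Proof.
elim: m l => [|m IH] l; first by case: l.
rewrite wordsS; set C := (X in _ ++ _ ++ X).
have uC : uniq C /\ {in C, forall w, exists2 u, w = m :: u & m \in u}.
  rewrite /C; case: l {C} => [|[|l]] //; split.
    by apply: (@uniq_insertions _ _ behead) => // w _; rewrite add0n.
  move=> w /flatten_mapP[u _ /mapP[j _ ->]]; exists (insert m j u) => //.
  by rewrite insertE mem_cat mem_head orbT.
set B := (X in _ ++ X ++ _).
have uB : uniq B /\ {in B, forall w, m \in w /\ m \notin rem m w}.
  rewrite /B; case: l {B C uC} => [|l] //; split; last first.
    move=> w; rewrite mem_cat => /orP[/mapP[u uw ->]|/flatten_mapP[u uw /mapP[j _ ->]]].
      by rewrite mem_head /= eqxx (words_notin uw).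
    by rewrite rem_insert ?(words_notin uw) // insertE mem_cat mem_head orbT.
  rewrite cat_uniq map_inj_uniq ?IH => [|u v [] //] /=.
  rewrite (@uniq_insertions _ _ id) ?andbT //.
  apply/hasPn => w /flatten_mapP[u uw /mapP[j]]; rewrite mem_iota add1n ltnS => /andP[j0 jr] ->.
  apply/mapP => -[v vw] /(congr1 (index m)) /=; rewrite eqxx index_insert ?(words_notin uw) //.
    by move=> e; rewrite e in j0.
  by rewrite (leq_trans jr) // run_le_size.
case: uB uC => uB pB [uC pC].
rewrite !cat_uniq IH uB uC andbT /=; apply/andP; split.
  apply/hasPn => w; rewrite mem_cat => wBC; apply/negP => /words_notin mw; move: mw.
  by case/orP: wBC => [/pB[-> _] | /pC[u -> _]]; rewrite ?mem_head.
apply/hasPn => w /pC[u -> mu]; apply/negP => /pB[_] /=.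
by rewrite eqxx mu.
Qed.

(** * Recursion for the number of words by ascents and initial run *)

Local Open Scope nat_scope.

Definition num_words_run (m l r k : nat) : nat :=
  count (fun w => (run w == r) && (asc w == k)) (words m l).
Definition num_words_minrun (m l r k : nat) : nat :=
  count (fun w => (r <= run w) && (asc w == k)) (words m l).
(* Counts the words into which a new largest letter can be inserted in position [r]
   so that [k] ascents result. *)
Definition num_insertions (m l r k : nat) : nat :=
  count (fun w => (r <= run w) && (asc w + ((r < run w) || (r == size w)) == k))
    (words m l).

Lemma words_all m l w : w \in words m l -> all (ltn^~ m) w.
Proof. by rewrite mem_words => /and3P[]. Qed.

Lemma words_size m l w : w \in words m l -> size w = l.
Proof. by rewrite mem_words => /and3P[/eqP]. Qed.

Lemma count_flatten_insertions (f : nat -> seq nat -> seq nat) (a : nat) (b : seq nat -> nat)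
    (p : pred (seq nat)) (q : pred (seq nat)) r s :
  (forall w, w \in s -> forall j, a <= j < a + b w -> p (f j w) = (j == r) && q w) ->
  count p (flatten [seq [seq f j w | j <- iota a (b w)] | w <- s])
  = count (fun w => (a <= r < a + b w) && q w) s.
Proof.
elim: s => //= w s IH H; rewrite count_cat IH => [|u us]; last by apply: H; rewrite inE us orbT.
congr (_ + _); rewrite count_map.
have -> : count (preim (f^~ w) p) (iota a (b w)) = count (fun j => (j == r) && q w) (iota a (b w)).
  by apply: eq_in_count => j; rewrite mem_iota => jb /=; rewrite H ?inE ?eqxx.
case: (q w); last by rewrite andbF; elim: (iota _ _) => //= x t ->; rewrite andbF.
rewrite andbT -mem_iota -count_uniq_mem ?iota_uniq //.
by apply: eq_count => j /=; rewrite andbT.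
Qed.

(** The summands follow the groups in [words]. With two copies of the largest letter the front copy
    lengthens the run by one, so the other copy goes to position [r] and not [r.+1]. *)
Lemma num_words_run_rec m l r k :
  num_words_run m.+1 l r.+1 k =
    num_words_run m l r.+1 k
    + (if l is l1.+1 then num_words_run m l1 r k + num_insertions m l1 r.+1 k else 0)
    + (if l is l2.+2 then num_insertions m l2 r k else 0).
Proof.
rewrite /num_words_run wordsS !count_cat -addnA; congr (_ + (_ + _)).
  case: l => [|l] //; rewrite count_cat count_map; congr (_ + _).
    apply: eq_in_count => w /words_all wm; rewrite [LHS]/=.
    by rewrite -/(run (m :: w)) -/(asc (m :: w)) run_cons_max // asc_cons_max.
  rewrite (@count_flatten_insertions _ _ _ _
    (fun w => asc w + ((r.+1 < run w) || (r.+1 == size w)) == k) r.+1).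
    by apply: eq_count => w; rewrite /= add1n ltnS.
  move=> w /words_all wm j; rewrite add1n ltnS => jr.
  by rewrite run_insert // asc_insert //; case: eqP => // ->.
case: l => [|[|l]] //.
rewrite (@count_flatten_insertions (fun j w => m :: insert m j w) _ _ _
  (fun w => asc w + ((r < run w) || (r == size w)) == k) r).
  by apply: eq_count => w; rewrite /= add0n ltnS.
move=> w /words_all wm j; rewrite add0n ltnS => /andP[_ jr].
by rewrite run_insert2 // asc_insert2 // eqSS; case: eqP => // ->.
Qed.

Lemma num_words_run0 m l k : num_words_run m l 0 k.+1 = 0.
Proof.
apply/eqP; rewrite -leqn0 leqNgt -has_count; apply/hasPn => w _.
by rewrite negb_and; case: w => //=; rewrite orbT.
Qed.

Lemma num_words_minrun_rec m l r k :
  num_words_minrun m l r k = num_words_run m l r k + num_words_minrun m l r.+1 k.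
Proof.
rewrite /num_words_minrun /num_words_run -count_predUI.
rewrite -[LHS]addn0; congr (_ + _).
  by apply: eq_count => w /=; rewrite -andb_orl leq_eqVlt eq_sym.
symmetry; apply/eqP; rewrite -leqn0 leqNgt -has_count; apply/hasPn => w _ /=.
by apply/negP => /andP[/andP[/eqP -> _] /andP[]]; rewrite ltnn.
Qed.

Lemma num_words_minrun_big m l r k : l < r -> num_words_minrun m l r k = 0.
Proof.
move=> lr; apply/eqP; rewrite -leqn0 leqNgt -has_count; apply/hasPn => w /words_size sw.
by rewrite negb_and -ltnNge (leq_ltn_trans (run_le_size w)) // sw.
Qed.

(* Without ascents the word is strictly decreasing. *)
Lemma num_words_minrun0 m l r : num_words_minrun m l r 0 = (r <= l) * 'C(m, l).
Proof.
have -> : num_words_minrun m l r 0 = (r <= l) * count (fun w => asc w == 0) (words m l).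
  rewrite /num_words_minrun; case: leqP => rl; last first.
    apply/eqP; rewrite mul0n -leqn0 leqNgt -has_count; apply/hasPn => w /words_size sw.
    by rewrite negb_and -ltnNge (leq_ltn_trans (run_le_size w)) // sw.
  rewrite mul1n; apply: eq_in_count => w /words_size sw.
  by rewrite andbC asc_eq0; case: eqP => // ->; rewrite sw rl.
congr (_ * _); elim: m l {r} => [|m IH] [|l] //; first by rewrite wordsS !cats0 IH !bin0.
rewrite wordsS !count_cat IH binS; congr (_ + _).
rewrite -addnA -[RHS]addn0 count_map; congr (_ + _).
  rewrite -IH; apply: eq_in_count => w /words_all wm.
  by rewrite /= -/(asc (m :: w)) asc_cons_max.
have pos (w : seq nat) r : r <= run w -> 0 < asc w + ((r < run w) || (r == size w)).
  move=> rw; case: (posnP (asc w)) => [a0|]; last by rewrite addn_gt0 => ->.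
  move/eqP: a0 (a0) => /[dup]; rewrite {1}asc_eq0 => /eqP e _ ->; rewrite add0n -e.
  by move: rw; rewrite leq_eqVlt => /orP[->|->]; rewrite ?orbT.
apply/eqP; rewrite addn_eq0; apply/andP; split; rewrite -leqn0 leqNgt -has_count.
  apply/hasPn => w /flatten_mapP[u /words_all um /mapP[j]].
  by rewrite mem_iota add1n ltnS => /andP[j0 jr] ->; rewrite asc_insert ?j0 // -lt0n pos.
case: l => [|l] //.
apply/hasPn => w /flatten_mapP[u /words_all um /mapP[j]].
by rewrite mem_iota add0n ltnS => /andP[_ jr] ->; rewrite asc_insert2 // -lt0n pos.
Qed.

(** An insertion at the end of the run creates no ascent, and one inside the run creates one. The
    last term is the decreasing words with [r] equal to run and size; its condition [r == l] is
    written so that it adds up with [r < l]. *)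
Lemma num_insertions_split m l r k :
  num_insertions m l r k.+1 =
    num_words_run m l r k.+1 + num_words_minrun m l r.+1 k
    + (k == 0) * (r <= l < r.+1) * 'C(m, l).
Proof.
have -> : (k == 0) * (r <= l < r.+1) * 'C(m, l) =
    count (fun w => (k == 0) && (r == size w) && (asc w == 0)) (words m l).
  have -> : (r <= l < r.+1) = (r == l) by lia.
  case: (k == 0) => /=; last by rewrite !mul0n; elim: (words m l).
  rewrite mul1n; case: eqP => [->|rl] /=; last first.
    symmetry; apply/eqP; rewrite mul0n -leqn0 leqNgt -has_count; apply/hasPn => w /words_size ->.
    by rewrite (introF eqP rl).
  rewrite mul1n; have := num_words_minrun0 m l 0; rewrite leq0n mul1n => <-.
  by apply: eq_in_count => w /words_size ->; rewrite eqxx leq0n.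
rewrite /num_insertions /num_words_run /num_words_minrun.
elim: (words m l) => //= w s ->.
have := run_le_size w; have := asc_eq0 w.
case: (ltngtP r (run w)) => rw a0 sw; last 1 first.
- subst r; case: (eqVneq (run w) (size w)) a0 => [e a0|ne a0].
    by rewrite (eqP a0) eqxx /= add0n eqSS eq_sym; case: (k == 0) => /=; lia.
  by rewrite addn0 a0 !andbF; lia.
- have -> : (r == size w) = false by apply/eqP => e; move: rw; rewrite e ltnNge sw.
  rewrite andbF /= addn1 eqSS; lia.
have -> : ((k == 0) && (r == size w) && (asc w == 0)) = false; last by lia.
by rewrite a0; apply/negP => /andP[/andP[_ /eqP e1] /eqP e2]; move: rw; rewrite e1 e2 ltnn.
Qed.

(** * Closed form by two-column tableaux *)

Local Open Scope ring_scope.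

(** The dual Jacobi-Trudi determinant for columns of lengths [a >= b]. The sums below also use it
    for [a < b], where it is the extension that is antisymmetric as in [schur2_anti]. *)
Definition schur2 (m a b : nat) : int :=
  'C(m, a)%:Z * 'C(m, b)%:Z - 'C(m, a.+1)%:Z * (if b is b'.+1 then 'C(m, b') else 0)%:Z.

(* The branching rule: add to a two-column tableau the entries equal to the largest letter. *)
Lemma schur2S m a b :
  schur2 m.+1 a.+1 b.+1 = schur2 m a.+1 b.+1 + schur2 m a b.+1 + schur2 m a.+1 b + schur2 m a b.
Proof.
rewrite /schur2; case: b => [|b]; rewrite ?bin0 !binS ?bin0 !PoszD; ring.
Qed.

Lemma schur2_anti m a b : schur2 m b a.+1 = - schur2 m a b.+1.
Proof. rewrite /schur2; ring. Qed.

(** This and the next two sums will be the values of [num_words_run], [num_insertions] and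
    [num_words_minrun] for [k.+1] ascents; words without ascents are counted by
    [num_words_minrun0]. *)
Definition run_sum (m l r k : nat) : int :=
  \sum_(0 <= a < l - r) schur2 m (a + r) (l - r - a)
     * ('C(a, k) * 'C((l - r - a).-1, k))%:Z.

Definition insertion_sum (m l r k : nat) : int :=
  \sum_(0 <= a < l.+1 - r) schur2 m (a + r) (l - r - a) * ('C(a, k) * 'C(l - r - a, k))%:Z.

Definition minrun_sum (m l r k : nat) : int :=
  \sum_(0 <= a < l) schur2 m a (l - a) * ('C(a.+1 - r, k.+1) * 'C((l - a).-1, k))%:Z.

(** Reversing the sum exchanges the two columns, which changes the sign of [schur2] and preserves
    the product of binomials. *)
Lemma run_sum0 m l k : run_sum m l 0 k = 0.
Proof.
have E : run_sum m l 0 k = - run_sum m l 0 k.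
  rewrite /run_sum subn0 [in LHS]big_nat_rev /= -sumrN; apply: eq_big_nat => a /andP[_ al].
  have [b lE] : exists b, l = (a + b.+1)%N by exists (l - a).-1; lia.
  rewrite !addn0 add0n lE.
  have -> : (a + b.+1 - a.+1 = b)%N by lia.
  have -> : (a + b.+1 - b = a.+1)%N by lia.
  have -> : (a + b.+1 - a = b.+1)%N by lia.
  by rewrite schur2_anti mulNr mulnC.
by apply/eqP; move: E => /eqP; rewrite -addr_eq0 -mulr2n mulrn_eq0.
Qed.

(** Pascal's rule: ['C(a.+1 - r, k.+1)] is the sum of ['C(a - r', k)] over [r'] from [r] to [a]. *)
Lemma minrun_sum_rec m l r k :
  minrun_sum m l r k = run_sum m l r k + minrun_sum m l r.+1 k.
Proof.
rewrite /minrun_sum /run_sum.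
have -> : \sum_(0 <= a < l - r) schur2 m (a + r) (l - r - a) * ('C(a, k) * 'C((l - r - a).-1, k))%:Z
  = \sum_(0 <= a < l) schur2 m a (l - a) * ((r <= a) * 'C(a - r, k) * 'C((l - a).-1, k))%:Z.
  have [lr|rl] := leqP l r.
    rewrite big_geq; last by lia.
    rewrite big_nat big1 // => a /andP[_ al].
    by rewrite leqNgt (leq_trans al lr) /= !mul0n mulr0.
  rewrite [RHS](big_cat_nat (n := r)) //=; last exact: ltnW.
  rewrite [X in X + _]big_nat [X in X + _]big1 ?add0r; last first.
    by move=> a /andP[_ ar]; rewrite leqNgt ar /= !mul0n mulr0.
  rewrite -[X in _ = \sum_(X <= i < _) _]add0n big_addn; apply: eq_big_nat => a /andP[_ al].
  by rewrite leq_addl mul1n addnK (addnC a r) subnDA.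
rewrite -big_split /=; apply: eq_big_nat => a /andP[_ al].
rewrite -mulrDr -PoszD -mulnDl; congr (_ * (_ * _)%N%:Z).
rewrite subSS; case: leqP => ra.
  by rewrite subSn // binS mul1n addnC.
have [-> ->] : (a.+1 - r = 0 /\ a - r = 0)%N by lia.
by rewrite !bin0n.
Qed.

Lemma insertion_sum_split m l r k :
  insertion_sum m l r k = run_sum m l r k
    + (if k is k'.+1 then minrun_sum m l r.+1 k' else ((r <= l) * 'C(m, l))%N%:Z).
Proof.
rewrite /insertion_sum; have [rl|lr] := leqP r l; last first.
  rewrite /run_sum /minrun_sum !big_geq ?add0r; try lia.
  case: k => [|k]; first by rewrite mul0n.
  rewrite big_nat big1 // => a /andP[_ al].
  have -> : (a.+1 - r.+1 = 0)%N by lia.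
  by rewrite bin0n mul0n mulr0.
rewrite subSn // big_nat_recr //= subnn subnK //.
have s0 : schur2 m l 0 = 'C(m, l)%:Z by rewrite /schur2 bin0; ring.
rewrite s0; case: k => [|k].
  rewrite !bin0 mulr1 mul1n; congr (_ + _).
  by apply: eq_big_nat => a al; rewrite !bin0.
rewrite bin0n muln0 mulr0 addr0.
have -> : minrun_sum m l r.+1 k = \sum_(0 <= a < l - r) schur2 m (a + r) (l - r - a) * ('C(a, k.+1) * 'C((l - r - a).-1, k))%:Z.
  rewrite /minrun_sum (big_cat_nat (n := r)) //=.
  rewrite [X in X + _]big_nat [X in X + _]big1 ?add0r; last first.
    by move=> a /andP[_ ar]; rewrite (_ : a.+1 - r.+1 = 0)%N ?bin0n ?mul0n ?mulr0 //; lia.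
  rewrite -[X in \sum_(X <= i < _) _ = _]add0n big_addn; apply: eq_big_nat => a /andP[_ al].
  by rewrite subSS addnK (addnC a r) subnDA.
rewrite /run_sum -big_split /=; apply: eq_big_nat => a /andP[_ al].
rewrite -mulrDr -PoszD -mulnDr; congr (_ * (_ * _)%N%:Z).
by case: (l - r - a)%N (subn_gt0 a (l - r)) => [|b]; rewrite al // binS.
Qed.

(** The four terms of [schur2S] match the four summands of [num_words_run_rec] for each [a]
    separately. *)
Lemma run_sumS m l r k :
  run_sum m.+1 l r.+1 k = run_sum m l r.+1 k
    + (if l is l1.+1 then run_sum m l1 r k + insertion_sum m l1 r.+1 k else 0)
    + (if l is l2.+2 then insertion_sum m l2 r k else 0).
Proof.
rewrite /run_sum /insertion_sum; case: l => [|[|l]].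
- by rewrite !big_geq // !addr0.
- by rewrite !big_geq ?addr0 //; lia.
rewrite !subSS -!big_split /=.
apply: eq_big_nat => a /andP[_ al].
have [b lE] : exists b, l = (a + r + b)%N by exists (l - r - a)%N; lia.
have -> : (l.+1 - r - a = b.+1)%N by lia.
have -> : (l - r - a = b)%N by lia.
rewrite /= !addnS schur2S; ring.
Qed.

Lemma num_words_minrun_of_run m l r k :
  (forall r' , (num_words_run m l r' k.+1)%:Z = run_sum m l r' k) ->
  (num_words_minrun m l r k.+1)%:Z = minrun_sum m l r k.
Proof.
move=> H; have [d] : exists d, (l.+1 - r <= d)%N by exists (l.+1 - r)%N.
elim: d r => [|d IHd] r dr.
  rewrite num_words_minrun_big ?/minrun_sum; last by lia.
  rewrite big_nat big1 // => a /andP[_ al].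
  have -> : (a.+1 - r = 0)%N by lia.
  by rewrite bin0n mul0n mulr0.
rewrite num_words_minrun_rec minrun_sum_rec PoszD H IHd //; lia.
Qed.

Lemma num_words_run_closed m l r k : (num_words_run m l r k.+1)%:Z = run_sum m l r k.
Proof.
elim: m l r k => [|m IH] l r k.
  rewrite (_ : num_words_run _ _ _ _ = 0)%N; last first.
    by rewrite /num_words_run; case: l => //=; rewrite andbF.
  rewrite /run_sum big_nat big1 // => a /andP[_ al].
  case: (l - r - a)%N (subn_gt0 a (l - r)) => [|b]; rewrite al // => _.
  by rewrite /schur2 (bin0n b.+1) (bin0n (a + r).+1) /=; ring.
(* The recursion starts at run 1. For run 0 only the empty word remains, which has no ascent, and
   the sum vanishes by antisymmetry. *)
case: r => [|r]; first by rewrite num_words_run0 run_sum0.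
have IHV l' r' k' : (num_words_minrun m l' r' k'.+1)%:Z = minrun_sum m l' r' k'.
  exact: num_words_minrun_of_run.
have IHU l' r' : (num_insertions m l' r' k.+1)%:Z = insertion_sum m l' r' k.
  rewrite num_insertions_split insertion_sum_split !PoszD IH -addrA; congr (_ + _).
  case: k => [|k]; last by rewrite IHV !mul0n addr0.
  rewrite num_words_minrun0 -PoszD mul1n -mulnDl; congr (_ * _)%N%:Z; lia.
rewrite num_words_run_rec run_sumS -IH; case: l => [|[|l]]; rewrite ?PoszD -?IH -?IHU //.
Qed.

Lemma num_words_minrun_closed m l r k :
  (num_words_minrun m l r k.+1)%:Z = minrun_sum m l r k.
Proof. by apply: num_words_minrun_of_run => *; apply: num_words_run_closed. Qed.

(** * From words back to functions *)

Local Open Scope nat_scope.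

Lemma pairwise_filter (T : Type) (r : rel T) (p : pred T) (s : seq T) :
  pairwise r (filter p s) = pairwise (fun x y => p x ==> p y ==> r x y) s.
Proof.
elim: s => //= x s IH; case: ifP => px /=; last first.
  by rewrite IH all_predT.
by rewrite IH all_filter.
Qed.

Lemma avoidingP w : reflect
  (forall i j k, i < j -> j < k -> k < size w ->
     nth 0 w i <= nth 0 w j -> nth 0 w j <= nth 0 w k -> False)
  (avoiding w).
Proof.
elim: w => [|x w IH]; first by left=> i j k.
rewrite /= sorted_pairwise ?pairwise_filter; last exact: gtn_trans.
apply: (iffP andP) => [[/(pairwiseP 0) xw /IH aw] [|i] [|j] [|k] //= ij jk ks fi fj|H].
- rewrite ltnS in jk; rewrite ltnS in ks.
  have := xw j k (ltn_trans jk ks : j \in gtn (size w)) ks jk.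
  by rewrite fi (leq_trans fi fj) /= ltnNge fj.
- exact: (aw i j k).
split; last by apply/IH => i j k ij jk ks; apply: (H i.+1 j.+1 k.+1).
apply/(pairwiseP 0) => j k; rewrite !inE => js ks jk.
apply/implyP => xj; apply/implyP => xk; rewrite /= ltnNge; apply/negP => fjk.
exact: (H 0 j.+1 k.+1).
Qed.

Lemma asc_sum w : asc w = \sum_(0 <= i < (size w).-1) (nth 0 w i <= nth 0 w i.+1).
Proof.
elim: w => [|x [|y w] IH]; [by rewrite big_geq|by rewrite big_geq|].
by rewrite [LHS]/= -/(asc (y :: w)) IH [size _]/= big_nat_recl.
Qed.

Definition word_of (n : nat) (f : {ffun 'I_n -> 'I_n}) : seq nat :=
  [seq nat_of_ord (f i) | i <- enum 'I_n].

Lemma size_word_of n (f : {ffun 'I_n -> 'I_n}) : size (word_of f) = n.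
Proof. by rewrite size_map size_enum_ord. Qed.

Lemma nth_word_of n (f : {ffun 'I_n -> 'I_n}) (i : 'I_n) : nth 0 (word_of f) i = f i.
Proof. by rewrite (nth_map i) ?size_enum_ord // nth_ord_enum. Qed.

Lemma avoiding_word_of n (f : {ffun 'I_n -> 'I_n}) : avoiding (word_of f) = avoids123 f.
Proof.
apply/avoidingP/negP => [H /existsP[i /existsP[j /existsP[k /and4P[ij jk fi fj]]]]|H i j k ij jk].
  by apply: (H i j k) => //; rewrite ?size_word_of ?nth_word_of.
rewrite size_word_of => kn fi fj; apply: H.
have jn := ltn_trans jk kn; have i_n := ltn_trans ij jn.
apply/existsP; exists (Ordinal i_n); apply/existsP; exists (Ordinal jn).
by apply/existsP; exists (Ordinal kn); rewrite /= ij jk -!nth_word_of /= fi fj.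
Qed.

Lemma asc_word_of n (f : {ffun 'I_n -> 'I_n}) : asc (word_of f) = #|ascents f|.
Proof.
rewrite asc_sum size_word_of /ascents -sum1dep_card [RHS]big_mkcond /=.
case: n f => [|n] f; first by rewrite big_geq ?big_ord0.
rewrite big_ord_recr /= [X in _ = _ + X]ifF ?addn0; last first.
  apply/negbTE/existsPn => j; rewrite negb_and; apply/orP; left.
  by rewrite neq_ltn (leq_trans (ltn_ord j)).
rewrite big_mkord; apply: eq_bigr => i _.
have e1 := nth_word_of f (widen_ord (leqnSn n) i).
have e2 := nth_word_of f (lift ord0 i).
rewrite /= in e1; rewrite lift0 in e2; rewrite e1 e2.
set b := [exists j, _]; suff -> : b = (f (widen_ord (leqnSn n) i) <= f (lift ord0 i)) by case: (_ <= _).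
apply/existsP/idP => [[j /andP[/eqP e]]|le].
  by rewrite (_ : j = lift ord0 i) //; apply: val_inj; rewrite /= e.
by exists (lift ord0 i); rewrite le andbT lift0.
Qed.

Lemma word_of_inj n : injective (@word_of n).
Proof.
move=> f g e; apply/ffunP => i; apply: val_inj.
by rewrite /= -!nth_word_of e.
Qed.

Lemma card_avoids123 n k :
  #|[set f : {ffun 'I_n -> 'I_n} | avoids123 f && (#|ascents f| == k)]|
  = count (fun w => asc w == k) (words n n).
Proof.
rewrite cardE -(size_map (@word_of n)) -size_filter.
apply/perm_size/uniq_perm.
- by rewrite (map_inj_uniq (@word_of_inj n)) enum_uniq.
- by rewrite filter_uniq // uniq_words.
move=> w; rewrite mem_filter mem_words; apply/mapP/idP => [[f]|/and4P[aw /eqP sw wn av]].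
  rewrite mem_enum inE => /andP[av /eqP af] ->.
  rewrite asc_word_of af eqxx size_word_of eqxx avoiding_word_of av !andbT /=.
  by apply/allP => x /mapP[i _ ->] /=.
case: n sw wn => [|n] sw wn.
  exists [ffun i => i]; last by move/eqP: sw; rewrite size_eq0 => /eqP ->; rewrite /word_of enum_ord0.
  rewrite mem_enum inE -avoiding_word_of -asc_word_of /word_of enum_ord0 /=.
  by move/eqP: sw aw; rewrite size_eq0 => /eqP ->.
have wE : w = word_of [ffun i : 'I_n.+1 => inord (nth 0 w i)].
  apply: (@eq_from_nth _ 0); first by rewrite sw size_word_of.
  move=> i; rewrite sw => ilt; rewrite (nth_word_of _ (Ordinal ilt)) ffunE inordK //.
  by apply: (allP wn); rewrite mem_nth // sw.
exists [ffun i : 'I_n.+1 => inord (nth 0 w i)] => //.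
by rewrite mem_enum inE -avoiding_word_of -asc_word_of -wE av.
Qed.

Local Open Scope ring_scope.

Lemma card_avoids123_closed n k : (0 < n)%N ->
  #|[set f : {ffun 'I_n -> 'I_n} | avoids123 f && (#|ascents f| == k)]|%:Z
  = if k is k'.+1 then minrun_sum n n 1 k' else 1.
Proof.
move=> n0; rewrite card_avoids123.
(* As [n] is positive, every word has run at least 1, so the threshold 1 excludes nothing. *)
have -> : count (fun w => asc w == k) (words n n) = num_words_minrun n n 1 k.
  by apply: eq_in_count => w /words_size sw; rewrite run_gt0 sw n0.
case: k => [|k]; last exact: num_words_minrun_closed.
by rewrite num_words_minrun0 n0 binn.
Qed.

(** * Noncrossing families of periodic intervals *)

Local Open Scope nat_scope.

(* The arc [(a, l)] stands for the intervals [a + i N, a + l + 1 + i N] of the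
   integers, where N = n + 1 and i is arbitrary. *)
Definition parc (n : nat) := ('I_n.+1 * 'I_n.+1)%type.

Section Arcs.

Variable n : nat.
Local Notation N := n.+1.
Implicit Types (B : {set parc n}) (p : parc n).

Definition has_arc B (x y : nat) : bool :=
  [exists p in B, (x %% N == p.1) && (y == x + p.2.+1)].

Definition arcs_of (P : nat -> nat -> bool) : {set parc n} :=
  [set p : parc n | P p.1 (p.1 + p.2.+1)].

Lemma has_arc_shift B x y : has_arc B (x + N) (y + N) = has_arc B x y.
Proof. by apply: eq_existsb => p; rewrite modnDr addnAC eqn_add2r. Qed.

Lemma has_arc_len B x y : has_arc B x y -> x < y <= x + N.
Proof. case/exists_inP => p _ /andP[_ /eqP ->]; case: p => a [l ln] /=; lia. Qed.

Lemma has_arc_ord B p : has_arc B p.1 (p.1 + p.2.+1) = (p \in B).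
Proof.
apply/exists_inP/idP => [[q qB]|pB]; last by exists p => //; rewrite modn_small ?eqxx.
rewrite modn_small // eqn_add2l eqSS => /andP[/eqP e1 /eqP e2].
suff -> : p = q by []. 
by case: p q e1 e2 {qB} => a l [a' l'] /= e1 e2; congr pair; apply: val_inj.
Qed.

Lemma arc_exists x y : x < N -> x < y <= x + N ->
  exists p : parc n, p.1 = x :> nat /\ p.1 + p.2.+1 = y.
Proof.
move=> xN /andP[xy yN]; have ly : y - x.+1 < N by lia.
exists (Ordinal xN, Ordinal ly) => /=; split=> //; lia.
Qed.

Lemma has_arcs_of (P : nat -> nat -> bool) x y : x < N ->
  has_arc (arcs_of P) x y = (x < y <= x + N) && P x y.
Proof.
move=> xN; apply/idP/andP => [h|[xy Pxy]].
  split; first exact: has_arc_len h.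
  case/exists_inP: h => p; rewrite inE modn_small // => + /andP[/eqP -> /eqP ->].
  by [].
have [p [ex ey]] := arc_exists xN xy.
by rewrite -{1}ex -ey has_arc_ord inE ey ex.
Qed.

Lemma arcs_ext B B' :
  (forall x y, x < N -> x < y <= x + N -> has_arc B x y = has_arc B' x y) -> B = B'.
Proof.
move=> H; apply/setP => p; rewrite -!has_arc_ord H //.
by case: p => a [l ln] /=; lia.
Qed.

(** The second alternative shifts [q] by one period. Larger shifts cannot cross, since [p] ends
    before 2N; negative shifts are covered by exchanging the two arcs. *)
Definition arcs_cross (p q : 'I_N * 'I_N) : bool :=
  ((p.1 < q.1) && (q.1 < p.1 + p.2.+1 < q.1 + q.2.+1))
  || ((q.1 + N < p.1 + p.2.+1 < q.1 + N + q.2.+1)).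

Definition noncrossing B : bool :=
  [forall p in B, forall q in B, ~~ arcs_cross p q].

Lemma noncrossingP B : reflect
  (forall x x' y y', x < N -> x < x' -> x' < y -> y < y' ->
     has_arc B x y -> has_arc B x' y' -> False) (noncrossing B).
Proof.
apply: (iffP forall_inP) => [H x x' y y' xN xx' x'y yy' h h'|H p pB].
  case/exists_inP: (h) => -[a l] pB; rewrite modn_small //= => /andP[/eqP ex /eqP ey].
  have x'2N : x' < N + N by have := has_arc_len h; lia.
  have /forall_inP Hp := H _ pB.
  have [x'N|Nx'] := ltnP x' N.
    case/exists_inP: h' => -[a' l'] qB; rewrite modn_small //= => /andP[/eqP ex' /eqP ey'].
    have := Hp _ qB; rewrite /arcs_cross /=; lia.
  move: h'; rewrite -(subnK Nx') -(subnK (_ : N <= y')); last by lia.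
  rewrite has_arc_shift => /exists_inP[[a' l'] qB]; rewrite modn_small /=; last by lia.
  case/andP => /eqP ex' /eqP ey'.
  have := Hp _ qB; rewrite /arcs_cross /=; lia.
apply/forall_inP => q qB; apply/negP => /orP[/and3P[h1 h2 h3]|/andP[h1 h2]].
  by apply: (H p.1 q.1 _ _ (ltn_ord p.1) h1 h2 h3); rewrite has_arc_ord.
have h0 : p.1 < q.1 + N by rewrite (leq_trans (ltn_ord _)) // leq_addl.
apply: (H p.1 (q.1 + N) _ _ (ltn_ord p.1) h0 h1 h2); rewrite ?has_arc_ord //.
by rewrite addnAC has_arc_shift has_arc_ord.
Qed.

(** The edges of the polygon belong to the family, so k antipodal classes of diagonals give N + k
    arcs. *)
Definition dissection B : bool := noncrossing B && [forall a : 'I_N, (a, ord0) \in B].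

Lemma dissection_edge B x : dissection B -> x < N -> has_arc B x x.+1.
Proof.
case/andP => _ /forallP H xN; have := H (Ordinal xN).
by rewrite -has_arc_ord /= addn1.
Qed.

End Arcs.

Lemma card_arcs_map (n n' : nat) (B : {set parc n}) (B' : {set parc n'})
    (f g : nat -> nat -> nat) :
  (forall x y, x < n.+1 -> has_arc B x y -> f x y < n'.+1 /\ has_arc B' (f x y) (g x y)) ->
  (forall x y x' y', x < n.+1 -> x' < n.+1 -> has_arc B x y -> has_arc B x' y' ->
     f x y = f x' y' -> g x y = g x' y' -> x = x' /\ y = y') ->
  (forall u w, u < n'.+1 -> has_arc B' u w ->
     exists x y, [/\ x < n.+1, has_arc B x y, f x y = u & g x y = w]) ->
  #|B| = #|B'|.
Proof.
move=> Hf Hinj Hsurj.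
pose F (p : parc n) : parc n' :=
  let x := p.1 : nat in let y := (p.1 + p.2.+1)%N in (inord (f x y), inord (g x y - (f x y).+1)).
have FE (p : parc n) : p \in B -> (F p).1 = f p.1 (p.1 + p.2.+1) :> nat /\
    (F p).1 + (F p).2.+1 = g p.1 (p.1 + p.2.+1).
  rewrite -has_arc_ord => h; have [fl /has_arc_len hl] := Hf _ _ (ltn_ord _) h.
  rewrite /F /= !inordK //; lia.
have <- : F @: B = B'.
  apply/setP => q; apply/imsetP/idP => [[p pB ->]|].
    have [e1 e2] := FE p pB; rewrite -has_arc_ord e2 e1.
    by apply: (Hf _ _ (ltn_ord p.1) _).2; rewrite has_arc_ord.
  rewrite -has_arc_ord => /(Hsurj _ _ (ltn_ord q.1)) [x [y [xN h fx gx]]].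
  have [p [ex ey]] := arc_exists xN (has_arc_len h).
  have pB : p \in B by rewrite -has_arc_ord ex -ex ey ex.
  exists p => //; have [e1 e2] := FE p pB.
  rewrite ey ex fx in e1; rewrite ey ex gx in e2.
  case: q (F p) fx gx e1 e2 => a l [a' l'] /= _ _ e1 e2.
  by congr pair; apply: val_inj => /=; lia.
rewrite card_in_imset // => p q pB qB e.
have [e1 e2] := FE p pB; have [e3 e4] := FE q qB; rewrite e in e1 e2.
have [] := Hinj p.1 (p.1 + p.2.+1) q.1 (q.1 + q.2.+1) (ltn_ord _) (ltn_ord _).
- by rewrite has_arc_ord.
- by rewrite has_arc_ord.
- by rewrite -e1 e3.
- by rewrite -e2 e4.
case: p q {pB qB e e1 e2 e3 e4} => a l [a' l'] /= e1 e2.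
by congr pair; apply: val_inj => /=; lia.
Qed.

Lemma card_arcs_add (n : nat) (B B' : {set parc n}) x0 y0 : x0 < n.+1 -> x0 < y0 <= x0 + n.+1 ->
  ~~ has_arc B x0 y0 ->
  (forall x y, x < n.+1 -> has_arc B' x y = ((x == x0) && (y == y0)) || has_arc B x y) ->
  #|B'| = #|B|.+1.
Proof.
move=> xN xy nh H; have [p [ex ey]] := arc_exists xN xy.
have -> : B' = p |: B.
  apply/setP => q; rewrite -has_arc_ord H // !inE has_arc_ord; congr (_ || _).
  rewrite -ex -ey; apply/andP/eqP => [[/eqP e1 /eqP e2]|-> //].
  case: p q {ex ey} e1 e2 => a l [a' l'] /= e1 e2.
  by congr pair; apply: val_inj => /=; lia.
by rewrite cardsU1 -has_arc_ord ey ex nh.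
Qed.

Local Open Scope nat_scope.

(** * Contraction of an edge and its fibres *)

Section Contraction.

Variable n : nat.
Local Notation N := n.+1.
Local Notation M := n.+2.
Implicit Types (B : {set parc n}) (C : {set parc n.+1}).

(* The monotone map that identifies i M with i M + 1, correct up to 3 M. *)
Definition squeeze (v : nat) : nat := v - (0 < v) - (M < v) - (M + M < v).
Local Notation c := squeeze.

Lemma squeeze_mono u v : u <= v -> c u <= c v.
Proof. rewrite /squeeze; lia. Qed.

Lemma squeeze_inj u v : u < v -> v < M + M + M -> c u = c v ->
  [\/ u = 0 /\ v = 1, u = M /\ v = M.+1 | u = M + M /\ v = (M + M).+1].
Proof.
move=> uv vM e; have h1 : v = u.+1 by move: uv vM e; rewrite /squeeze; lia.
have : u = 0 \/ u = M \/ u = M + M by move: e; rewrite /squeeze; lia.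
by rewrite h1; case=> [|[]] ->; [constructor 1|constructor 2|constructor 3].
Qed.

Lemma squeeze_shift v : v < M + M -> c (v + M) = c v + N.
Proof. rewrite /squeeze; lia. Qed.

Lemma squeezeM : c M = N.
Proof. rewrite /squeeze; lia. Qed.

Lemma squeezeMS : c M.+1 = N.
Proof. rewrite /squeeze; lia. Qed.

Lemma squeeze_lt v : v < M -> c v < N.
Proof. rewrite /squeeze; lia. Qed.

(* The arcs at the vertex 0 of the small polygon are ordered by a key: it is l for
   an arc [0, l] and 2N+1-l for an arc [-l, 0]. In the large polygon, the arcs of
   key less than q are attached to 1, and those of key greater than q to 0;
   the arc of key q is attached to 0, and also to 1 when [b] holds. *)
Definition lift_rule (q : nat) (b : bool) (x y : nat) : bool :=
  let l := c y - c x in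
  [&& (x == 0) ==> (q <= l),
      (x == 1) ==> ((l < q) || (b && (l == q))),
      (y == M) ==> (q + l <= (N + N).+1)
    & (y == M.+1) ==> (((N + N).+1 < q + l) || (b && (q + l == (N + N).+1)))].

Definition lift_arcs B q b : {set parc n.+1} :=
  arcs_of n.+1 (fun x y => ((x == 0) && (y == 1)) || (has_arc B (c x) (c y) && lift_rule q b x y)).

(** The keys of arcs at the vertex run from 1 to 2N in cyclic order. An arc of length N has both
    ends there and therefore the two keys N and N + 1. *)
Definition entry B q : bool :=
  if q <= N then has_arc B 0 q else has_arc B (q - N.+1) N.

(** Key 1 is that of the edge [0, 1], which has to be attached to 1 as well in order to give the
    edge [1, 2] of the large polygon. *)
Definition choices B : {set 'I_(N + N).+1 * bool} :=
  [set t : 'I_(N + N).+1 * bool | [&& 0 < t.1, entry B t.1 & (t.1 == 1 :> nat) ==> t.2]].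

Lemma has_lift B q b x y : x < M ->
  has_arc (lift_arcs B q b) x y = (x < y <= x + M) &&
    (((x == 0) && (y == 1)) || (has_arc B (c x) (c y) && lift_rule q b x y)).
Proof. exact: has_arcs_of. Qed.

(** A crossing of lifted arcs projects to a crossing in [B] unless [squeeze] merges two of the
    endpoints; then both arcs are at the contracted vertex and their keys contradict [lift_rule]. *)
Lemma noncrossing_lift B q b : noncrossing B -> noncrossing (lift_arcs B q b).
Proof.
move=> /noncrossingP nB; apply/noncrossingP => x x' y y' xM xx' x'y yy'.
rewrite has_lift // => /andP[/andP[_ yM]] /orP[/andP[_ /eqP y1]|/andP[h rxy]]; first by lia.
have lh := has_arc_len h.
have c1 : c x < c x' \/ x = 0 /\ x' = 1.
  have := squeeze_mono (ltnW xx'); rewrite leq_eqVlt => /orP[/eqP e|]; last by left.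
  by have := squeeze_inj xx' _ e; case; lia.
have c2 : c x' < c y \/ x' = M /\ y = M.+1.
  have := squeeze_mono (ltnW x'y); rewrite leq_eqVlt => /orP[/eqP e|]; last by left.
  by have := squeeze_inj x'y _ e; case; lia.
have c3 : y' < M + M + M -> c y < c y' \/ y = M /\ y' = M.+1.
  have := squeeze_mono (ltnW yy'); rewrite leq_eqVlt => /orP[/eqP e|]; last by left.
  by move=> y'M3; have := squeeze_inj yy' y'M3 e; case; lia.
have nBx u u' : c x < u -> u < c y -> c y < u' -> has_arc B u u' -> False.
  by move=> a1 a2 a3; apply: nB (squeeze_lt xM) a1 a2 a3 h.
move=> h'.
have {c3}c3 : c y < c y' \/ y = M /\ y' = M.+1 by apply: c3; have := has_arc_len h'; lia.
case/and4P: rxy => r1 r2 r3 r4.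
have lh0 := has_arc_len h'.
have [x'M|Mx'] := ltnP x' M.
  move: h'; rewrite has_lift // => /andP[/andP[_ y'M]] /orP[/andP[/eqP x'0 _]|/andP[h' rxy']].
    by rewrite x'0 in xx'.
  have lh' := has_arc_len h'; case/and4P: rxy' => r1' r2' r3' r4'.
  case: c1 => [c1|[x0 x'1]].
    case: c2 => [c2|[x'M' _]]; last by rewrite x'M' ltnn in x'M.
    case: c3 => [c3|[yM' y'M']]; first exact: nBx h'.
    have e : c y = c y' by rewrite yM' y'M' squeezeM squeezeMS.
    move: (implyP r3 (introT eqP yM')) (implyP r4' (introT eqP y'M')); clear -c1 lh' e; lia.
  have e : c x = c x' by rewrite x0 x'1.
  case: c3 => [c3|[yM' y'M']].
    move: (implyP r1 (introT eqP x0)) (implyP r2' (introT eqP x'1)); clear -c3 lh e; lia.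
  have e' : c y = c y' by rewrite yM' y'M' squeezeM squeezeMS.
  move: (implyP r1 (introT eqP x0)) (implyP r2' (introT eqP x'1)).
  move: (implyP r3 (introT eqP yM')) (implyP r4' (introT eqP y'M')); clear -e e' lh; lia.
move: h'; rewrite -(subnK Mx') -(subnK (_ : M <= y')) ?has_arc_shift; last by lia.
have [xM' yM'] : x' - M < M /\ y' - M < M + M by clear -lh0 xx' x'y yM xM Mx'; lia.
have ex' : c x' = c (x' - M) + N by rewrite -squeeze_shift ?subnK //; clear -xM' yM' Mx' lh0; lia.
have ey' : c y' = c (y' - M) + N by rewrite -squeeze_shift ?subnK //; clear -xM' yM' Mx' lh0; lia.
rewrite has_lift // => /andP[_] /orP[/andP[/eqP ex /eqP ey]|/andP[h' /and4P[r1' _ _ _]]].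
  by move: ex ey x'y yy' Mx'; clear; lia.
have lh' := has_arc_len h'.
case: c2 => [c2|[x'M' yM1]].
  case: c1 => [c1|[_ x'1]]; last by rewrite x'1 in Mx'.
  case: c3 => [c3|[yM1 _]]; last by move: Mx' x'y; rewrite yM1; clear; lia.
  by move: h'; rewrite -has_arc_shift -ex' -ey'; exact: nBx.
have e : c x' = c y by rewrite yM1 x'M' squeezeM squeezeMS.
have x'0 : x' - M = 0 by rewrite x'M' subnn.
move: (implyP r1' (introT eqP x'0)) (implyP r4 (introT eqP yM1)); clear -lh lh'; lia.
Qed.

Lemma dissection_lift B q b : dissection B -> 0 < q <= N + N -> ((q == 1) ==> b) ->
  dissection (lift_arcs B q b).
Proof.
move=> dB q0 qb; have /andP[nB _] := dB; rewrite /dissection noncrossing_lift //=.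
apply/forallP => -[a aM]; rewrite -has_arc_ord /= addn1 has_lift //.
have [-> //|a0] := posnP a.
have ca : c a.+1 = (c a).+1 by rewrite /squeeze; lia.
rewrite ca dissection_edge ?squeeze_lt // /lift_rule ca; lia.
Qed.

Lemma lift_arc_exists B q u w : u < N -> has_arc B u w -> exists x y,
  [/\ x < M, x < y <= x + M, c x = u, c y = w & lift_rule q false x y].
Proof.
move=> uN /has_arc_len uw.
exists (if u == 0 then (if w - u < q then 1 else 0) else u.+1).
exists (if w == N then (if (N + N).+1 < q + (w - u) then M.+1 else M)
        else if w < N then w.+1 else w.+2).
set x := (X in X < M); set y := (X in _ < X <= _).
have cx : c x = u.
  by rewrite /x /squeeze; case: eqP => [->|]; [case: ifP | clear -uN; lia].
have cy : c y = w.
  rewrite /y; case: eqP => [->|wN]; first by case: ifP; rewrite ?squeezeM ?squeezeMS.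
  by case: ltnP => wN'; rewrite /squeeze; clear -uN uw wN wN'; lia.
have xM : x < M by rewrite /x; clear -uN; case: eqP => [_|]; [case: ifP | lia].
split=> //.
  rewrite /x /y; move: uN uw; clear.
  case: (eqVneq w N) => [->|wN]; case: (eqVneq u 0) => [->|u0];
  by repeat case: ifP => ?; lia.
rewrite /lift_rule cx cy /x /y; clear -uN uw; apply/and4P; split; apply/implyP.
all: by repeat case: ifP => ?; lia.
Qed.

(** The lift without the contracted edge and without the doubled arc; it is in bijection with
    [B]. *)
Definition lift_arcs0 B q : {set parc n.+1} :=
  arcs_of n.+1 (fun x y => has_arc B (c x) (c y) && lift_rule q false x y).

Lemma squeeze_inj_arc x y x' y' : x < M -> x' < M -> 0 < y < M + M -> 0 < y' < M + M ->
  c x = c x' -> c y = c y' ->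
  [/\ x = x' \/ (x = 0 /\ x' = 1) \/ (x = 1 /\ x' = 0)
    & y = y' \/ (y = M /\ y' = M.+1) \/ (y = M.+1 /\ y' = M)].
Proof.
move=> xM x'M yM y'M ex ey; split.
  case: (ltngtP x x') => [h|h|->]; last by left.
    by have := squeeze_inj h _ ex; case; clear -xM x'M h; lia.
  by have := squeeze_inj h _ (esym ex); case; clear -xM x'M h; lia.
case: (ltngtP y y') => [h|h|->]; last by left.
  by have := squeeze_inj h _ ey; case; clear -yM y'M h; lia.
by have := squeeze_inj h _ (esym ey); case; clear -yM y'M h; lia.
Qed.

Lemma card_lift0 B q : #|lift_arcs0 B q| = #|B|.
Proof.
apply: (card_arcs_map (f := fun x _ => c x) (g := fun _ y => c y)).
- move=> x y xM; rewrite has_arcs_of // => /and3P[_ h _]; split=> //; exact: squeeze_lt.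
- move=> x y x' y' xM x'M.
  rewrite !has_arcs_of // => /and3P[xy h r] /and3P[xy' h' r'] ex ey.
  case/and4P: r => r1 r2 r3 r4; case/and4P: r' => r1' r2' r3' r4'.
  have [||ex' ey'] := squeeze_inj_arc xM x'M _ _ ex ey; try by clear -xM xy xy' x'M; lia.
  rewrite -ex -ey in r1' r2' r3' r4'; split.
    case: ex' => // -[[e e']|[e e']].
      by move: (implyP r1 (introT eqP e)) (implyP r2' (introT eqP e')); clear; lia.
    by move: (implyP r2 (introT eqP e)) (implyP r1' (introT eqP e')); clear; lia.
  case: ey' => // -[[e e']|[e e']].
    by move: (implyP r3 (introT eqP e)) (implyP r4' (introT eqP e')); clear; lia.
  by move: (implyP r4 (introT eqP e)) (implyP r3' (introT eqP e')); clear; lia.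
move=> u w uN h; have [x [y [xM xy ex ey r]]] := lift_arc_exists q uN h.
by exists x, y; split=> //; rewrite has_arcs_of // xy ex ey h.
Qed.

Lemma card_lift_false B q : #|lift_arcs B q false| = #|B|.+1.
Proof.
rewrite -(card_lift0 B q); apply: (@card_arcs_add _ _ _ 0 1) => //.
  by rewrite has_arcs_of //; apply/negP => /and3P[_ /has_arc_len]; rewrite ltnn.
move=> x y xM; rewrite has_lift // has_arcs_of // andb_orr; congr (_ || _).
by apply: andb_idl => /andP[/eqP -> /eqP ->].
Qed.

Lemma card_lift_true B q : 0 < q <= N + N -> entry B q -> #|lift_arcs B q true| = #|B|.+2.
Proof.
move=> qN eq; rewrite -(card_lift_false B q).
(* The arc from [x0] to [y0] is the second copy of the arc of key [q], the one attached to 1. *)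
pose x0 := if q <= N then 1 else q - N.
pose y0 := if q <= N then q.+1 else M.+1.
have cx0 : c x0 = if q <= N then 0 else q - N.+1.
  by rewrite /x0; case: (leqP q N) => h //; rewrite /squeeze; clear -h qN; lia.
have cy0 : c y0 = if q <= N then q else N.
  by rewrite /y0; case: (leqP q N) => h; rewrite ?squeezeMS // /squeeze; clear -h qN; lia.
have hB : has_arc B (c x0) (c y0).
  by move: eq; rewrite /entry cx0 cy0; case: (q <= N).
have xM : x0 < M by rewrite /x0; case: (leqP q N) => h //; clear -h qN; lia.
have xy0 : x0 < y0 <= x0 + M by rewrite /x0 /y0; case: (leqP q N) => h; clear -h qN; lia.
have l0 : c y0 - c x0 = if q <= N then q else (N + N).+1 - q.
  by rewrite cx0 cy0; case: (leqP q N) => h; clear -h qN; lia.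
have x00 : x0 != 0 by rewrite /x0; case: (leqP q N) => h //; clear -h qN; lia.
have rt : lift_rule q true x0 y0.
  rewrite /lift_rule l0 /x0 /y0; case: (leqP q N) => h; clear -h qN; lia.
apply: (@card_arcs_add _ _ _ x0 y0) => //.
  rewrite has_lift // (negPf x00) /= hB /= negb_and; apply/orP; right.
  rewrite /lift_rule l0 /x0 /y0; case: (leqP q N) => h; clear -h qN; lia.
move=> x y xM'; rewrite !has_lift //.
case: (boolP ((x == x0) && (y == y0))) => [/andP[/eqP -> /eqP ->]|ne].
  by rewrite xy0 hB rt orbT.
case: (boolP (x < y <= x + M)) => //= xy; congr (_ || _).
case: (boolP (has_arc B _ _)) => //= h.
apply/idP/idP; last first.
  by case/and4P=> r1 r2 r3 r4; apply/and4P; split=> //; [move: r2 | move: r4]; rewrite /= orbF; case: (_ == _) => //= ->.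
case/and4P=> r1 r2 r3 r4; have lh := has_arc_len h.
apply/and4P; split=> //; apply/implyP => /eqP e; rewrite orbF.
  case/orP: (implyP r2 (introT eqP e)) => // /= /eqP lq; case/negP: ne.
  have x1 : c x = 0 by rewrite e.
  have yq : c y = q by move: lq; rewrite x1 subn0.
  have qN' : q <= N by move: lh; rewrite x1 yq; clear; lia.
  have y1 : y = q.+1.
    move: (implyP r4); rewrite lq; move: yq; rewrite /squeeze; move: xy qN'; rewrite e.
    clear -qN; lia.
  by rewrite e y1 /x0 /y0 qN' !eqxx.
case/orP: (implyP r4 (introT eqP e)) => // /= /eqP lq; case/negP: ne.
have y1 : c y = N by rewrite e squeezeMS.
have qN' : ~~ (q <= N) by move: lh lq; rewrite y1; clear; lia.
rewrite /x0 /y0 (negPf qN') e eqxx andbT; apply/eqP.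
move: lq xy lh; rewrite y1 e /squeeze; clear -qN qN' xM'; lia.
Qed.

Lemma card_lift B q b : 0 < q <= N + N -> entry B q -> #|lift_arcs B q b| = #|B| + 1 + b.
Proof.
move=> qN eq; case: b; last by rewrite card_lift_false !addn1 addn0.
by rewrite card_lift_true // !addn1.
Qed.

(* The second alternative is an arc that ends at a translate of the vertex [i]; for
   the key [q] of an arc see [lift_rule]. *)
Definition attached (i : nat) (C : {set parc n.+1}) (q : nat) : Prop :=
  exists x y, [/\ x < M, has_arc C x y, c x < c y &
    (x = i /\ c y - c x = q) \/ (y = M + i /\ q + (c y - c x) = (N + N).+1)].

Lemma attached0_lift B q b : 0 < q <= N + N -> entry B q -> ((q == 1) ==> b) ->
  attached 0 (lift_arcs B q b) q.
Proof.
move=> qN eq q1; rewrite /entry in eq; case: (leqP q N) eq => h eq.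
  have cq : c q.+1 = q by rewrite /squeeze; clear -h qN; lia.
  exists 0, q.+1; split=> //; last by left; rewrite cq subn0.
    rewrite has_lift // cq eq /lift_rule cq (_ : c 0 = 0) //; clear -h qN; lia.
  by rewrite cq (_ : c 0 = 0) //; case/andP: qN.
have cq : c (q - N) = q - N.+1 by rewrite /squeeze; clear -h qN; lia.
have xM : q - N < M by clear -qN; lia.
exists (q - N), M; split=> //; last by right; rewrite addn0 cq squeezeM; split=> //; clear -h qN; lia.
  rewrite has_lift // cq squeezeM eq /lift_rule cq squeezeM; clear -h qN; lia.
by rewrite cq squeezeM; clear -qN; lia.
Qed.

Lemma attached0_lift_ge B q b k : attached 0 (lift_arcs B q b) k -> q <= k.
Proof.
case=> x [y [xM h cxy e]].
move: h; rewrite has_lift // => /andP[xy /orP[/andP[/eqP x0 /eqP y1]|/andP[h]]].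
  by move: cxy; rewrite x0 y1.
case/and4P=> r1 r2 r3 r4; case: e => -[e1 e2]; first by rewrite -e2; move: (implyP r1 (introT eqP e1)).
by rewrite addn0 in e1; move: (implyP r3 (introT eqP e1)) e2; clear; lia.
Qed.

Lemma attached1_lift B q b : 0 < q <= N + N -> entry B q ->
  attached 1 (lift_arcs B q b) q <-> b.
Proof.
move=> qN eq; split.
  case=> x [y [xM h cxy e]].
  move: h; rewrite has_lift // => /andP[xy /orP[/andP[/eqP x0 /eqP y1]|/andP[h]]].
    by move: cxy; rewrite x0 y1.
  case/and4P=> r1 r2 r3 r4; case: e => -[e1 e2].
    by move: (implyP r2 (introT eqP e1)); rewrite e2 ltnn eqxx andbT.
  rewrite addn1 in e1.
  by move: (implyP r4 (introT eqP e1)); rewrite e2 ltnn eqxx andbT.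
move=> ->; rewrite /entry in eq; case: (leqP q N) eq => h eq.
  have cq : c q.+1 = q by rewrite /squeeze; clear -h qN; lia.
  exists 1, q.+1; split=> //; last by left; rewrite cq subn0.
    rewrite has_lift // cq eq /lift_rule cq (_ : c 1 = 0) //; clear -h qN; lia.
  by rewrite cq (_ : c 1 = 0) //; case/andP: qN.
have cq : c (q - N) = q - N.+1 by rewrite /squeeze; clear -h qN; lia.
have xM : q - N < M by clear -qN; lia.
exists (q - N), M.+1; split=> //; last by right; rewrite addn1 cq squeezeMS; split=> //; clear -h qN; lia.
  rewrite has_lift // cq squeezeMS eq /lift_rule cq squeezeMS; clear -h qN; lia.
by rewrite cq squeezeMS; clear -qN; lia.
Qed.

Lemma has_arc_from_lift B q b u w : u < N ->
  has_arc B u w <-> exists x y, [/\ x < M, has_arc (lift_arcs B q b) x y, c x = u, c y = w & u < w].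
Proof.
move=> uN; split=> [h|[x [y [xM]]]].
  have [x [y [xM xy ex ey r]]] := lift_arc_exists q uN h.
  exists x, y; split=> //; last by case/andP: (has_arc_len h).
  rewrite has_lift // xy ex ey h /=; apply/orP; right.
  case/and4P: r => r1 r2 r3 r4; apply/and4P; split=> //; apply/implyP => e.
    by move: (implyP r2 e); rewrite orbF => ->.
  by move: (implyP r4 e); rewrite orbF => ->.
rewrite has_lift // => /andP[xy /orP[/andP[/eqP -> /eqP ->] <- <-|/andP[h _] <- <-]] //.
Qed.

(** All data can be read off from the lift: [q] is the least key at 0, [b] tells whether this key
    also occurs at 1, and [B] is the contraction. *)
Lemma lift_inj B q b B' q' b' :
  0 < q <= N + N -> entry B q -> ((q == 1) ==> b) ->
  0 < q' <= N + N -> entry B' q' -> ((q' == 1) ==> b') ->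
  lift_arcs B q b = lift_arcs B' q' b' -> [/\ B = B', q = q' & b = b'].
Proof.
move=> qN eq qb qN' eq' qb' e.
have eqq : q = q'.
  apply/eqP; rewrite eqn_leq.
  rewrite (@attached0_lift_ge B q b) ?(@attached0_lift_ge B' q' b') //.
    by rewrite -e; exact: attached0_lift.
  by rewrite e; exact: attached0_lift.
split=> //.
  apply: arcs_ext => u w uN _; apply/idP/idP => h.
    by apply/(has_arc_from_lift B' q' b' _ uN); rewrite -e; apply/(has_arc_from_lift B q b _ uN).
  by apply/(has_arc_from_lift B q b _ uN); rewrite e; apply/(has_arc_from_lift B' q' b' _ uN).
subst q'; apply/idP/idP => h.
  by apply/(attached1_lift b' qN eq'); rewrite -e; apply/(attached1_lift b qN eq).
by apply/(attached1_lift b qN eq); rewrite e; apply/(attached1_lift b' qN eq').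
Qed.

Definition contract (C : {set parc n.+1}) : {set parc n} :=
  arcs_of n (fun u w => [exists x : 'I_M, exists y : 'I_(M + M),
    [&& has_arc C x y, c x == u & c y == w]]).

Lemma has_contract C u w : u < N ->
  has_arc (contract C) u w <-> exists x y, [/\ x < M, has_arc C x y, c x = u, c y = w & u < w].
Proof.
move=> uN; rewrite has_arcs_of //; split.
  case/andP => uw /existsP[x /existsP[y /and3P[h /eqP ex /eqP ey]]].
  by exists x, y; split=> //; case/andP: uw.
case=> x [y [xM h ex ey uw]]; have xy := has_arc_len h.
have yM : y < M + M by clear -xM xy; lia.
apply/andP; split; last first.
  by apply/existsP; exists (Ordinal xM); apply/existsP; exists (Ordinal yM); rewrite /= h ex ey !eqxx.
rewrite uw -ex -ey -squeeze_shift; last by clear -xM; lia.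
by rewrite squeeze_mono //; case/andP: xy.
Qed.

Lemma squeeze_ltW u v : c u < c v -> u < v.
Proof. by rewrite ltnNge => h; rewrite ltnNge; apply: contra h => /squeeze_mono. Qed.

Lemma dissection_contract C : dissection C -> dissection (contract C).
Proof.
move=> dC; have /andP[/noncrossingP nC _] := dC; apply/andP; split.
  apply/noncrossingP => u u' w w' uN uu' u'w ww' /(has_contract _ _ uN)[x [y [xM h ex ey _]]] h'.
  have lh := has_arc_len h.
  suff [x' [y' [h2 ex' ey']]] : exists x' y', [/\ has_arc C x' y', c x' = u' & c y' = w'].
    apply: (nC x x' y y') => //; apply: squeeze_ltW.
    - by rewrite ex ex'.
    - by rewrite ex' ey.
    - by rewrite ey ey'.
  have [u'N|Nu'] := ltnP u' N.
    by case/(has_contract _ _ u'N): h' => x' [y' [x'M h2 ex' ey' _]]; exists x', y'.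
  have u'2 : u' - N < N.
    have : c y <= c (x + M) by apply: squeeze_mono; case/andP: lh.
    rewrite squeeze_shift; last by clear -xM; lia.
    by move: u'w; rewrite -ex -ey in uN *; clear -Nu' uN; lia.
  have lh' := has_arc_len h'.
  move: h'; rewrite -(subnK Nu') -(subnK (_ : N <= w')) ?has_arc_shift; last by clear -lh' Nu'; lia.
  case/(has_contract _ _ u'2) => x' [y' [x'M h2 ex' ey' _]].
  exists (x' + M), (y' + M); split; first by rewrite has_arc_shift.
    by rewrite squeeze_shift ?ex' //; clear -x'M; lia.
  by rewrite squeeze_shift ?ey' //; have := has_arc_len h2; clear -x'M; lia.
apply/forallP => a; rewrite -has_arc_ord /= addn1; apply/(has_contract _ _ (ltn_ord a)).
have aM : a.+1 < M by rewrite ltnS.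
exists a.+1, a.+2; split=> //; first exact: dissection_edge.
  by rewrite /squeeze; have := ltn_ord a; clear; lia.
by rewrite /squeeze; have := ltn_ord a; clear; lia.
Qed.

(** An arc at 1 with a larger key than some arc at 0 would cross it. Hence a single cut value
    describes how the arcs are distributed over the two ends of the contracted edge. *)
Lemma attached_leq C k k' : noncrossing C -> attached 1 C k -> attached 0 C k' -> k <= k'.
Proof.
move=> /noncrossingP nC [x [y [xM h cxy e]]] [x' [y' [x'M h' cxy' e']]].
have lh := has_arc_len h; have lh' := has_arc_len h'.
have cl : c y <= c x + N.
  by rewrite -squeeze_shift; [apply: squeeze_mono; case/andP: lh | clear -xM; lia].
have cl' : c y' <= c x' + N.
  by rewrite -squeeze_shift; [apply: squeeze_mono; case/andP: lh' | clear -x'M; lia].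
have [c0 c1] : c 0 = 0 /\ c 1 = 0 by [].
rewrite leqNgt; apply/negP => kk.
case: e => -[e1 e2]; case: e' => -[e1' e2'].
- subst x x'; rewrite c0 in cxy' e2'; rewrite c1 in cxy e2.
  apply: (nC 0 1 y' y) => //; apply: squeeze_ltW; first by rewrite c1.
  by clear -e2 e2' kk; lia.
- by clear -cl cl' e2 e2' kk; lia.
- subst x'; rewrite addn1 in e1; subst y.
  apply: (nC x M M.+1 (y' + M)) => //; last by rewrite -{1}[M]add0n has_arc_shift.
  have : 1 < y' by apply: squeeze_ltW; rewrite c1 -c0.
  by clear; lia.
- rewrite addn0 in e1'; rewrite addn1 in e1; subst y y'.
  apply: (nC x' x M M.+1) => //; apply: squeeze_ltW.
  by rewrite squeezeM squeezeMS in e2 e2' cxy cxy'; clear -e2 e2' kk cxy cxy'; lia.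
Qed.

Definition attachedb (i : nat) C q : bool :=
  [exists x : 'I_M, exists y : 'I_(M + M), [&& has_arc C x y, c x < c y &
    ((x == i :> nat) && (c y - c x == q))
    || ((y == M + i :> nat) && (q + (c y - c x) == (N + N).+1))]].

Lemma attachedP i C q : reflect (attached i C q) (attachedb i C q).
Proof.
apply: (iffP idP) => [/existsP[x /existsP[y /and3P[h cxy e]]]|[x [y [xM h cxy e]]]].
  exists x, y; split=> //.
  by case/orP: e => /andP[/eqP e1 /eqP e2]; [left | right].
have yM : y < M + M by have := has_arc_len h; clear -xM; lia.
apply/existsP; exists (Ordinal xM); apply/existsP; exists (Ordinal yM).
by rewrite /= h cxy /=; case: e => -[-> ->]; rewrite !eqxx ?orbT.
Qed.

Lemma arc_squeeze_len C x y : x < M -> has_arc C x y -> c y <= c x + N.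
Proof.
move=> xM /has_arc_len xy.
by rewrite -squeeze_shift; [apply: squeeze_mono; case/andP: xy | clear -xM; lia].
Qed.

Lemma lift_surj C : dissection C -> exists B q b,
  [/\ dissection B, 0 < q <= N + N, entry B q, ((q == 1) ==> b) & C = lift_arcs B q b].
Proof.
move=> dC; have nC : noncrossing C by case/andP: dC.
pose B := contract C.
have dB : dissection B by exact: dissection_contract.
have BE u w := has_contract C w (u := u).
(* The edge [N, M] ends at a translate of 0 and has key 2N; [q] will be the least key at 0. *)
have exq : exists k, (0 < k) && attachedb 0 C k.
  exists (N + N); rewrite /=; apply/attachedP; exists N, M; split=> //.
  - exact: dissection_edge.
  - by rewrite squeezeM /squeeze; clear; lia.
  - right; rewrite addn0; split=> //; rewrite squeezeM /squeeze; clear; lia.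
case: (ex_minnP exq) => q /andP[q0 /attachedP A0] qmin.
have min0 k : 0 < k -> attached 0 C k -> q <= k.
  by move=> k0 /attachedP ak; apply: qmin; rewrite k0.
have max1 k : attached 1 C k -> k <= q by move=> a1; apply: (attached_leq nC a1 A0).
pose b := attachedb 1 C q.
have q2 : q <= N + N by apply: qmin; case: exq => k0 _; apply/andP; split=> //;
  apply/attachedP; exists N, M; split=> //;
  [exact: dissection_edge | by rewrite squeezeM /squeeze; clear; lia
  | right; rewrite addn0; split=> //; rewrite squeezeM /squeeze; clear; lia].
have qN : 0 < q <= N + N by rewrite q0.
have [c0 c1] : c 0 = 0 /\ c 1 = 0 by [].
exists B, q, b; split=> //.
- case: A0 => x [y [xM h cxy e]]; rewrite /entry.
  have lh := arc_squeeze_len xM h.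
  have hB : has_arc B (c x) (c y) by apply/BE; [exact: squeeze_lt | exists x, y].
  case: e => -[e1 e2].
    rewrite e1 c0 subn0 in e2; rewrite e1 c0 e2 in hB lh.
    by rewrite lh hB.
  rewrite addn0 in e1; rewrite e1 squeezeM in hB e2 lh cxy.
  have -> : q <= N = false by clear -e2 lh cxy; lia.
  by have -> : q - N.+1 = c x by clear -e2 lh cxy; lia.
- apply/implyP => /eqP q1; apply/attachedP; exists 1, 2; split=> //.
    exact: dissection_edge.
  by left; split=> //; rewrite q1.
apply: arcs_ext => x y xM xy; rewrite has_lift // xy /=.
have cxy : c x <= c y by apply: squeeze_mono; case/andP: xy => /ltnW.
apply/idP/idP => [h|].
  move: cxy; rewrite leq_eqVlt => /orP[/eqP e|cxy].
    have := squeeze_inj (proj1 (andP xy)) _ e.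
    by case; try (clear -xM xy; lia); case=> -> ->.
  have lh := arc_squeeze_len xM h.
  apply/orP; right; apply/andP; split; first by apply/BE; [exact: squeeze_lt | exists x, y].
  apply/and4P; split; apply/implyP => /eqP e.
  - apply: min0; first by rewrite subn_gt0.
    by exists x, y; split=> //; left.
  - have a1 : attached 1 C (c y - c x) by exists x, y; split=> //; left.
    have := max1 _ a1; rewrite leq_eqVlt => /orP[/eqP e1|->//].
    apply/orP; right; apply/andP; split; last exact/eqP.
    by apply/attachedP; rewrite -e1.
  - suff : q <= (N + N).+1 - (c y - c x) by clear -lh; lia.
    apply: min0; first by clear -lh; lia.
    by exists x, y; split=> //; right; split; [rewrite addn0 | clear -lh; lia].
  - have a1 : attached 1 C ((N + N).+1 - (c y - c x)).
      by exists x, y; split=> //; right; split; [rewrite addn1 | clear -lh; lia].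
    have := max1 _ a1; rewrite leq_eqVlt => /orP[/eqP e1|lq].
      apply/orP; right; apply/andP; split; last by apply/eqP; clear -e1 lh; lia.
      by apply/attachedP; rewrite -e1.
    by apply/orP; left; clear -lq lh; lia.
(* For the converse, the arc of [C] that projects to the same arc of [B] may be attached to the
   other end of the contracted edge. Its key is then forced to be [q], or contradicts the choice of
   [q]; for key [q] the copy at the required end exists by the choice of [q] and [b]. *)
case/orP => [/andP[/eqP -> /eqP ->]|/andP[/BE]]; first exact: dissection_edge.
case=> [|x' [y' [x'M h ex ey {}cxy]] /and4P[r1 r2 r3 r4]]; first exact: squeeze_lt.
have xy' := has_arc_len h.
have lh := arc_squeeze_len x'M h; rewrite ex ey in lh.
have [||ex' ey'] := squeeze_inj_arc xM x'M _ _ (esym ex) (esym ey);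
  try by clear -xM x'M xy xy'; lia.
have cxy' : c x' < c y' by rewrite ex ey.
case: ex' => [e|[[x0 x'1]|[x1 x'0]]].
- subst x'; case: ey' => [->//|[[yM y'M]|[yM y'M]]].
  + have a1 : attached 1 C ((N + N).+1 - (c y - c x)).
      by exists x, y'; split=> //; right; rewrite ey; split; [rewrite addn1 | clear -lh; lia].
    have qE : q + (c y - c x) = (N + N).+1.
      by move: (max1 _ a1) (implyP r3 (introT eqP yM)); clear -lh; lia.
    case: A0 => x2 [y2 [x2M h2 cxy2 [[e1 e2]|[e1 e2]]]].
      by have := arc_squeeze_len x2M h2; clear -qE lh e2; lia.
    rewrite addn0 in e1; subst y2; subst y.
    have cx2 : c x2 = c x.
      by move: e2 qE cxy2 cxy; clear; lia.
    (* Left endpoints that differ belong to arcs over one of length N; its second key conflicts with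
       the minimality of [q] or with [lift_rule]. *)
    have [||[e|[[x20 x1]|[x21 x0]]] _] := squeeze_inj_arc x2M xM _ _ cx2 (erefl (c M)); try by clear; lia.
    * by rewrite -e.
    * have a0 : attached 0 C N.
        by exists x2, M; split=> //; left; rewrite x20 c0 squeezeM subn0.
      by move: (min0 N isT a0) qE; rewrite x1 c1 squeezeM; clear; lia.
    * by move: (implyP r1 (introT eqP x0)) qE; rewrite x0 c0 squeezeM; clear; lia.
  + have a0 : attached 0 C ((N + N).+1 - (c y - c x)).
      by exists x, y'; split=> //; right; rewrite ey; split; [rewrite addn0 | clear -lh; lia].
    have qle : q <= (N + N).+1 - (c y - c x) by apply: min0 => //; clear -lh; lia.
    case/orP: (implyP r4 (introT eqP yM)) => [lt|/andP[bt /eqP qE]].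
      by move: lt qle lh; clear; lia.
    case/attachedP: bt => x2 [y2 [x2M h2 cxy2 [[e1 e2]|[e1 e2]]]].
      by have := arc_squeeze_len x2M h2; clear -qE lh e2; lia.
    rewrite addn1 in e1; subst y2; subst y.
    have cx2 : c x2 = c x by move: e2 qE cxy2 cxy; clear; lia.
    have := has_arc_len h2.
    have [||[e|[[x20 x1]|[x21 x0]]] _] := squeeze_inj_arc x2M xM _ _ cx2 (erefl (c M.+1)); try by clear; lia.
    * by rewrite -e.
    * by rewrite x20; clear; lia.
    * by move: xy; rewrite x0; clear; lia.
- have a1 : attached 1 C (c y - c x).
    by exists x', y'; split=> //; left; rewrite ex ey.
  have qE : q = c y - c x.
    by move: (max1 _ a1) (implyP r1 (introT eqP x0)); clear; lia.
  case: A0 => x2 [y2 [x2M h2 cxy2 [[e1 e2]|[e1 e2]]]]; last first.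
    by have := arc_squeeze_len x2M h2; clear -qE lh e2; lia.
  subst x x2; have cy2 : c y2 = c y by rewrite qE c0 !subn0 in e2.
  have xy2 := has_arc_len h2.
  have [||_ [<- //|[[e3 e4]|[e3 e4]]]] := squeeze_inj_arc xM xM _ _ (erefl (c 0)) cy2;
    by move: xy xy2; rewrite ?e3 ?e4; clear; lia.
have a0 : attached 0 C (c y - c x).
  by exists x', y'; split=> //; left; rewrite ex ey.
have qle : q <= c y - c x by apply: min0 => //; rewrite subn_gt0.
case/orP: (implyP r2 (introT eqP x1)) => [lt|/andP[bt /eqP qE]].
  by move: lt qle; clear; lia.
case/attachedP: bt => x2 [y2 [x2M h2 cxy2 [[e1 e2]|[e1 e2]]]]; last first.
  by have := arc_squeeze_len x2M h2; clear -qE lh e2; lia.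
subst x x2; have cy2 : c y2 = c y by rewrite -qE c1 !subn0 in e2.
have xy2 := has_arc_len h2.
have [||_ [<- //|[[e3 e4]|[e3 e4]]]] := squeeze_inj_arc xM xM _ _ (erefl (c 1)) cy2.
- by clear -xy2; lia.
- by clear -xy; lia.
- by move: (implyP r4 (introT eqP e4)); rewrite -qE -cy2 e3 squeezeM c1; clear; lia.
(* Here [q] is N, but the arc from 1 to M + 1 also has the key N + 1 at its other end, above the
   largest key allowed at 1. *)
suff a1 : attached 1 C N.+1 by move: (max1 _ a1); rewrite -qE -cy2 e3 squeezeMS c1; clear; lia.
exists 1, y2; split=> //; right; split; first by rewrite addn1.
by rewrite e3 squeezeMS c1; clear; lia.
Qed.

End Contraction.

Local Open Scope nat_scope.

(** * Averaging over rotations and the number of dissections *)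

Section Rotation.

Variable n : nat.
Local Notation N := n.+1.
Implicit Types (B : {set parc n}).

Lemma dissectionP B : dissection B <->
  (forall x x' y y', x < x' -> x' < y -> y < y' -> has_arc B x y -> has_arc B x' y' -> False)
  /\ (forall x, has_arc B x x.+1).
Proof.
split=> [dB|[nB eB]]; last first.
  apply/andP; split; first by apply/noncrossingP => x x' y y' _; apply: nB.
  by apply/forallP => a; rewrite -has_arc_ord addn1.
have /andP[/noncrossingP nB _] := dB; split=> [x|x].
  have [q qx] : exists q, x < q * N by exists x.+1; rewrite mulSn mulnS; lia.
  elim: q x qx => // q IH x xq x' y y' xx' x'y yy' h h'.
  have [xN|Nx] := ltnP x N; first exact: (nB x x' y y').
  apply: (IH (x - N) _ (x' - N) (y - N) (y' - N)); try by clear -Nx xx' x'y yy' xq; lia.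
    by rewrite -has_arc_shift !subnK //; clear -Nx xx' x'y yy'; lia.
  by rewrite -has_arc_shift !subnK //; clear -Nx xx' x'y yy'; lia.
have [q qx] : exists q, x < q * N by exists x.+1; rewrite mulSn mulnS; lia.
elim: q x qx => // q IH x xq.
have [xN|Nx] := ltnP x N; first exact: dissection_edge.
rewrite -(subnK Nx) -addSn has_arc_shift; apply: IH; clear -Nx xq; lia.
Qed.

Definition rotate B : {set parc n} := arcs_of n (fun x y => has_arc B x.+1 y.+1).

Lemma has_rotate B x y : has_arc (rotate B) x y = has_arc B x.+1 y.+1.
Proof.
have [q qx] : exists q, x < q * N by exists x.+1; rewrite mulSn mulnS; lia.
elim: q x y qx => // q IH x y xq.
have [xN|Nx] := ltnP x N.
  by rewrite has_arcs_of // andb_idl // => /has_arc_len; clear; lia.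
have [Ny|yN] := leqP N y.
  by rewrite -(subnK Nx) -(subnK Ny) -!addSn !has_arc_shift IH //; clear -Nx xq; lia.
by apply/idP/idP => /has_arc_len; clear -yN Nx; lia.
Qed.

(** Adding [n] inverts the shift by one modulo N and avoids the predecessor of 0. *)
Lemma has_arc_rotate B x y : has_arc B x y = has_arc (rotate B) (x + n) (y + n).
Proof. by rewrite has_rotate -!addnS has_arc_shift. Qed.

Lemma rotate_inj : injective rotate.
Proof.
move=> B B' e; apply: arcs_ext => x y _ _.
by rewrite has_arc_rotate e -has_arc_rotate.
Qed.

Lemma dissection_rotate B : dissection (rotate B) = dissection B.
Proof.
apply/idP/idP => /dissectionP[nB eB]; apply/dissectionP; split=> [x x' y y' a1 a2 a3|x].
- by rewrite has_arc_rotate [has_arc B x' _]has_arc_rotate; apply: nB; rewrite ltn_add2r.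
- by rewrite has_arc_rotate addSn.
- by rewrite !has_rotate; apply: nB.
- by rewrite has_rotate.
Qed.

Definition outdeg B (a : nat) : nat := \sum_(l < N) has_arc B a (a + l.+1).
(** The vertex is taken at [a + N] to keep the subtraction from being truncated. *)
Definition indeg B (a : nat) : nat := \sum_(l < N) has_arc B (a + N - l.+1) (a + N).

Lemma sum_outdeg B : \sum_(a < N) outdeg B a = #|B|.
Proof.
rewrite pair_big /= -sum1_card [RHS]big_mkcond /=.
by apply: eq_bigr => p _; rewrite has_arc_ord; case: (p \in B).
Qed.

Lemma sum_indeg B : \sum_(a < N) indeg B a = #|B|.
Proof.
rewrite -sum_outdeg exchange_big [RHS]exchange_big /=; apply: eq_bigr => l _.
have lN := ltn_ord l.
pose f x : nat := has_arc B x (x + l.+1).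
have fN x : f (x + N) = f x by rewrite /f addnAC has_arc_shift.
have E d : \sum_(0 <= a < N) f (a + d) = \sum_(0 <= a < N) f a.
  elim: d => [|d <-]; first by apply: eq_bigr => a _; rewrite addn0.
  rewrite big_nat_recr //= [RHS]big_nat_recl //= [LHS]addnC; congr (_ + _).
    by rewrite addnS -addSn addnC fN.
  by apply: eq_bigr => a _; rewrite addnS addSn.
rewrite -(big_mkord xpredT (fun a => f a)) -(E (N - l.+1)) big_mkord.
apply: eq_bigr => a _; rewrite /f addnBA // subnK //.
by rewrite (leq_trans lN) // leq_addl.
Qed.

Lemma card_rotate B : #|rotate B| = #|B|.
Proof.
rewrite -[RHS]sum_outdeg -sum_outdeg.
have E a : outdeg (rotate B) a = outdeg B a.+1 by apply: eq_bigr => l _; rewrite has_rotate addSn.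
under eq_bigr => a _ do rewrite E.
rewrite -(big_mkord xpredT (fun a => outdeg B a.+1)) -(big_mkord xpredT (outdeg B)).
rewrite big_nat_recr //= big_nat_recl //= addnC; congr (_ + _).
by apply: eq_bigr => l _; rewrite -{2}[l.+1]add0n -[in RHS]has_arc_shift add0n addnAC.
Qed.

Definition dissections (k : nat) : {set {set parc n}} :=
  [set B | dissection B & #|B| == N + k].

(** Rotation permutes the dissections, so the sum is the same at every vertex; summed over all
    vertices, the degrees of one dissection give twice the number of its arcs. *)
Lemma sum_degrees k :
  N * (\sum_(B in dissections k) (outdeg B 0 + indeg B 0)) = 2 * (N + k) * #|dissections k|.
Proof.
have R a : \sum_(B in dissections k) (outdeg B a + indeg B a)
         = \sum_(B in dissections k) (outdeg B 0 + indeg B 0).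
  elim: a => // a <-; rewrite [RHS](reindex_inj rotate_inj) /=.
  apply: eq_big => [B|B _]; first by rewrite !inE dissection_rotate card_rotate.
  congr (_ + _); apply: eq_bigr => l _; rewrite has_rotate ?addSn //.
  by congr (has_arc _ _ _ : nat); have := ltn_ord l; clear; lia.
transitivity (\sum_(a < N) \sum_(B in dissections k) (outdeg B a + indeg B a)).
  by under [RHS]eq_bigr => a _ do rewrite R; rewrite sum_nat_const card_ord.
rewrite exchange_big /= mulnC -sum_nat_const; apply: eq_bigr => B.
rewrite inE => /andP[_ /eqP <-].
by rewrite big_split /= sum_outdeg sum_indeg addnn mul2n.
Qed.

Lemma card_entries B :
  #|[set q : 'I_(N + N).+1 | (0 < q) && entry B q]| = outdeg B 0 + indeg B 0.
Proof.
rewrite -sum1dep_card big_mkcond /= big_ord_recl /= add0n.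
rewrite big_split_ord /=; congr (_ + _).
  apply: eq_bigr => l _; rewrite /entry /= add0n /bump /= add1n ltn_ord.
  by case: (has_arc _ _ _).
rewrite /indeg (reindex_inj rev_ord_inj) /=; apply: eq_bigr => l _.
rewrite /entry /bump /= add1n.
have lN := ltn_ord l.
have -> : ((N + (N - l.+1)).+1 <= N) = false by clear; lia.
have -> : (N + (N - l.+1)).+1 - N.+1 = 0 + N - l.+1 by clear -lN; lia.
by rewrite add0n; case: (has_arc _ _ _).
Qed.

Lemma entry1 B : dissection B -> entry B 1.
Proof. by move=> dB; rewrite /entry /=; apply: dissection_edge. Qed.

Lemma card_choices B b : dissection B ->
  #|[set t in choices B | t.2 == b]| + ~~ b = outdeg B 0 + indeg B 0.
Proof.
move=> dB; rewrite -card_entries.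
have qP : 1 < (N + N).+1 by [].
pose q1 : 'I_(N + N).+1 := Ordinal qP.
pose E := [set q : 'I_(N + N).+1 | (0 < q) && entry B q].
have -> : [set t in choices B | t.2 == b] = (fun q => (q, b)) @: (if b then E else E :\ q1).
  apply/setP => -[q b']; apply/idP/imsetP.
    rewrite !inE /= => /andP[/and3P[q0 eq q1b] /eqP <-]; exists q => //.
    case: b' q1b; rewrite !inE q0 eq ?andbT // implybF.
  case=> q' hq [-> ->]; rewrite !inE eqxx andbT /=.
  case: b hq; rewrite !inE => /andP[h1 h2]; first by rewrite h1 h2 implybT.
  case/andP: h2 => -> ->; rewrite implybF /=.
  by apply: contra h1 => /eqP e; apply/eqP/val_inj.
rewrite card_imset => [|q q' []//]; case: b; first by rewrite addn0.
rewrite -/E (cardsD1 q1 E) addnC; congr (_ + _).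
by rewrite inE /= entry1.
Qed.

End Rotation.

Lemma card_dissection_ge (n : nat) (B : {set parc n}) : dissection B -> n.+1 <= #|B|.
Proof.
case/andP => _ /forallP eB; rewrite -{1}(card_ord n.+1) -(card_imset (mem 'I_n.+1) (f := fun a => (a, ord0 : 'I_n.+1))).
  by apply/subset_leq_card/subsetP => _ /imsetP[a _ ->].
by move=> a b [].
Qed.

(** A lift has one more arc if [b] is false and two more otherwise, while the polygon gains one edge
    modulo symmetry; so [k] is preserved or raised by one. The second term on the left stands for
    the pairs of key 1 and [b = false], which [choices] excludes. *)
Lemma num_dissections_rec (n k : nat) : #|dissections n.+1 k| + #|dissections n k| =
  \sum_(B in dissections n k) (outdeg B 0 + indeg B 0)
  + (if k is k'.+1 then \sum_(B in dissections n k') (outdeg B 0 + indeg B 0) else 0).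
Proof.
pose S b k' := [set t : {set parc n} * ('I_(n.+1 + n.+1).+1 * bool) |
  (t.1 \in dissections n k') && (t.2 \in [set t' in choices t.1 | t'.2 == b])].
have cS b k' : #|S b k'| = \sum_(B in dissections n k') #|[set t in choices B | t.2 == b]|.
  rewrite -sum1dep_card -(pair_big_dep (mem (dissections n k'))
    (fun B t => t \in [set t' in choices B | t'.2 == b]) (fun _ _ => 1)) /=.
  by apply: eq_bigr => B _; rewrite sum1_card.
have cF k' : #|S false k'| + #|dissections n k'| = \sum_(B in dissections n k') (outdeg B 0 + indeg B 0).
  rewrite cS -sum1_card -big_split /=; apply: eq_bigr => B; rewrite inE => /andP[dB _].
  by rewrite -(card_choices false dB).
have cT k' : #|S true k'| = \sum_(B in dissections n k') (outdeg B 0 + indeg B 0).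
  by rewrite cS; apply: eq_bigr => B; rewrite inE => /andP[dB _]; rewrite -(card_choices true dB) addn0.
pose S' := S false k :|: (if k is k'.+1 then S true k' else set0).
pose f (t : {set parc n} * ('I_(n.+1 + n.+1).+1 * bool)) := lift_arcs t.1 t.2.1 t.2.2.
have S'P t : t \in S' -> [/\ dissection t.1, 0 < t.2.1 <= n.+1 + n.+1, entry t.1 t.2.1,
    (t.2.1 == 1 :> nat) ==> t.2.2 & #|t.1| + 1 + t.2.2 = n.+2 + k].
  case: t => B [q b]; rewrite /S' inE => /orP[].
    rewrite !inE /= => /andP[/andP[dB /eqP cB] /andP[/and3P[q0 eq q1] /eqP eb]].
    by split=> //; [rewrite q0 -ltnS ltn_ord | rewrite cB eb; clear; lia].
  case: (k) => [|k']; rewrite !inE //=.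
  case/andP => /andP[dB /eqP cB] /andP[/and3P[q0 eq q1] /eqP eb].
  by split=> //; [rewrite q0 -ltnS ltn_ord | rewrite cB eb; clear; lia].
have -> : #|dissections n.+1 k| = #|S'|.
  rewrite -(card_in_imset (f := f) (D := S')); last first.
    move=> [B [q b]] [B' [q' b']] /S'P[/= _ qN eq q1 _] /S'P[/= _ qN' eq' q1' _] e.
    by have [-> /val_inj -> ->] := lift_inj qN eq q1 qN' eq' q1' e.
  congr #|pred_of_set _|; apply/setP => C; apply/idP/imsetP => [|[t /S'P[dB qN eq q1 cB] ->]].
    rewrite inE => /andP[dC /eqP cC].
    have [B [q [b [dB qN eq q1 CE]]]] := lift_surj dC.
    have qlt : q < (n.+1 + n.+1).+1 by rewrite ltnS; case/andP: qN.
    exists (B, (Ordinal qlt, b)) => //.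
    move: cC; rewrite CE card_lift // => cC.
    case: b q1 {CE} cC => q1 cC; rewrite !inE /=.
      case: (k) cC => [|k'] cC.
        by exfalso; have := card_dissection_ge dB; move: cC; clear; lia.
      rewrite !inE dB q1 eq /= orbC; apply/orP; left.
      case/andP: qN => -> _; rewrite !andbT; apply/eqP/(@addIn 2).
      by move: cC; rewrite -addnA => ->; clear; lia.
    rewrite dB q1 eq /=; apply/orP; left.
    case/andP: qN => -> _; rewrite !andbT; apply/eqP/(@addIn 1).
    by move: cC; rewrite -addnA => ->; clear; lia.
  by rewrite inE dissection_lift // card_lift // cB eqxx.
rewrite -cF addnAC; congr (_ + _).
rewrite /S' cardsU; case: (k) => [|k']; first by rewrite setI0 cards0 subn0 addn0.
rewrite cT disjoint_setI0 ?cards0 ?subn0 //.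
rewrite -setI_eq0; apply/eqP/setP => -[B [q b]]; rewrite !inE /=.
by case: b; rewrite ?andbF.
Qed.

Local Open Scope nat_scope.

Lemma card_dissections0 (k : nat) : #|dissections 0 k| = (k == 0).
Proof.
have D (B : {set parc 0}) : dissection B = (B == setT).
  apply/idP/eqP => [|->].
    move=> dB; apply/eqP; rewrite eqEcard subsetT /= cardsT card_prod !card_ord.
    exact: card_dissection_ge dB.
  apply/andP; split; last by apply/forallP => a; rewrite inE.
  by apply/noncrossingP => x x' y y' _ a1 a2 a3 /has_arc_len; clear -a1 a2; lia.
have cT : #|[set: parc 0]| = 1 by rewrite cardsT card_prod !card_ord.
case: eqP => k0.
  have -> : dissections 0 k = [set setT]; last by rewrite cards1.
  apply/setP => B; rewrite !inE D; case: eqP => // ->.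
  by rewrite cT k0.
apply/eqP; rewrite cards_eq0; apply/eqP/setP => B; rewrite !inE D.
by case: eqP => // ->; rewrite cT; case: k k0.
Qed.

(** The induction step with letters for the binomials. After multiplication by [n + 1], the claim is
    a linear combination of the four hypotheses. *)
Lemma card_dissections_step (n k A A' D E F T : nat) :
  (n + 1) * T + (n + 1) * (A * D)
    = 2 * (n + 1 + (k + 1)) * (A * D) + 2 * (n + 1 + k) * (A' * E) ->
  (n + 1 + (k + 1)) * D = (n + 1) * F -> (n + k + 1) * E = (k + 1) * D ->
  (k + 1) * A + k * A' = n * A' ->
  T = (A + A') * F.
Proof.
move=> /(congr1 Posz) H1 /(congr1 Posz) H2 /(congr1 Posz) H3 /(congr1 Posz) H4.
apply/eqP; rewrite -(@eqn_pmul2l (n + 1)) ?addn1 // -addn1 -eqz_nat -subr_eq0; apply/eqP.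
move: H1 H2 H3 H4; rewrite !(PoszM, PoszD).
move: (Posz n) (Posz k) (Posz A) (Posz A') (Posz D) (Posz E) (Posz F) (Posz T).
move=> {}n {}k {}A {}A' {}D {}E {}F {}T H1 H2 H3 H4.
transitivity (((n + 1) * T + (n + 1) * (A * D)
    - (2 * (n + 1 + (k + 1)) * (A * D) + 2 * (n + 1 + k) * (A' * E)))
  + (A + A') * ((n + 1 + (k + 1)) * D - (n + 1) * F)
  + 2 * A' * ((n + k + 1) * E - (k + 1) * D) + D * ((k + 1) * A + k * A' - n * A'))%R; first by ring.
by rewrite H1 H2 H3 H4 !subrr !mulr0 !addr0.
Qed.

Lemma card_dissections (n k : nat) : #|dissections n k| = 'C(n, k) * 'C(n + k, k).
Proof.
elim: n k => [|n IH] k; first by rewrite card_dissections0 bin0n; case: k => //= k; rewrite binn.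
have := num_dissections_rec n k; move/(congr1 (muln n.+1)); rewrite !mulnDr sum_degrees.
case: k => [|k] H.
  apply/eqP; rewrite -(eqn_pmul2l (ltn0Sn n)) -(eqn_add2r (n.+1 * #|dissections n 0|)).
  by rewrite H IH !bin0 muln0; apply/eqP; clear; lia.
have down := mul_bin_down (n.+1 + k.+1) k.+1; rewrite addnK addSn [_.-1]/= -addSn in down.
rewrite sum_degrees !IH in H.
have diag := mul_bin_diag (n + k.+1) k; rewrite {2}addnS [_.-1]/= in diag.
have left := mul_bin_left n k.
rewrite binS; apply: (@card_dissections_step n k _ _ 'C(n + k.+1, k.+1) 'C(n + k, k)).
- by rewrite !addn1.
- by rewrite !addn1.
- by rewrite !addn1 -addnS.
have [kn|nk] := leqP k n; last by rewrite !bin_small ?muln0 // ltnW.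
by rewrite addn1 left -mulnDl subnK.
Qed.

(** * Every dissection extends to one of maximal size *)

Section Purity.

Variable n : nat.
Local Notation N := n.+1.
Implicit Types (B : {set parc n}).

Lemma has_arc_mod B x x' d : x %% N = x' %% N -> has_arc B x (x + d) = has_arc B x' (x' + d).
Proof. by move=> e; apply: eq_existsb => p; rewrite e !eqn_add2l. Qed.

Lemma dissection_add B x d : dissection B -> x < N -> 0 < d <= N ->
  ~~ has_arc B x (x + d) ->
  (forall u p q, u %% N = x -> has_arc B p q -> u < p -> p < u + d -> u + d < q -> False) ->
  (forall u p q, u %% N = x -> has_arc B p q -> p < u -> u < q -> q < u + d -> False) ->
  exists B', [/\ dissection B', B \subset B' & #|B'| = #|B|.+1].
Proof.
move=> dB xN dN nh H1 H2; have /dissectionP[nB eB] := dB.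
have xy : x < x + d <= x + N by clear -dN; lia.
have [p [ep1 ep2]] := arc_exists xN xy.
have hE u v : has_arc (p |: B) u v = ((u %% N == x) && (v == u + d)) || has_arc B u v.
  have dE : p.2.+1 = d by move: ep2; rewrite ep1 => /addnI.
  apply/exists_inP/orP => [[q]|[e|/exists_inP[q qB e]]].
  - rewrite !inE => /orP[/eqP ->|qB e]; last by right; apply/exists_inP; exists q.
    by rewrite ep1 dE; left.
  - by exists p; rewrite ?setU11 // ep1 dE.
  - by exists q => //; rewrite setU1r.
exists (p |: B); split; last 1 first.
- rewrite cardsU1 (_ : p \notin B) //; apply: contra nh.
  by rewrite -has_arc_ord ep2 ep1.
- apply/dissectionP; split=> [u u' v v' uu' u'v vv'|u]; last by rewrite hE eB orbT.
  rewrite !hE => /orP[/andP[/eqP e /eqP ev]|h] /orP[/andP[/eqP e' /eqP ev']|h'].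
  + subst v v'; have uu'd : u' < u + N by clear -u'v dN; lia.
    move: e'; rewrite -(subnK (ltnW uu')) => e'.
    have /eqP : (u' - u) + u = 0 + u %[mod N] by rewrite e' e.
    rewrite eqn_modDr mod0n modn_small; last by clear -uu' uu'd; lia.
    by rewrite subn_eq0 leqNgt uu'.
  + by subst v; apply: (H1 u u' v').
  + by subst v'; apply: (H2 u' u v).
  + exact: (nB u u' v v').
exact: subsetUr.
Qed.

Definition long_arcs B := [set p in B | p.2 != ord0].
(* A residue mod N that is not an apex leaves room for a further arc. *)
Definition apex B (p : parc n) : nat := \max_(d < p.2.+1 | has_arc B p.1 (p.1 + d)) d.
Definition apexes B : {set 'I_N} := [set inord ((p.1 + apex B p) %% N) | p : parc n in long_arcs B].

Lemma apexP B p : dissection B -> p.2 != ord0 ->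
  [/\ 0 < apex B p < p.2.+1, has_arc B p.1 (p.1 + apex B p) &
   forall d, d < p.2.+1 -> has_arc B p.1 (p.1 + d) -> d <= apex B p].
Proof.
move=> dB p2; have p20 : 0 < p.2 by rewrite lt0n.
have one : 1 < p.2.+1 by [].
have h1 : has_arc B p.1 (p.1 + Ordinal one) by rewrite /= addn1; apply: dissection_edge.
have mx d : d < p.2.+1 -> has_arc B p.1 (p.1 + d) -> d <= apex B p.
  by move=> dl h; rewrite /apex (bigop.leq_bigmax_cond (Ordinal dl)).
have := @eq_bigmax_cond _ [pred d : 'I_p.2.+1 | has_arc B p.1 (p.1 + d)] (fun d => d : nat).
case=> [|d hd E]; first by apply/card_gt0P; exists (Ordinal one).
have -> : apex B p = d by [].
split=> //; last by move=> d' dl h; have := mx d' dl h; rewrite /apex E.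
rewrite ltn_ord andbT; have := mx 1 one h1; by rewrite /apex E.
Qed.

(** In a shortest arc over [r], join the left end to [r]. By minimality nothing crosses the new arc.
    It is not yet present, for otherwise [r] would be the apex or the arc from the left end to the
    apex would be a shorter one over [r]. *)
Lemma extend_inside B (r : 'I_N) u d l : dissection B -> r \notin apexes B ->
  has_arc B u (u + l) -> 0 < d < l -> (u + d) %% N = r ->
  exists B', [/\ dissection B', B \subset B' & #|B'| = #|B|.+1].
Proof.
move=> dB rB hu dl ur.
have /dissectionP[nB eB] := dB.
pose P l := [exists x : 'I_N, exists d : 'I_l, [&& has_arc B x (x + l), 0 < d & (x + d) %% N == r]].
have Pin x' d' l' : has_arc B x' (x' + l') -> 0 < d' < l' -> (x' + d') %% N = r -> P l'.
  move=> h /andP[d0 dl'] e; have x'N : x' %% N < N by rewrite ltn_mod.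
  apply/existsP; exists (Ordinal x'N); apply/existsP; exists (Ordinal dl') => /=.
  by rewrite d0 modnDml e eqxx andbT (@has_arc_mod B _ x' l' (modn_mod _ _)) h.
have exP : exists l, P l by exists l; apply: (Pin u d).
case: (ex_minnP exP) => {hu dl ur exP}l' /existsP[x /existsP[d' /and3P[h d0 /eqP xr]]] lmin.
have d'l := ltn_ord d'.
have /andP[_ l'N] := has_arc_len h; rewrite leq_add2l in l'N.
apply: (@dissection_add B x d') => //.
- by rewrite d0; clear -d'l l'N; lia.
- have l2 : l'.-1 < N by clear -d'l l'N; lia.
  pose p : parc n := (x, Ordinal l2).
  have p2 : p.2 != ord0 by apply/eqP => /(congr1 val) /=; clear -d'l d0; lia.
  have pl : p.2.+1 = l' by rewrite /=; clear -d'l; lia.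
  have [al ha amax] := apexP dB p2.
  have pB : p \in long_arcs B by rewrite inE p2 andbT -has_arc_ord pl.
  apply/negP => hd; have := amax d'; rewrite pl => /(_ d'l hd); rewrite leq_eqVlt => /orP[/eqP e|da].
    case/negP: rB; apply/imsetP; exists p => //; apply: val_inj => /=.
    by rewrite inordK ?ltn_mod // -e xr.
  have := lmin (apex B p) (Pin _ _ _ ha _ xr); rewrite d0 da => /(_ isT).
  by move: al; rewrite pl; clear; lia.
- move=> v p q vx hpq vp pv vq.
  have hv : has_arc B v (v + l') by rewrite (@has_arc_mod B _ x) // vx modn_small.
  have [ql|lq] := leqP q (v + l'); last first.
    apply: (nB v p (v + l') q) => //; clear -pv d'l; lia.
  have pq : p + (q - p) = q by rewrite subnKC // ltnW; case/andP: (has_arc_len hpq).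
  have := lmin (q - p) (Pin p (v + d' - p) (q - p) _ _ _); rewrite pq => /(_ hpq).
  have -> : p + (v + d' - p) = v + d' by clear -pv; lia.
  rewrite -modnDml vx xr => /(_ _ erefl).
  have -> : 0 < v + d' - p < q - p by clear -pv vq; lia.
  by move/(_ isT); clear -ql vp pq; lia.
- move=> v p q vx hpq pv vq qv.
  have hv : has_arc B v (v + l') by rewrite (@has_arc_mod B _ x) // vx modn_small.
  by apply: (nB p v q (v + l')) => //; clear -qv d'l; lia.
Qed.

Lemma card_long_arcs B : dissection B -> #|long_arcs B| + N = #|B|.
Proof.
case/andP => _ /forallP eB; rewrite -(cardsID [set p | p.2 == ord0] B) addnC; congr (_ + _).
  rewrite -[LHS](card_ord N) -(card_imset (mem 'I_N) (f := fun a => (a, ord0 : 'I_N))).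
    apply: eq_card => -[a l]; rewrite !inE /=; apply/imsetP/andP => [[b _ [-> ->]]|[ab /eqP ->]].
      by rewrite eqxx eB.
    by exists a.
  by move=> a b [].
by apply: eq_card => p; rewrite !inE andbC.
Qed.

(** There are fewer than [n] long arcs, hence at least two residues that are not apexes. If no arc
    passes over the first, the arc of length N at it crosses nothing; if that arc is already
    present, it passes over the second residue. *)
Lemma dissection_extend B : dissection B -> #|B| < N + n ->
  exists B', [/\ dissection B', B \subset B' & #|B'| = #|B|.+1].
Proof.
move=> dB Bn; have cl := card_long_arcs dB.
have ca : #|apexes B| < n.
  by apply: leq_ltn_trans (leq_imset_card _ _) _; rewrite -(ltn_add2r N) cl addnC.
have c2 : 1 < #|~: apexes B| by have := cardsC (apexes B); rewrite card_ord; clear -ca; lia.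
have /dissectionP[nB eB] := dB.
case/card_gt1P: c2 => r [r' [rB r'B rr']]; rewrite !inE in rB r'B.
case: (boolP [exists u : 'I_N, exists l : 'I_N.+1, exists d : 'I_l,
   [&& has_arc B u (u + l), 0 < d & (u + d) %% N == r]]) => [|noin].
  case/existsP => u /existsP[l /existsP[d /and3P[h d0 /eqP e]]].
  by apply: (extend_inside dB rB h _ e); rewrite d0 ltn_ord.
have {noin}noin p q v : has_arc B p q -> p < v -> v < q -> v %% N = r -> False.
  move=> h pv vq vr; case/negP: noin; have lpq := has_arc_len h.
  have pN : p %% N < N by rewrite ltn_mod.
  have lN : q - p < N.+1 by clear -lpq; lia.
  have dl : v - p < q - p by clear -pv vq; lia.
  apply/existsP; exists (Ordinal pN); apply/existsP; exists (Ordinal lN).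
  apply/existsP; exists (Ordinal dl) => /=.
  rewrite (@has_arc_mod B _ p) ?modn_mod // subnKC; last by clear -lpq; lia.
  by rewrite h subn_gt0 pv modnDml subnKC ?vr ?eqxx // ltnW.
case: (boolP (has_arc B r (r + N))) => [h|nh].
  have [d dN e] : exists2 d, 0 < d < N & (r + d) %% N = r'.
    case: (ltngtP r r') => [lt|lt|/val_inj e]; last by rewrite e eqxx in rr'.
      by exists (r' - r); [have := ltn_ord r'; clear -lt; lia | rewrite subnKC ?modn_small // ltnW].
    exists (r' + N - r); first by have := ltn_ord r; clear -lt; lia.
    by rewrite subnKC ?modnDr ?modn_small //; have := ltn_ord r; clear; lia.
  exact: (extend_inside dB r'B h dN e).
apply: (@dissection_add B r N) => //; first by rewrite leqnn.
- by move=> u p q ur h up pu uq; apply: (noin p q (u + N)) => //; rewrite modnDr.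
- by move=> u p q ur h pu uq _; apply: (noin p q u).
Qed.

(** Larger dissections do not exist because their number contains the factor ['C(n, k)] with
    [k > n]. *)
Lemma card_dissection_le B : dissection B -> #|B| <= N + n.
Proof.
move=> dB; rewrite leqNgt; apply/negP => nB.
have := card_dissections n (#|B| - N); rewrite bin_small ?mul0n; last by clear -nB; lia.
move/eqP; rewrite cards_eq0 => /eqP/setP/(_ B).
by rewrite !inE dB subnKC ?eqxx //; clear -nB; lia.
Qed.

End Purity.

(** * Centrally symmetric dissections *)

Local Open Scope nat_scope.

Lemma edge_len x l : (x + l.+1 == x.+1) = (l == 0).
Proof. by rewrite addnS eqSS -{2}[x]addn0 eqn_add2l. Qed.

Section Chords.

Variable n : nat.
Local Notation N := n.+1.
Local Notation V := 'I_(n.*2.+2).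
Implicit Types (B : {set parc n}) (A : {set {set V}}) (D E : {set V}).

Lemma double_size : n.*2.+2 = N + N.
Proof. clear; lia. Qed.

Definition chord (x y : nat) : {set V} := [set inZp x; inZp y].

Lemma chord_modl x y : chord (x + n.*2.+2) y = chord x y.
Proof. by congr [set _; _]; apply: val_inj; rewrite /= modnDr. Qed.

Lemma chord_modr x y : chord x (y + n.*2.+2) = chord x y.
Proof. by congr [set _; _]; apply: val_inj; rewrite /= modnDr. Qed.

Lemma chordC x y : chord x y = chord y x.
Proof. exact: setUC. Qed.

Lemma antipodeK : involutive (@antipode n).
Proof.
move=> v; apply: val_inj; rewrite /= modnDml -addnA -double_size modnDr modn_small //.
Qed.

Lemma antipode_chord x y : [set antipode v | v in chord x y] = chord (x + N) (y + N).
Proof.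
rewrite /chord imsetU1 imset_set1.
by congr [set _; _]; apply: val_inj; rewrite /= modnDml.
Qed.

Lemma symmetric_chord A x y : cyclo_dissection A ->
  (chord (x + N) (y + N) \in A) = (chord x y \in A).
Proof.
case/and3P => _ _ /eqP sA; rewrite -antipode_chord -{1}sA mem_imset //.
by apply: imset_inj; apply: inv_inj antipodeK.
Qed.

Lemma chord_cases x y x' y' : chord x y = chord x' y' ->
  (x = x' %[mod n.*2.+2] /\ y = y' %[mod n.*2.+2])
  \/ (x = y' %[mod n.*2.+2] /\ y = x' %[mod n.*2.+2]).
Proof.
move=> e; have inZpE u v : (inZp u == inZp v :> V) = (u == v %[mod n.*2.+2]) by [].
have := set21 (inZp x : V) (inZp y); rewrite -/(chord x y) e !inE !inZpE.
have := set22 (inZp x : V) (inZp y); rewrite -/(chord x y) e !inE !inZpE.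
have := set21 (inZp x' : V) (inZp y'); rewrite -/(chord x' y') -e !inE !inZpE.
have := set22 (inZp x' : V) (inZp y'); rewrite -/(chord x' y') -e !inE !inZpE.
move=> h1 h2 /orP[/eqP yx'|/eqP yy'] /orP[/eqP xx'|/eqP xy'].
- by left; move: h1; rewrite xx' yx' orbb => /eqP.
- by right.
- by left.
- by right; move: h2; rewrite xy' yy' orbb => /eqP.
Qed.

Lemma modn_eq_cases m u v : u = v %[mod m] -> u < v + m -> v < u + m -> u = v.
Proof.
wlog le : u v / u <= v => [H e a b|].
  by have [uv|/ltnW vu] := leqP u v; [apply: H | apply/esym/H].
move=> e _ vu; have /eqP : (v - u) + u = 0 + u %[mod m] by rewrite subnK.
rewrite eqn_modDr mod0n modn_small; last by clear -vu le; lia.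
by rewrite subn_eq0 => vu'; apply/eqP; rewrite eqn_leq le.
Qed.

(* Two arcs that span the same chord are translates of each other. *)
Lemma chord_arc_eq B x y x' y' : x < y <= x + N -> x' < y' <= x' + N ->
  chord x y = chord x' y' -> has_arc B x y = has_arc B x' y'.
Proof.
move=> xy xy' /chord_cases.
have modN u v : u = v %[mod n.*2.+2] -> u %% N = v %% N.
  have d : N %| n.*2.+2 by rewrite double_size dvdn_addr ?dvdnn.
  by move=> e; rewrite -(modn_dvdm u d) e modn_dvdm.
have -> : y = x + (y - x) by clear -xy; lia.
have -> : y' = x' + (y' - x') by clear -xy'; lia.
set d := y - x; set d' := y' - x'.
have dN : 0 < d <= N by rewrite /d; clear -xy; lia.
have dN' : 0 < d' <= N by rewrite /d'; clear -xy'; lia.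
case=> -[e1 e2].
  have -> : d = d'; last by apply: has_arc_mod; apply: modN.
  apply: (@modn_eq_cases n.*2.+2); try by clear -dN dN'; lia.
  by apply/eqP; rewrite -(eqn_modDl x); apply/eqP; rewrite e2 -modnDml -e1 modnDml.
(* With exchanged ends the two lengths add up to 2N, so both are N: the chord is a diameter and the
   arcs differ by a period. *)
have e : d + d' = n.*2.+2.
  have /eqP : (d + d') + x' = n.*2.+2 + x' %[mod n.*2.+2].
    rewrite modnDl -e2 -addnA [d' + _]addnC -modnDmr -e1 modnDmr addnC //.
  rewrite eqn_modDr modnn => e; apply: (@modn_eq_cases n.*2.+2).
  - by rewrite (eqP e) modnn.
  - by clear -dN dN'; lia.
  - by clear -dN dN'; lia.
have -> : d = N by move: e dN dN'; clear; lia.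
have -> : d' = N by move: e dN dN'; clear; lia.
apply: has_arc_mod; rewrite (modN _ _ e1).
have -> : d' = N by move: e dN dN'; clear; lia.
by rewrite modnDr.
Qed.

(** Edges of the polygon are not diagonals; they are added here and dropped again in
    [chords_of_arcs]. *)
Definition arcs_of_chords A : {set parc n} :=
  [set p : parc n | (p.2 == ord0) || (chord p.1 (p.1 + p.2.+1) \in A)].

Definition chords_of_arcs B : {set {set V}} :=
  [set D | [exists p in B, (p.2 != ord0) &&
     ((D == chord p.1 (p.1 + p.2.+1)) || (D == chord (p.1 + N) (p.1 + p.2.+1 + N)))]].

Lemma has_arcs_of_chords A x y : cyclo_dissection A ->
  has_arc (arcs_of_chords A) x y = (x < y <= x + N) && ((y == x.+1) || (chord x y \in A)).
Proof.
move=> dA.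
have [q qx] : exists q, x < q * N by exists x.+1; rewrite mulSn mulnS; clear; lia.
elim: q x y qx => // q IH x y xq.
have [xN|Nx] := ltnP x N.
  apply/idP/andP => [h|[xy e]].
    split; first exact: has_arc_len h.
    case/exists_inP: h => p; rewrite inE modn_small // => + /andP[/eqP -> /eqP ->].
    by rewrite edge_len.
  have [p [ex ey]] := arc_exists xN xy.
  rewrite -ex -ey has_arc_ord inE; move: e; rewrite -ex -ey.
  by rewrite edge_len.
have [Ny|yN] := leqP N y; last first.
  by apply/idP/idP => [/has_arc_len|/andP[+ _]]; clear -yN Nx; lia.
rewrite -{1}(subnK Nx) -{1}(subnK Ny) has_arc_shift IH; last by clear -Nx xq; lia.
rewrite -(symmetric_chord _ _ dA) !subnK //.
by congr (_ && (_ || _)); clear -Nx Ny; lia.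
Qed.

Lemma in_chords_of_arcs B D : reflect
  (exists x y, [/\ x.+1 < y, has_arc B x y & D = chord x y]) (D \in chords_of_arcs B).
Proof.
rewrite inE; apply: (iffP exists_inP) => [[p pB /andP[p2 e]]|[x [y [xy h ->]]]].
  have h := pB; rewrite -has_arc_ord in h.
  have p2' : p.1.+1 < p.1 + p.2.+1 by rewrite -addn1 ltn_add2l ltnS lt0n.
  case/orP: e => /eqP ->; first by exists p.1, (p.1 + p.2.+1).
  by exists (p.1 + N), (p.1 + p.2.+1 + N); rewrite has_arc_shift -addSn ltn_add2r.
have [q qx] : exists q, x < q * (N + N) by exists x.+1; rewrite mulSn !mulnDr !mulnS; clear; lia.
elim: q x y qx xy h => // q IH x y xq xy h.
have xl := has_arc_len h.
have [x2|Nx] := ltnP x (N + N); last first.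
  have ex : x = x - (N + N) + n.*2.+2 by rewrite double_size subnK.
  have ey : y = y - (N + N) + n.*2.+2 by rewrite double_size subnK //; clear -xl Nx; lia.
  rewrite ex ey chord_modl chord_modr; apply: IH; try by clear -Nx xq xy; lia.
  by move: h; rewrite {1}ex {1}ey !double_size !addnA !has_arc_shift.
have [xN|Nx] := ltnP x N.
  have [p [ep1 ep2]] := arc_exists xN xl.
  exists p; first by rewrite -has_arc_ord ep2 ep1.
  rewrite ep2 ep1 eqxx andbT; apply/eqP => p2; move: ep2; rewrite p2 ep1 addn1 => e.
  by move: xy; rewrite e ltnn.
have xN' : x - N < N by clear -x2 Nx; lia.
have xl' : x - N < y - N <= x - N + N by clear -xl Nx; lia.
have [p [ep1 ep2]] := arc_exists xN' xl'.
have yN : N <= y by clear -xl Nx; lia.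
exists p; first by rewrite -has_arc_ord ep2 ep1 -has_arc_shift !subnK.
rewrite ep2 ep1 !subnK // eqxx orbT andbT; apply/eqP => p2; move: ep2; rewrite p2 ep1 addn1 => e.
by move: xy e; clear -Nx yN; lia.
Qed.

Lemma crossing_chords D E (a b v w : V) : a \in D -> b \in D -> v \in E -> w \in E ->
  a < v < b -> (w < a) || (b < w) -> crossing D E.
Proof.
move=> aD bD vE wE /andP[av vb] wab; apply/exists_inP; exists a => //.
apply/exists_inP; exists b => //; apply/exists_inP; exists v => //.
by apply/exists_inP; exists w => //; rewrite av vb.
Qed.

Lemma dissection_arcs_of_chords A : cyclo_dissection A -> dissection (arcs_of_chords A).
Proof.
move=> dA; have /and3P[_ /forall_inP nA _] := dA; apply/andP; split; last first.
  by apply/forallP => a; rewrite inE eqxx.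
apply/noncrossingP => x x' y y' xN xx' x'y yy'.
rewrite !has_arcs_of_chords // => /andP[xy /orP[/eqP e|cA]].
  by clear -e xx' x'y; lia.
case/andP => xy' /orP[/eqP e|cA']; first by clear -e yy' x'y; lia.
have := forall_inP (nA _ cA) _ cA'; apply/negP; rewrite negbK.
pose i z : V := inZp z.
have iE z : z < N + N -> i z = z :> nat by move=> zN; rewrite /= modn_small // double_size.
have y2 : y < N + N by clear -xy xN; lia.
have x2 : x < N + N by clear -xN; lia.
have x2' : x' < N + N by clear -x'y y2; lia.
apply: (@crossing_chords _ _ (i x) (i y) (i x') (i y')); rewrite ?set21 ?set22 //.
  by rewrite (iE x) // (iE y) // (iE x') // xx'.
rewrite (iE x) // (iE y) //.
have [y2'|y2'] := ltnP y' (N + N); first by rewrite iE // yy' orbT.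
have -> : i y' = i (y' - (N + N)).
  by apply: val_inj; rewrite /= double_size -{1}(subnK y2') modnDr.
by rewrite iE; clear -xy' x'y xy y2' xN; lia.
Qed.

(** Crossings of diagonals are defined through vertices in [0, 2N). Of the two intervals under the
    chord, one has length at most N, and this is a translate of the given arc. *)
Lemma chord_ord B x y (a b : V) : has_arc B x y -> a \in chord x y -> b \in chord x y -> a < b ->
  has_arc B a b \/ has_arc B b (a + N + N).
Proof.
move=> h aD bD ab; have xy := has_arc_len h.
have e : chord x y = chord a b.
  have va (z : V) : inZp z = z by apply: valZpK.
  have ne : inZp x != inZp y :> V.
    apply: contraTneq ab => e; move: aD bD; rewrite /chord e setUid !inE => /eqP -> /eqP ->.
    by rewrite ltnn.
  move: aD bD; rewrite /chord !va !inE => /orP[/eqP ea|/eqP ea] /orP[/eqP eb|/eqP eb].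
  - by move: ab; rewrite ea eb ltnn.
  - by rewrite ea eb.
  - by rewrite ea eb setUC.
  - by move: ab; rewrite ea eb ltnn.
have [l|l] := leqP b (a + N).
  by left; rewrite -(chord_arc_eq B xy _ e) // ab.
right; have l' : b < a + N + N <= b + N.
  by have := ltn_ord b; rewrite [X in _ < X]double_size; clear -l; lia.
rewrite -(chord_arc_eq B xy l') // e chordC -addnA -double_size chord_modr //.
Qed.

Lemma dissection_chords_of_arcs B : dissection B -> cyclo_dissection (chords_of_arcs B).
Proof.
move=> /dissectionP[nB eB]; apply/and3P; split.
- apply/forall_inP => _ /in_chords_of_arcs[x [y [xy h ->]]].
  have xl := has_arc_len h.
  have neq : inZp x != inZp y :> V.
    apply/eqP => /(congr1 val) /= e.
    have := modn_eq_cases e; clear -xl xy; lia.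
  apply/andP; split; first by rewrite cards2 neq.
  apply/forallP => v; apply/eqP => e.
  have : chord x y = chord v v.+1.
    rewrite e /chord; congr [set _; _]; first by rewrite valZpK.
    by apply: val_inj.
  have hv : v < v.+1 <= v + N by clear; lia.
  (* Applied to the family of all edges, the comparison of arcs with equal chord shows that the arc
     itself would have length 1. *)
  move/(chord_arc_eq [set p : parc n | p.2 == ord0] xl hv).
  have -> : has_arc [set p : parc n | p.2 == ord0] v v.+1.
    have vN : v %% N < N by rewrite ltn_mod.
    by apply/exists_inP; exists (Ordinal vN, ord0); rewrite ?inE //= eqxx addn1 eqxx.
  case/exists_inP => p; rewrite inE => /eqP p2 /andP[_ /eqP ey].
  by move: xy; rewrite ey p2 addn1 ltnn.
- apply/forall_inP => _ /in_chords_of_arcs[x [y [_ h ->]]].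
  apply/forall_inP => _ /in_chords_of_arcs[x' [y' [_ h' ->]]].
  apply/negP => /exists_inP[a aD /exists_inP[b bD /exists_inP[v vE /exists_inP[w wE]]]].
  case/and3P => av vb wab.
  have sh u z : has_arc B u z -> has_arc B (u + N + N) (z + N + N) by rewrite !has_arc_shift.
  have [aV bV vV wV] : [/\ a < N + N, b < N + N, v < N + N & w < N + N].
    by rewrite -!double_size !ltn_ord.
  have := chord_ord h aD bD (ltn_trans av vb).
  case/orP: wab => [wa|bw].
    have := chord_ord h' wE vE (ltn_trans wa av) => -[h1|h1] [h2|h2].
    + by apply: (nB w a v b).
    + by apply: (nB b (w + N + N) (a + N + N) (v + N + N)) => //; [clear -bV; lia | clear -wa; lia | clear -av; lia | exact: sh].
    + by apply: (nB a v b (w + N + N)) => //; clear -bV; lia.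
    + by apply: (nB v b (w + N + N) (a + N + N)) => //; [clear -bV; lia | clear -wa; lia].
  have := chord_ord h' vE wE (ltn_trans vb bw) => -[h1|h1] [h2|h2].
  + by apply: (nB a v b w).
  + by apply: (nB v b w (a + N + N)) => //; clear -wV; lia.
  + by apply: (nB w (a + N + N) (v + N + N) (b + N + N)) => //; [clear -wV; lia | clear -av; lia | clear -vb; lia | exact: sh].
  + by apply: (nB b w (a + N + N) (v + N + N)) => //; [clear -wV; lia | clear -av; lia].
rewrite eqEsubset; apply/andP; split; apply/subsetP => D.
  case/imsetP => E /in_chords_of_arcs[x [y [xy h ->]]] ->; rewrite antipode_chord.
  by apply/in_chords_of_arcs; exists (x + N), (y + N); rewrite has_arc_shift -addSn ltn_add2r.
case/in_chords_of_arcs => x [y [xy h ->]]; apply/imsetP; exists (chord (x + N) (y + N)).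
  by apply/in_chords_of_arcs; exists (x + N), (y + N); rewrite has_arc_shift -addSn ltn_add2r.
by rewrite antipode_chord -!addnA -double_size chord_modl chord_modr.
Qed.

Lemma arcs_of_chordsK A : cyclo_dissection A -> chords_of_arcs (arcs_of_chords A) = A.
Proof.
move=> dA; apply/setP => D; apply/idP/idP => [/in_chords_of_arcs[x [y [xy]]]|DA].
  rewrite has_arcs_of_chords // => /andP[_ /orP[/eqP e|cA] -> //].
  by rewrite e ltnn in xy.
apply/in_chords_of_arcs.
have /and3P[/forall_inP/(_ D DA)/andP[/cards2P[u [v [uv De]]] /forallP nD] _ _] := dA.
wlog ltuv : u v uv De / u < v.
  move=> H; case: (ltngtP u v) => [lt|lt|/val_inj e].
  - exact: (H u v).
  - by apply: (H v u); rewrite 1?eq_sym // De setUC.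
  - by rewrite e eqxx in uv.
have va (z : V) : inZp z = z by apply: valZpK.
have Duv : D = chord u v by rewrite De /chord !va.
have ne : v != u.+1 :> nat.
  apply/eqP => e; case/negP: (nD u); rewrite De; apply/eqP; congr [set _; _].
  by apply: val_inj; rewrite /= -e modn_small.
have vN := ltn_ord v; rewrite [X in _ < X]double_size in vN.
have [l|l] := leqP v (u + N).
  exists u, v; split=> //; first by clear -ltuv ne; lia.
  by rewrite has_arcs_of_chords // ltuv l -Duv DA orbT.
exists v, (u + N + N); split.
(* The edge that closes the polygon joins its last vertex to 0 and is not of the form excluded by
   [ne]. *)
- have ne' : ~~ ((u == 0 :> nat) && (v == n.*2.+1 :> nat)).
    apply/negP => /andP[/eqP u0 /eqP v0]; case/negP: (nD v); rewrite De setUC.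
    apply/eqP; congr [set _; _]; apply: val_inj => /=.
    by rewrite v0 u0 modnn.
  by clear -vN ne' l; lia.
- rewrite has_arcs_of_chords //; have -> : chord v (u + N + N) = D.
    by rewrite -addnA -double_size chord_modr chordC.
  by rewrite DA orbT andbT; clear -vN l; lia.
by rewrite -addnA -double_size chord_modr chordC.
Qed.

Lemma chords_of_arcsK B : dissection B -> arcs_of_chords (chords_of_arcs B) = B.
Proof.
move=> dB; have dA := dissection_chords_of_arcs dB.
apply: arcs_ext => x y xN xy; rewrite has_arcs_of_chords // xy /=.
apply/idP/idP => [/orP[/eqP ->|]|h]; first exact: dissection_edge.
  case/in_chords_of_arcs => x' [y' [_ h e]].
  by rewrite (chord_arc_eq B xy (has_arc_len h) e).
case: (eqVneq y x.+1) => //= ne; apply/in_chords_of_arcs; exists x, y; split=> //.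
by clear -ne xy; lia.
Qed.

Lemma arcs_of_chordsS A A' : A \subset A' -> arcs_of_chords A \subset arcs_of_chords A'.
Proof.
by move=> /subsetP s; apply/subsetP => p; rewrite !inE => /orP[->|/s ->]; rewrite ?orbT.
Qed.

Lemma chords_of_arcsS B B' : B \subset B' -> chords_of_arcs B \subset chords_of_arcs B'.
Proof.
move=> /subsetP s; apply/subsetP => D; rewrite !inE => /exists_inP[p pB h].
by apply/exists_inP; exists p => //; apply: s.
Qed.

End Chords.

(** * The face lattice of the cyclohedron *)

Local Open Scope nat_scope.

(** Strict monotonicity makes [r] injective on a chain below [y], which bounds its size; the
    predecessors provide a chain of that size. *)
Lemma rank_eq (disp : Order.disp_t) (T : finTBPOrderType disp) (r : T -> nat) :
  (forall y z : T, (y < z)%O -> r y < r z) ->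
  (forall y : T, 0 < r y -> exists2 z, (z < y)%O & r y = (r z).+1) ->
  forall y : T, rank y = r y.
Proof.
move=> rmono rpred y; apply/eqP; rewrite eqn_leq; apply/andP; split.
  apply/bigmax_leqP => C /andP[/forall_inP Cy /forall_inP Cc].
  case: (set_0Vmem C) => [->|[x0 x0C]]; first by rewrite cards0.
  have ry : 0 < r y by apply: leq_ltn_trans (rmono _ _ (Cy _ x0C)).
  rewrite -(card_ord (r y)).
  pose f x : 'I_(r y).-1.+1 := inord (r x).
  have fE x : x \in C -> f x = r x :> nat.
    by move=> /Cy /rmono h; rewrite inordK // prednK.
  rewrite card_ord -[X in _ <= X](prednK ry) -[X in _ <= X]card_ord.
  rewrite -(card_in_imset (f := f)) ?max_card // => x z xC zC /(congr1 val) /=.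
  rewrite fE // fE // => e.
  case: (comparable_ltgtP (forall_inP (Cc x xC) z zC)) => // /rmono; by rewrite e ltnn.
have [m] := ubnP (r y); elim: m y => // m IH y ym.
have [->//|ry] := posnP (r y).
have [z zy e] := rpred y ry.
by rewrite e (leq_ltn_trans (IH z _) (rank_lt zy)) //; move: ym; rewrite e.
Qed.

Lemma sum_subsets (R : comNzRingType) (T : finType) (E : {set T}) (s q : R) :
  (\sum_(X : {set T} | X \subset E) s ^+ #|X| * q ^+ (#|E| - #|X|) = (s + q) ^+ #|E|)%R.
Proof.
rewrite addrC exprDn.
rewrite (partition_big (fun X : {set T} => inord #|X| : 'I_#|E|.+1) xpredT) //=.
apply: eq_bigr => k _.
transitivity (\sum_(X : {set T} | (X \subset E) && (#|X| == k)) q ^+ (#|E| - k) * s ^+ k)%R.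
  apply: eq_big => [X|X /andP[XE /eqP <-]]; last first.
    by rewrite inordK ?ltnS ?subset_leq_card // mulrC.
  case: (boolP (X \subset E)) => //= XE.
  by rewrite -val_eqE /= inordK // ltnS subset_leq_card.
by rewrite sumr_const -[X in _ = (_ *+ X)%R](cards_draws E k) cardsE.
Qed.

Lemma sum_between (R : comNzRingType) (T : finType) (A B : {set T}) (s q : R) : A \subset B ->
  (\sum_(C : {set T} | (A \subset C) && (C \subset B)) s ^+ (#|C| - #|A|) * q ^+ (#|B| - #|C|)
   = (s + q) ^+ (#|B| - #|A|))%R.
Proof.
move=> AB; have cD : #|B :\: A| = #|B| - #|A| by rewrite cardsD (setIidPr AB).
rewrite -cD -sum_subsets.
rewrite (reindex_onto (fun X : {set T} => A :|: X) (fun C => C :\: A)) /=; last first.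
  by move=> C /andP[sAC _]; rewrite -[in RHS](setID C A) (setIidPr sAC).
apply: eq_big => [X|X /andP[/andP[_ XB] /eqP XD]].
  rewrite subsetUl subUset AB /= setDUl setDv set0U.
  apply/andP/subsetDP => -[XB dX]; split=> //; first exact/setDidPl/eqP.
  exact/eqP/setDidPl.
have dAX : #|A :|: X| = #|A| + #|X|.
  rewrite -XD setDUl setDv set0U cardsU.
  by rewrite setDE setICA setICr setI0 cards0 subn0.
rewrite dAX addKn cD subnDA //.
Qed.

Lemma mul_bin_bin n i j : j <= i -> i <= n -> 'C(n, i) * 'C(i, j) = 'C(n, j) * 'C(n - j, n - i).
Proof.
move=> ji i_n; have jn := leq_trans ji i_n.
have nij : n - i <= n - j by rewrite leq_sub2l.
apply/eqP; rewrite -(eqn_pmul2r (fact_gt0 j)) -(eqn_pmul2r (fact_gt0 (i - j))).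
rewrite -(eqn_pmul2r (fact_gt0 (n - i))); apply/eqP.
have e1 := bin_fact i_n; have e2 := bin_fact ji; have e3 := bin_fact jn; have e4 := bin_fact nij.
have e : n - j - (n - i) = i - j by clear -ji i_n; lia.
rewrite e in e4; transitivity n`!.
  by rewrite -e1 -e2; ring.
by rewrite -e3 -e4; ring.
Qed.

(** Trinomial revision followed by Vandermonde's identity; this is the passage from the h-vector to
    the face numbers. *)
Lemma sum_bin_sqr_bin n j : j <= n ->
  \sum_(i < n.+1) 'C(n, i) * 'C(n, i) * 'C(i, j) = 'C(n, j) * 'C(n.*2 - j, n - j).
Proof.
move=> jn; have -> : 'C(n.*2 - j, n - j) = 'C(n + (n - j), n).
  rewrite -addnn -addnBA // -[RHS]bin_sub ?leq_addr // addKn //.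
rewrite -binomial.Vandermonde big_distrr /=; apply: eq_bigr => i _.
have i_n : i <= n by rewrite -ltnS.
rewrite -mulnA; have [ji|ij] := leqP j i; first by rewrite mul_bin_bin // mulnCA.
have lt : n - j < n - i by move: ij i_n jn; clear; lia.
by rewrite (bin_small ij) (bin_small lt) !muln0.
Qed.

Section Faces.

Variable n : nat.
Local Notation N := n.+1.
Implicit Types (B : {set parc n}) (F G : cyclohedron n).

Definition face_of B : cyclohedron n := insub (chords_of_arcs B).

Definition arcs_of_face F : {set parc n} :=
  if F is Some A then arcs_of_chords (val A) else set0.

Lemma face_ofE B : dissection B ->
  exists2 A : {A : {set {set 'I_(n.*2.+2)}} | cyclo_dissection A},
    face_of B = Some A & val A = chords_of_arcs B.
Proof.
move=> dB; rewrite /face_of; case: insubP => [A _ vA|]; first by exists A.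
by rewrite dissection_chords_of_arcs.
Qed.

Lemma face_ofK B : dissection B -> arcs_of_face (face_of B) = B.
Proof. by move=> dB; have [A -> vA] := face_ofE dB; rewrite /= vA chords_of_arcsK. Qed.

Lemma face_of_neq_bot B : dissection B -> face_of B != \bot%O.
Proof. by move=> dB; have [A -> _] := face_ofE dB. Qed.

Lemma arcs_of_faceK F : F != \bot%O -> face_of (arcs_of_face F) = F.
Proof.
case: F => [A|] // _; rewrite /face_of /= arcs_of_chordsK ?(valP A) //.
exact: valK.
Qed.

Lemma dissection_face F : F != \bot%O -> dissection (arcs_of_face F).
Proof. by case: F => [A|] // _; apply: dissection_arcs_of_chords (valP A). Qed.

Lemma le_face F G : F != \bot%O -> G != \bot%O ->
  (F <= G)%O = (arcs_of_face G \subset arcs_of_face F).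
Proof.
case: F G => [A|] [B|] // _ _; apply/idP/idP; first exact: arcs_of_chordsS.
by move=> /chords_of_arcsS; rewrite !arcs_of_chordsK ?(valP A) ?(valP B).
Qed.

Lemma arcs_of_top : arcs_of_face \top%O = [set p : parc n | p.2 == ord0].
Proof. by apply/setP => p; rewrite !inE orbF. Qed.

Lemma card_face F : F != \bot%O -> N <= #|arcs_of_face F| <= N + n.
Proof.
move=> /dissection_face dF; apply/andP; split.
  exact: card_dissection_ge.
exact: card_dissection_le.
Qed.

(** Vertices have [N + n] arcs and rank 1, with the empty face below them. All other nonempty faces
    get a predecessor from [dissection_extend]. *)
Lemma cyclo_rank F : rank F = if F == \bot%O then 0 else (N + N) - #|arcs_of_face F|.
Proof.
apply: (@rank_eq _ _ (fun F => if F == \bot%O then 0 else (N + N) - #|arcs_of_face F|)).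
  move=> {}F G; have [-> F0|F0 FG] := eqVneq F \bot%O.
    have G0 : G != \bot%O by rewrite -lt0x.
    rewrite (negPf G0); have := card_face G0; lia.
  have G0 : G != \bot%O by rewrite -lt0x (le_lt_trans (le0x F)).
  rewrite (negPf G0).
  have : arcs_of_face G \proper arcs_of_face F.
    by rewrite properE -!le_face // (ltW FG) lt_geF.
  by move/proper_card; have := card_face G0; have := card_face F0; clear; lia.
move=> {}F; case: eqVneq => // F0 _; have cF := card_face F0.
have [lt|ge] := ltnP #|arcs_of_face F| (N + n); last first.
  by exists \bot%O; [rewrite lt0x | rewrite eqxx; move: ge cF; clear; lia].
have [B [dB FB cB]] := dissection_extend (dissection_face F0) lt.
have B0 := face_of_neq_bot dB.
exists (face_of B); last by rewrite (negPf B0) face_ofK // cB; move: lt; clear; lia.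
rewrite lt_neqAle le_face // face_ofK // FB andbT; apply/eqP => e.
by move: cB; rewrite -e face_ofK //; clear; lia.
Qed.

Lemma sum_faces (R : nmodType) (Q : pred {set parc n}) (f : {set parc n} -> R) :
  (\sum_(F : cyclohedron n | (F != \bot%O) && Q (arcs_of_face F)) f (arcs_of_face F)
  = \sum_(B : {set parc n} | dissection B && Q B) f B)%R.
Proof.
rewrite (reindex_onto face_of arcs_of_face) /=; last first.
  by move=> F /andP[F0 _]; apply: arcs_of_faceK.
apply: eq_big => [B|B /andP[/andP[_ _] /eqP ->] //].
apply/andP/andP => [[/andP[B0 QB] /eqP e]|[dB QB]].
  by rewrite -e; split; [apply: dissection_face | move: QB; rewrite !e].
by rewrite face_ofK // face_of_neq_bot // QB eqxx.
Qed.

Lemma dissectionS B B' : B \subset B' -> dissection B' -> [set p : parc n | p.2 == ord0] \subset B ->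
  dissection B.
Proof.
move=> /subsetP BB' /andP[/forall_inP nB' _] /subsetP eB; apply/andP; split.
  apply/forall_inP => p pB; apply/forall_inP => q qB.
  exact: (forall_inP (nB' p (BB' p pB)) q (BB' q qB)).
by apply/forallP => a; apply: eB; rewrite inE.
Qed.

Lemma edges_sub B : dissection B -> [set p : parc n | p.2 == ord0] \subset B.
Proof.
move=> /andP[_ /forallP eB]; apply/subsetP => -[a l]; rewrite inE /= => /eqP ->.
exact: eB.
Qed.

(** A subfamily of a dissection that contains all edges is a dissection, so the faces in between are
    all the sets of arcs in between. *)
Lemma cyclo_boolean (R : comNzRingType) (s q : R) F G : F != \bot%O -> (F <= G)%O ->
  (\sum_(H | (F <= H <= G)%O) s ^+ (rank G - rank H) * q ^+ (rank H - rank F)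
   = (s + q) ^+ (rank G - rank F))%R.
Proof.
move=> F0 FG; have G0 : G != \bot%O by rewrite -lt0x (lt_le_trans _ FG) // lt0x.
have GF : arcs_of_face G \subset arcs_of_face F by rewrite -le_face.
have cF := card_face F0; have cG := card_face G0.
have rk H : H != \bot%O -> rank H = N + N - #|arcs_of_face H|.
  by move=> H0; rewrite cyclo_rank (negPf H0).
rewrite !rk //.
have -> : N + N - #|arcs_of_face G| - (N + N - #|arcs_of_face F|) = #|arcs_of_face F| - #|arcs_of_face G|.
  by move: cF cG; clear; lia.
rewrite -sum_between //.
transitivity (\sum_(H : cyclohedron n | (H != \bot%O) &&
    ((arcs_of_face G \subset arcs_of_face H) && (arcs_of_face H \subset arcs_of_face F)))
  s ^+ (#|arcs_of_face H| - #|arcs_of_face G|) * q ^+ (#|arcs_of_face F| - #|arcs_of_face H|))%R.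
  apply: eq_big => [H|H /andP[FH HG]].
    have [->|H0] := eqVneq H \bot%O; first by rewrite lex0 (negPf F0).
    by rewrite !le_face //= andbC.
  have H0 : H != \bot%O by rewrite -lt0x (lt_le_trans _ FH) // lt0x.
  rewrite rk //; have cH := card_face H0.
  congr (_ ^+ _ * _ ^+ _)%R; move: cF cG cH; clear; lia.
rewrite (sum_faces (fun B => (arcs_of_face G \subset B) && (B \subset arcs_of_face F))
  (fun B => s ^+ (#|B| - #|arcs_of_face G|) * q ^+ (#|arcs_of_face F| - #|B|))%R).
apply: eq_bigl => B; apply: andb_idl => /andP[GB BF].
apply: (dissectionS BF (dissection_face F0)).
exact: subset_trans (edges_sub (dissection_face G0)) GB.
Qed.

Lemma cyclo_rank_top : rank (\top%O : cyclohedron n) = N.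
Proof.
rewrite cyclo_rank arcs_of_top.
have -> : (\top%O : cyclohedron n) == \bot%O = false by [].
have -> : #|[set p : parc n | p.2 == ord0]| = N; last by rewrite addnK.
rewrite -[RHS](card_ord N) -(card_imset (mem 'I_N) (f := fun a => (a, ord0 : 'I_N))); last by move=> a b [].
apply: eq_card => -[a l]; rewrite !inE /=; apply/eqP/imsetP => [->|[b _ [_ ->]] //].
by exists a.
Qed.

Local Open Scope ring_scope.

(** The face numbers give an expansion in powers of t - q; the right-hand side is brought to the
    same form by writing t = (t - q) + q. *)
Lemma cyclo_hom_h_poly : hom_h_poly (\top%O : cyclohedron n)
  = \sum_(i < N) (tvar ^+ i * qvar ^+ (n - i)) *+ ('C(n, i) * 'C(n, i)).
Proof.
rewrite /hom_h_poly cyclo_rank_top.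
transitivity (\sum_(B : {set parc n} | dissection B)
   (tvar - qvar) ^+ (N + n - #|B|) * qvar ^+ (#|B| - N)).
  rewrite -(eq_bigl _ _ (fun B => andbT (dissection B))).
  rewrite -(sum_faces xpredT (fun B => (tvar - qvar) ^+ (N + n - #|B|) * qvar ^+ (#|B| - N))).
  apply: eq_big => [F|F /andP[F0 _]]; first by rewrite lex1.
  have cF := card_face F0; rewrite cyclo_rank (negPf F0).
  by congr (_ ^+ _ * _ ^+ _); move: cF; clear; lia.
rewrite (partition_big (fun B : {set parc n} => inord (#|B| - N) : 'I_N) xpredT) //=.
transitivity (\sum_(k < N) ((tvar - qvar) ^+ (n - k) * qvar ^+ k) *+ ('C(n, k) * 'C(n + k, k))).
  apply: eq_bigr => k _; rewrite -card_dissections -sumr_const.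
  apply: eq_big => [B|B].
    rewrite inE; case: (boolP (dissection B)) => //= dB.
    have cB := card_dissection_le dB; have cB' := card_dissection_ge dB.
    rewrite -val_eqE /= inordK; last by rewrite ltnS leq_subLR.
    by apply/eqP/eqP => [<-|->]; rewrite ?subnKC ?addKn.
  case/andP => dB; have cB := card_dissection_le dB; have cB' := card_dissection_ge dB.
  rewrite -val_eqE /= inordK => [/eqP <-|]; last by rewrite ltnS leq_subLR.
  by rewrite subnBA // addnC.
have -> : \sum_(i < N) (tvar ^+ i * qvar ^+ (n - i)) *+ ('C(n, i) * 'C(n, i))
  = \sum_(i < N) \sum_(j < N) ((tvar - qvar) ^+ j * qvar ^+ (n - j)) *+ ('C(n, i) * 'C(n, i) * 'C(i, j)).
  apply: eq_bigr => i _; rewrite -{1}[tvar](subrKC qvar) exprDn.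
  rewrite mulr_suml -sumrMnl (big_ord_widen N (fun j => (qvar ^+ (i - j) * (tvar - qvar) ^+ j *+ 'C(i, j)
    * qvar ^+ (n - i)) *+ ('C(n, i) * 'C(n, i)))) // big_mkcond /=.
  apply: eq_bigr => j _; case: ltnP => [ji|ij]; last by rewrite (bin_small ij) muln0 mulr0n.
  rewrite mulrnAl -mulrnA mulnC; congr (_ *+ _).
  rewrite mulrC mulrA -exprD mulrC; congr (_ * _ ^+ _).
  by have := ltn_ord i; move: ji; clear; lia.
rewrite exchange_big /= [LHS](reindex_inj rev_ord_inj) /=; apply: eq_bigr => j _.
rewrite sumrMnr sum_bin_sqr_bin // -1?ltnS // subSS subKn //; last by rewrite -ltnS.
have jn : (j <= n)%N by rewrite -ltnS.
by rewrite -(bin_sub jn) addnBA // addnn.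
Qed.

End Faces.

(** * Comparison of the two formulas *)

Local Open Scope ring_scope.

Lemma coef_cyclo_toric_g (n k : nat) : (toric_g (cyclohedron n))`_k
  = \sum_(i < n.+1) tor_coef i (n - i) k *+ ('C(n, i) * 'C(n, i)).
Proof.
rewrite (toric_g_simple (@cyclo_boolean n)) cyclo_rank_top // cyclo_hom_h_poly.
rewrite tor_fun_sum coef_sum; apply: eq_bigr => i _.
have i_n : (i <= n)%N by rewrite -ltnS.
rewrite -mulr_natl -[_%:R](rmorph_nat intr) tor_fun_int tor_fun_monom //; last by rewrite ltnS leq_subr.
rewrite -(rmorph_int polyC) coefCM coef_tor_poly ?subnKC //.
by rewrite intz mulr_natl.
Qed.

(** The terms with [i > 0] vanish; the term [i = 0] is 1 because [binpred 0 0] is 0. *)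
Lemma sum_tor_coef0 n : \sum_(i < n.+1) tor_coef i (n - i) 0 *+ ('C(n, i) * 'C(n, i)) = 1.
Proof.
rewrite big_ord_recl big1 /= => [|i _].
  by rewrite /tor_coef !bin0.
by rewrite /tor_coef /= !bin0 subrr mul0rn.
Qed.

(** Pascal's rule splits the two products in [tor_coef] into [v + phi] and [u + phi']. The sums of
    [u] and [v] agree by the symmetry of the h-vector. Shifting the index in the sum with [phi']
    leaves the differences [c i - c i.+1], which are [schur2 n i (n - i)]. *)
Lemma sum_tor_coefS n k :
  \sum_(i < n.+1) tor_coef i (n - i) k.+1 *+ ('C(n, i) * 'C(n, i)) = minrun_sum n n 1 k.
Proof.
pose c i : int := 'C(n, i)%:Z * 'C(n, i)%:Z.
pose u i : int := (binpred i k.+1 * 'C(n - i, k.+1))%N%:Z.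
pose v i : int := ('C(i, k.+1) * binpred (n - i) k.+1)%N%:Z.
pose phi i : int := ('C(i, k.+1) * binpred (n - i) k)%N%:Z.
pose phi' i : int := (binpred i k.+1 * 'C(n - i, k))%N%:Z.
have uv : \sum_(i < n.+1) c i * u i = \sum_(i < n.+1) c i * v i.
  rewrite (reindex_inj rev_ord_inj) /=; apply: eq_bigr => i _.
  have i_n : (i <= n)%N by rewrite -ltnS.
  by rewrite subSS /c /u /v subKn // bin_sub // mulnC.
have -> : \sum_(i < n.+1) tor_coef i (n - i) k.+1 *+ ('C(n, i) * 'C(n, i))
  = \sum_(i < n.+1) c i * phi i - \sum_(i < n.+1) c i * phi' i.
  transitivity (\sum_(i < n.+1) ((c i * phi i - c i * phi' i) + (c i * v i - c i * u i))).
    apply: eq_bigr => i _; rewrite /c /phi /phi' /u /v /tor_coef -mulr_natl natz.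
    rewrite !PoszM; case: (n - i)%N => [|m] /=; last by rewrite !binS !PoszD; ring.
    by rewrite (bin0n k.+1) binS bin0n /= !add0n; ring.
  by rewrite big_split /= !sumrB uv subrr addr0.
rewrite /minrun_sum big_mkord [X in X - _]big_ord_recr [X in _ - X]big_ord_recl /=.
have -> : phi n = 0 by rewrite /phi subnn muln0.
have -> : phi' 0%N = 0 by [].
rewrite !mulr0 addr0 add0r -sumrB.
apply: eq_bigr => i _; have i_n := ltn_ord i.
rewrite /bump /= add1n /c /phi /phi' /schur2 subn1 /=.
have e : (n - i = (n - i.+1).+1)%N by rewrite subnSK.
have b0 := bin_sub (ltnW i_n); have b1 := bin_sub i_n; rewrite e in b0 *.
rewrite /= b0 b1 !PoszM. ring.
Qed.

Theorem theorem7p3 (n k : nat) (hn : (1 <= n)%N) :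
  (toric_g (cyclohedron n))`_k =
  #|[set f : {ffun 'I_n -> 'I_n} | avoids123 f && (#|ascents f| == k)]|%:Z.
Proof.
rewrite coef_cyclo_toric_g card_avoids123_closed //.
by case: k => [|k]; [exact: sum_tor_coef0 | exact: sum_tor_coefS].
Qed.
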